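(* Let $d\in\mathbb{N}$ and $\Omega:=(0,1)^d$. For all $u\in H^1(\Omega)$, all grid sizes $h$ and each $p\in\mathbb{N}_0$ with $hp<1$, there is a spline approximation $w_{p,h}\in\widetilde{W}_{p,h}(\Omega)$ such that $$\|u-w_{p,h}\|_{L^2(\Omega)}\le\sqrt{2d}\,h\,|u|_{H^1(\Omega)}.$$
   Context: $\mathbb{N}=\{1,2,3,\ldots\}$, $\mathbb{N}_0=\mathbb{N}\cup\{0\}$. A grid size (here for the interval $(0,1)$) is a real $h>0$ such that $n_h:=h^{-1}\in\mathbb{N}$. $|u|_{H^1(\Omega)}^2=\sum_{i=1}^d\|\partial u/\partial x_i\|_{L^2(\Omega)}^2$. $\mathbb{P}^p$ is the space of polynomials of degree at most $p$, and $$S_{p,h}(0,1):=\{u\in H^p(0,1): u|_{(hj,h(j+1)]}\in\mathbb{P}^p\text{ for all }j=0,\ldots,n_h-1\}$$ ($H^0=L^2$). $\widetilde{S}_{p,h}(0,1)$ is the space of all $u_{p,h}\in S_{p,h}(0,1)$ satisfying $\frac{\partial^{2l+1}}{\partial x^{2l+1}}u_{p,h}(0)=\frac{\partial^{2l+1}}{\partial x^{2l+1}}u_{p,h}(1)=0$ for all $l\in\mathbb{N}_0$ with $2l+1<p$. $\widetilde{W}_{p,h}(\Omega):=\bigotimes_{l=1}^d\widetilde{S}_{p,h}(0,1)$ is the tensor-product space, i.e. the linear span of all functions $(x_1,\ldots,x_d)\mapsto s_1(x_1)\cdots s_d(x_d)$ with $s_1,\ldots,s_d\in\widetilde{S}_{p,h}(0,1)$.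 *)

(* Defs.v *)
From HB Require Import structures.
From mathcomp Require Import all_boot all_order all_algebra.
From mathcomp Require Import all_classical all_reals all_analysis.

Set Implicit Arguments.
Unset Strict Implicit.
Unset Printing Implicit Defensive.
Import Order.TTheory GRing.Theory Num.Theory.
Import numFieldNormedType.Exports.
Local Open Scope ring_scope.
Local Open Scope classical_set_scope.

Definition measure_rV_display : measure_display -> measure_display.
Proof. exact. Qed.

Section measurable_rV.
Context {d} {T : sigmaRingType d}.
Variable n : nat.

Definition coord_rV (i : 'I_n) (x : 'rV[T]_n) : T := x ord0 i.

Let rV_set0 : g_sigma_preimage coord_rV set0.
Proof. exact: sigma_algebra0. Qed.

Let rV_setC A : g_sigma_preimage coord_rV A -> g_sigma_preimage coord_rV (~` A).
Proof. exact: sigma_algebraC. Qed.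

Let rV_bigcup (F : _^nat) : (forall i, g_sigma_preimage coord_rV (F i)) ->
  g_sigma_preimage coord_rV (\bigcup_i (F i)).
Proof. exact: sigma_algebra_bigcup. Qed.

(* The product sigma-algebra, generated by the coordinates; for T := R this is
   the Borel sigma-algebra of R^n. *)
HB.instance Definition _ := @isMeasurable.Build (measure_rV_display d)
  'rV[T]_n (g_sigma_preimage coord_rV) rV_set0 rV_setC rV_bigcup.

End measurable_rV.

Lemma measurable_coord_rV d (T : sigmaRingType d) n (i : 'I_n) :
  measurable_fun [set: 'rV[T]_n] (coord_rV i).
Proof.
move=> _ Y mY; rewrite setTI; apply: sub_sigma_algebra => /=.
rewrite -bigcup_seq/=; exists i => /=; first by rewrite mem_index_enum.
by exists Y => //; rewrite setTI.
Qed.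

Lemma measurable_fun_rV d1 d2 (T1 : measurableType d1) (T2 : measurableType d2)
    n (f : T1 -> 'rV[T2]_n) :
  (forall i, measurable_fun [set: T1] (coord_rV i \o f)) ->
  measurable_fun [set: T1] f.
Proof.
move=> mf _ A mA; rewrite setTI; move: A mA.
apply: smallest_sub => /=.
  split => [|A mA|F mF] /=.
  - by rewrite preimage_set0.
  - by rewrite setTD -preimage_setC; exact: measurableC.
  - by rewrite preimage_bigcup; apply: bigcup_measurable => i _; exact: mF.
rewrite -bigcup_seq/=; apply: bigcup_sub => i _ A [B mB <-] /=.
by rewrite setTI; have := mf i measurableT _ mB; rewrite setTI.
Qed.

Section lebesgue_measure_rV.
Context {R : realType}.

Definition cons_rV n (p : 'rV[R]_n * R) : 'rV[R]_n.+1 := row_mx p.2%:M p.1.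

Lemma measurable_cons_rV n : measurable_fun [set: 'rV[R]_n * R] (@cons_rV n).
Proof.
apply: measurable_fun_rV => i.
have [j ->|->] := unliftP ord0 i.
- rewrite (_ : _ \o _ = coord_rV j \o fst).
    by apply: measurableT_comp; [exact: measurable_coord_rV|exact: measurable_fst].
  apply/funext => p /=; rewrite /coord_rV /cons_rV.
  have -> : lift ord0 j = rshift 1 j by exact/val_inj.
  exact: (row_mxEr (p.2%:M : 'M[R]_1) p.1 ord0 j).
- rewrite (_ : _ \o _ = snd); first exact: measurable_snd.
  apply/funext => p /=; rewrite /coord_rV /cons_rV.
  have -> : ord0 = lshift n (ord0 : 'I_1) by exact/val_inj.
  by rewrite (row_mxEl (p.2%:M : 'M[R]_1) p.1 ord0 ord0) mxE.
Qed.

Section succ.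
Variables (n : nat) (m : {measure set 'rV[R]_n -> \bar R}).

Definition lebesgue_rV_succ : set 'rV[R]_n.+1 -> \bar R :=
  pushforward (m \x lebesgue_measure)%E (@cons_rV n).

Let succ0 : lebesgue_rV_succ set0 = 0%E.
Proof. by rewrite /lebesgue_rV_succ /pushforward preimage_set0 measure0. Qed.

Let succ_ge0 A : (0 <= lebesgue_rV_succ A)%E.
Proof. exact: measure_ge0 (m \x lebesgue_measure)%E _. Qed.

Let succ_sigma_additive : semi_sigma_additive lebesgue_rV_succ.
Proof.
have mcons := @measurable_cons_rV n.
by rewrite /lebesgue_rV_succ; exact: measure_semi_sigma_additive.
Qed.

HB.instance Definition _ := isMeasure.Build _ _ _ lebesgue_rV_succ
  succ0 succ_ge0 succ_sigma_additive.
End succ.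

Fixpoint lebesgue_rV n : {measure set 'rV[R]_n -> \bar R} :=
  if n is k.+1 then lebesgue_rV_succ (lebesgue_rV k) else \d_(0 : 'rV[R]_0).

End lebesgue_measure_rV.

(* Functions on an open set D are represented by total functions; their values
   outside D are ignored (f \_ D is f on D and 0 elsewhere). *)
Section L2.
Context {d} {T : measurableType d} {R : realType}.
Variables (mu : {measure set T -> \bar R}) (D : set T).

Definition in_L2 (f : T -> R) : Prop := (f \_ D) \in Lfun mu 2%:E.

Definition L2norm (f : T -> R) : \bar R := 'N[mu]_2%:E[EFin \o (f \_ D)]%E.

End L2.

Definition compactly_supported_in {R : realType} {V : topologicalType}
    (D : set V) (phi : V -> R) : Prop :=
  let supp := closure [set x | phi x != 0] in compact supp /\ supp `<=` D.

Section sobolev_line.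
Context {R : realType}.

Definition test_function (D : set R) (phi : R -> R) : Prop :=
  (forall k x, derivable (derive1n k phi) x 1) /\ compactly_supported_in D phi.

Definition is_weak_derivative (D : set R) (k : nat) (u g : R -> R) : Prop :=
  forall phi, test_function D phi ->
    \int[lebesgue_measure]_(x in D) (u x * derive1n k phi x) =
    (-1) ^+ k * \int[lebesgue_measure]_(x in D) (g x * phi x).

Definition sobolev (D : set R) (p : nat) (u : R -> R) : Prop :=
  in_L2 lebesgue_measure D u /\
  forall k, (k <= p)%N ->
    exists2 g, in_L2 lebesgue_measure D g & is_weak_derivative D k u g.

End sobolev_line.

Section sobolev_rV.
Context {R : realType} {n : nat}.
Implicit Types (D : set 'rV[R]_n) (u g : 'rV[R]_n -> R).

Definition partial (i : 'I_n) (f : 'rV[R]_n -> R) : 'rV[R]_n -> R :=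
  'D_(delta_mx ord0 i) f.

(* C^oo: differentiability of all iterated partial derivatives includes their
   existence and their continuity. *)
Definition smooth_rV (phi : 'rV[R]_n -> R) : Prop :=
  forall (s : seq 'I_n) x, differentiable (foldr partial phi s) x.

Definition test_function_rV D (phi : 'rV[R]_n -> R) : Prop :=
  smooth_rV phi /\ compactly_supported_in D phi.

Definition is_weak_partial D (i : 'I_n) u g : Prop :=
  forall phi, test_function_rV D phi ->
    \int[lebesgue_rV n]_(x in D) (u x * partial i phi x) =
    - \int[lebesgue_rV n]_(x in D) (g x * phi x).

Definition sobolev1 D u : Prop :=
  in_L2 (lebesgue_rV n) D u /\
  forall i, exists2 g, in_L2 (lebesgue_rV n) D g & is_weak_partial D i u g.

(* A chosen square-integrable weak partial derivative; it is unique almost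
   everywhere on D, and the default 0 is not used when u is in H^1(D). *)
Definition weak_partial D (i : 'I_n) u : 'rV[R]_n -> R :=
  xget (fun=> 0)
    [set g | in_L2 (lebesgue_rV n) D g /\ is_weak_partial D i u g].

Definition H1_seminorm D u : \bar R :=
  ((\sum_(i < n) L2norm (lebesgue_rV n) D (weak_partial D i u) ^+ 2) `^ 2^-1)%E.

Definition unit_cube : set 'rV[R]_n := [set x | forall i, 0 < x ord0 i < 1].

End sobolev_rV.
Arguments unit_cube R n : clear implicits.

Section splines.
Context {R : realType}.
Implicit Types (p : nat) (h : R) (s : R -> R).

Definition grid_size h : Prop := 0 < h /\ h^-1 \is a Num.nat.

Definition spline p h s : Prop :=
  sobolev `]0, 1[ p s /\
  forall j, (j < Num.truncn h^-1)%N ->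
    exists2 q : {poly R}, (size q <= p.+1)%N &
      {in `]h * j%:R, h * j.+1%:R], forall x, s x = q.[x]}.

(* On (0,1) a spline of degree p coincides with a function of class C^(p-1)
   that is polynomial near both endpoints, so its derivatives of order k < p
   are classical and have one-sided limits at 0 and at 1: these limits are the
   boundary values. *)
Definition spline_tilde p h s : Prop :=
  spline p h s /\
  forall l : nat, ((2 * l).+1 < p)%N ->
    derive1n (2 * l).+1 s x @[x --> 0^'+] --> 0 /\
    derive1n (2 * l).+1 s x @[x --> 1^'-] --> 0.

Definition tensor_spline_tilde n p h (w : 'rV[R]_n -> R) : Prop :=
  exists (m : nat) (c : 'I_m -> R) (s : 'I_m -> 'I_n -> R -> R),
    (forall k l, spline_tilde p h (s k l)) /\
    forall x, w x = \sum_(k < m) c k * \prod_(l < n) s k l (x ord0 l).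

End splines.

(* Main.v *)
(* In one dimension, with K f(x) = int_0^x f, every spline space satisfying the
   boundary conditions of odd order is R + K(T), where T consists of the splines
   of one degree less whose even derivatives vanish at the endpoints; such a T is
   in turn the image under K of the mean-zero splines of the first kind, again of
   one degree less.  Up to constants K is skew-adjoint, so the estimate
   |(1 - P) K f| <= h |f| for the orthogonal projection P onto one space passes to
   the next by duality; for degree 0 it is the elementary estimate for step
   functions.

   In dimension n + 1, expand u in the head variable on an orthonormal basis of
   the univariate spline space.  For almost every value of the other variables,
   u is a constant plus the primitive of its weak partial derivative in the head
   variable, so the one-dimensional estimate bounds the error of the expansion.
   The coefficients are approximated by induction, and both errors are added by
   the theorem of Pythagoras, while Bessel's inequality controls the partial
   derivatives of the coefficients.  The result is the estimate with constant 1
   in place of sqrt (2d). *)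
From HB Require Import structures.
From mathcomp Require Import all_boot all_order all_algebra.
From mathcomp Require Import all_classical all_reals all_analysis.
From mathcomp Require Import measurable_realfun.
From mathcomp Require Import ring lra.
Require Import Defs.

Set Implicit Arguments.
Unset Strict Implicit.
Unset Printing Implicit Defensive.
Import Order.TTheory GRing.Theory Num.Theory.
Import numFieldNormedType.Exports.
Local Open Scope ring_scope.
Local Open Scope classical_set_scope.

(** * Square-integrable functions *)

(** The duality works on residuals. Let P project onto T and r = (1 - P) f. The next space
    approximates K f with error at most |y|, where y is K r, less its mean when constants are
    available. The boundary term of the skew symmetry of K is a product of two means; once one of
    them is 0, <y, y> = -<r, K y> = -<r, (1 - P) K y>, and the known estimate applied to y in place
    of f bounds this by |f| h |y|. So the constant h passes unchanged from degree to degree.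
    Securing a vanishing mean is what forces two alternating families: one contains the constants,
    the other treats data of mean zero.

    Two kinds of equality coexist. A spline is a concrete function with prescribed values on
    half-open cells, whereas projections and weak derivatives see functions only up to null sets.
    Hence the orthonormal bases consist of true splines, while spanning is required only up to norm
    zero. In several variables, weak derivatives are tested on smooth functions but the coefficients
    are taken against splines; the passage uses that a function annihilated by all test functions
    vanishes almost everywhere. *)

Section square_integrable.
Context d (T : measurableType d) (R : realType).
Variable mu : {measure set T -> \bar R}.
Implicit Types f g : T -> R.

Definition sqint f :=
  measurable_fun setT f /\ (\int[mu]_x ((f x) ^+ 2)%:E < +oo)%E.

Definition ip f g : R := \int[mu]_x (f x * g x).

Lemma sqint_integrable2 f : sqint f -> mu.-integrable setT (EFin \o (fun x => f x ^+ 2)).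
Proof.
move=> [mf foo]; apply/integrableP; split.
  by apply/measurable_EFinP; exact: measurable_funX.
by under eq_integral do rewrite /= ger0_norm ?sqr_ge0//.
Qed.

Lemma sqint_mul f g : sqint f -> sqint g -> mu.-integrable setT (EFin \o (fun x => f x * g x)).
Proof.
move=> Lf Lg; have := integrableD measurableT (sqint_integrable2 Lf) (sqint_integrable2 Lg).
case: Lf Lg => mf _ [mg _].
apply: le_integrable => //.
  by apply/measurable_EFinP; exact: measurable_funM.
move=> x _ /=; rewrite lee_fin [leRHS]ger0_norm ?addr_ge0 ?sqr_ge0//.
have := sqr_ge0 (`|f x| - `|g x|); rewrite normrM.
have := sqr_ge0 (`|f x| + `|g x|); rewrite -(real_normK (num_real (f x))) -(real_normK (num_real (g x))).
nra.
Qed.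

Lemma sqintD f g : sqint f -> sqint g -> sqint (fun x => f x + g x).
Proof.
move=> Lf Lg; have [mf _] := Lf; have [mg _] := Lg; split; first exact: measurable_funD.
have If := sqint_integrable2 Lf; have Ig := sqint_integrable2 Lg.
have := integrableD measurableT (integrableD measurableT If Ig)
  (integrableZl measurableT 2 (sqint_mul Lf Lg)).
move=> /(@integrable_lty _ _ _ mu setT measurableT _); congr (_ < _)%E.
by apply: eq_integral => x _; rewrite -EFinM -!EFinD; congr EFin; ring.
Qed.

Lemma sqintZ (a : R) f : sqint f -> sqint (fun x => a * f x).
Proof.
move=> Lf; have [mf _] := Lf; split; first exact: measurable_funM.
have := integrableZl measurableT (a ^+ 2) (sqint_integrable2 Lf).
move=> /(@integrable_lty _ _ _ mu setT measurableT _); congr (_ < _)%E.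
by apply: eq_integral => x _; rewrite -EFinM; congr EFin; ring.
Qed.

Lemma sqintB f g : sqint f -> sqint g -> sqint (fun x => f x - g x).
Proof.
move=> Lf Lg; have := sqintD Lf (sqintZ (-1) Lg).
by congr sqint; apply/funext => x; rewrite mulN1r.
Qed.

Lemma sqint0 : sqint (fun=> 0).
Proof.
split; first exact: measurable_cst.
by under eq_integral do rewrite expr0n/=; rewrite integral0 ltry.
Qed.

Lemma sqint_sum I (s : seq I) (F : I -> T -> R) :
  (forall i, sqint (F i)) -> sqint (fun x => \sum_(i <- s) F i x).
Proof.
move=> LF; elim: s => [|i s ih].
  have -> : (fun x => \sum_(i <- [::]) F i x) = fun=> 0 by apply/funext => x; rewrite big_nil.
  exact: sqint0.
have -> : (fun x => \sum_(i <- i :: s) F i x) = fun x => F i x + \sum_(i <- s) F i x.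
  by apply/funext => x; rewrite big_cons.
exact: sqintD.
Qed.

Lemma ipC f g : ip f g = ip g f.
Proof. by rewrite /ip; under eq_Rintegral do rewrite mulrC. Qed.

Lemma ipDl f g k : sqint f -> sqint g -> sqint k ->
  ip (fun x => f x + g x) k = ip f k + ip g k.
Proof.
move=> Lf Lg Lk; rewrite /ip -RintegralD//; [|exact: sqint_mul..].
by under eq_Rintegral do rewrite mulrDl.
Qed.

Lemma ipZl a f g : sqint f -> sqint g -> ip (fun x => a * f x) g = a * ip f g.
Proof.
move=> Lf Lg; rewrite /ip -RintegralZl//; last exact: sqint_mul.
by under eq_Rintegral do rewrite -mulrA.
Qed.

Lemma ipBl f g k : sqint f -> sqint g -> sqint k ->
  ip (fun x => f x - g x) k = ip f k - ip g k.
Proof.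
move=> Lf Lg Lk; rewrite /ip -RintegralB//; [|exact: sqint_mul..].
by under eq_Rintegral do rewrite mulrBl.
Qed.

Lemma ip0l g : ip (fun=> 0) g = 0.
Proof. by rewrite /ip /Rintegral; under eq_integral do rewrite mul0r; rewrite integral0. Qed.

Lemma ip_suml I (s : seq I) (F : I -> T -> R) g : (forall i, sqint (F i)) -> sqint g ->
  ip (fun x => \sum_(i <- s) F i x) g = \sum_(i <- s) ip (F i) g.
Proof.
move=> LF Lg; elim: s => [|i s ih].
  by rewrite big_nil -[RHS](ip0l g); congr ip; apply/funext => x; rewrite big_nil.
rewrite big_cons -ih -ipDl//; last exact: sqint_sum.
by congr ip; apply/funext => x; rewrite big_cons.
Qed.

Lemma ipDr f g k : sqint f -> sqint g -> sqint k ->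
  ip k (fun x => f x + g x) = ip k f + ip k g.
Proof. by move=> *; rewrite ipC ipDl// ipC [X in _ + X]ipC. Qed.

Lemma ipBr f g k : sqint f -> sqint g -> sqint k ->
  ip k (fun x => f x - g x) = ip k f - ip k g.
Proof. by move=> *; rewrite ipC ipBl// ipC [X in _ - X]ipC. Qed.

Lemma ipZr a f g : sqint f -> sqint g -> ip g (fun x => a * f x) = a * ip g f.
Proof. by move=> *; rewrite ipC ipZl// ipC. Qed.

Lemma ip_ge0 f : 0 <= ip f f.
Proof. by apply: Rintegral_ge0 => x _; rewrite -expr2 sqr_ge0. Qed.

Lemma sqnormE f : sqint f -> (\int[mu]_x ((f x) ^+ 2)%:E)%E = (ip f f)%:E.
Proof.
move=> Lf; rewrite /ip /Rintegral fineK//.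
exact: integrable_fin_num (sqint_mul Lf Lf).
Qed.

(** At a = <g,g>, b = <f,g> the form |a f - b g|^2 is <g,g> times the defect, and a = <f,g>, b =
    <f,f> gives the same with <f,f>. If both norms vanish, a = 1 and b = <f,g> leave -2 <f,g>^2 >=
    0. *)
Lemma cauchy_schwarz f g : sqint f -> sqint g -> ip f g ^+ 2 <= ip f f * ip g g.
Proof.
move=> Lf Lg.
have H (a b : R) : 0 <= a ^+ 2 * ip f f - 2 * a * b * ip f g + b ^+ 2 * ip g g.
  have Laf := sqintZ a Lf; have Lbg := sqintZ b Lg.
  have := ip_ge0 (fun x => a * f x - b * g x).
  rewrite ipBl ?ipBr//; [|exact: sqintB..].
  rewrite !ipZl// !ipZr// (ipC g f) => h; apply: le_trans h _.
  by rewrite le_eqVlt; apply/orP; left; apply/eqP; ring.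
have f0 := ip_ge0 f; have g0 := ip_ge0 g.
have := H (ip g g) (ip f g); have := H (ip f g) (ip f f).
have := H 1 (ip f g); have := H (ip f g) 1.
have [->|gn0] := eqVneq (ip g g) 0; last first.
  have gp : 0 < ip g g by rewrite lt_def gn0.
  move=> _ _ _ h; rewrite -subr_ge0 -(pmulr_rge0 _ gp); apply: le_trans h _.
  by rewrite le_eqVlt; apply/orP; left; apply/eqP; ring.
have [f00|fn0] := eqVneq (ip f f) 0.
  by rewrite f00; nra.
have fp : 0 < ip f f by rewrite lt_def fn0.
move=> _ _ h _; rewrite -subr_ge0 -(pmulr_rge0 _ fp); apply: le_trans h _.
by rewrite le_eqVlt; apply/orP; left; apply/eqP; ring.
Qed.

Lemma ip_eq0l f g : sqint f -> sqint g -> ip f f = 0 -> ip f g = 0.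
Proof.
move=> Lf Lg f0; apply/eqP; rewrite -sqrf_eq0 eq_le sqr_ge0 andbT.
by rewrite (le_trans (cauchy_schwarz Lf Lg))// f0 mul0r.
Qed.

Definition orthonormal N (e : 'I_N -> T -> R) :=
  (forall i, sqint (e i)) /\ forall i j, ip (e i) (e j) = (i == j)%:R.

Definition lincomb N (e : 'I_N -> T -> R) (c : 'I_N -> R) : T -> R :=
  fun x => \sum_(i < N) c i * e i x.

Definition oproj N (e : 'I_N -> T -> R) f := lincomb e (fun i => ip f (e i)).

Lemma sqint_lincomb N (e : 'I_N -> T -> R) c : (forall i, sqint (e i)) -> sqint (lincomb e c).
Proof. by move=> Le; apply: sqint_sum => i; exact: sqintZ. Qed.

Lemma ip_lincomb N (e : 'I_N -> T -> R) c g : (forall i, sqint (e i)) -> sqint g ->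
  ip (lincomb e c) g = \sum_(i < N) c i * ip (e i) g.
Proof.
move=> Le Lg; rewrite /lincomb ip_suml//; last by move=> i; exact: sqintZ.
by apply: eq_bigr => i _; rewrite ipZl.
Qed.

Lemma ip_lincomb_ortho N (e : 'I_N -> T -> R) c j : orthonormal e ->
  ip (lincomb e c) (e j) = c j.
Proof.
move=> [Le oe]; rewrite ip_lincomb// (bigD1 j)//= oe eqxx mulr1 big1 ?addr0// => i ij.
by rewrite oe (negbTE ij) mulr0.
Qed.

(** Completing the square in each coefficient. The coefficients are arbitrary so that the formula
    covers both the projection, where the last sum is 0, and the perturbed coefficients of the
    induction on the dimension. *)
Lemma pythagoras N (e : 'I_N -> T -> R) c f : orthonormal e -> sqint f ->
  let r := fun x => f x - lincomb e c x in
  ip r r = ip f f - \sum_(i < N) ip f (e i) ^+ 2 + \sum_(i < N) (ip f (e i) - c i) ^+ 2.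
Proof.
move=> [Le oe] Lf r; rewrite /r.
have Lc := sqint_lincomb c Le.
rewrite ipBl ?ipBr//; last exact: sqintB.
rewrite (ipC f (lincomb e c)) ip_lincomb//.
rewrite [ip (lincomb e c) (lincomb e c)]ip_lincomb//.
have -> : \sum_(i < N) c i * ip (e i) (lincomb e c) = \sum_(i < N) c i ^+ 2.
  by apply: eq_bigr => i _; rewrite ipC ip_lincomb_ortho// expr2.
rewrite -!addrA; congr (_ + _).
rewrite opprD opprK addrA -opprD -big_split/=.
rewrite -!sumrN -!big_split/=; apply: eq_bigr => i _.
by rewrite (ipC (e i)); ring.
Qed.

Lemma oproj_ortho N (e : 'I_N -> T -> R) f j : orthonormal e -> sqint f ->
  ip (fun x => f x - oproj e f x) (e j) = 0.
Proof.
move=> oe Lf; have Le := oe.1; rewrite ipBl//; last exact: sqint_lincomb.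
by rewrite ip_lincomb_ortho// subrr.
Qed.

Lemma ip_oproj_residual N (e : 'I_N -> T -> R) f : orthonormal e -> sqint f ->
  let r := fun x => f x - oproj e f x in
  ip r r = ip f f - \sum_(i < N) ip f (e i) ^+ 2.
Proof.
move=> oe Lf; rewrite /= /oproj pythagoras// [X in _ + X]big1 ?addr0//.
by move=> i _; rewrite subrr expr0n.
Qed.

Lemma bessel N (e : 'I_N -> T -> R) f : orthonormal e -> sqint f ->
  \sum_(i < N) ip f (e i) ^+ 2 <= ip f f.
Proof. by move=> oe Lf; rewrite -subr_ge0 -ip_oproj_residual// ip_ge0. Qed.

Lemma oproj_best N (e : 'I_N -> T -> R) c f : orthonormal e -> sqint f ->
  let r := fun x => f x - oproj e f x in
  let r' := fun x => f x - lincomb e c x in ip r r <= ip r' r'.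
Proof.
move=> oe Lf; rewrite /= ip_oproj_residual// pythagoras// lerDl.
by apply: sumr_ge0 => i _; exact: sqr_ge0.
Qed.

Lemma ip_residual_lincomb N (e : 'I_N -> T -> R) c f : orthonormal e -> sqint f ->
  ip (fun x => f x - oproj e f x) (lincomb e c) = 0.
Proof.
move=> oe Lf; have Le := oe.1; rewrite ipC ip_lincomb//; last first.
  by apply: sqintB => //; exact: sqint_lincomb.
by rewrite big1// => i _; rewrite ipC oproj_ortho// mulr0.
Qed.

(* A residual of norm zero stands for equality almost everywhere. *)
Definition aespan N (e : 'I_N -> T -> R) f :=
  let r := fun x => f x - oproj e f x in ip r r = 0.

(** The predicate [C] stands for the spline space: the orthonormal functions belong to it pointwise,
    whereas the generators are recovered only up to norm zero. A generator whose residual has norm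
    zero is dropped. *)
Lemma gram_schmidt (C : (T -> R) -> Prop) m (s : 'I_m -> T -> R) :
  C (fun=> 0) ->
  (forall a f g, C f -> C g -> C (fun x => a * f x + g x)) ->
  (forall i, sqint (s i)) -> (forall i, C (s i)) ->
  exists N (e : 'I_N -> T -> R),
    [/\ orthonormal e, forall i, C (e i) & forall i, aespan e (s i)].
Proof.
move=> C0 CD; elim: m s => [|m ih] s Ls Cs.
  by exists 0%N, (fun=> fun=> 0); split => [||[]//]; [split => -[]|case].
have [N [e [oe Ce se]]] := ih (fun i => s (lift ord0 i)) (fun i => Ls _) (fun i => Cs _).
pose f := s ord0; pose r := fun x => f x - oproj e f x.
have Le := oe.1; have Lf : sqint f by exact: Ls.
have Lr : sqint r by apply: sqintB => //; exact: sqint_lincomb.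
have [r0|rn0] := eqVneq (ip r r) 0.
  exists N, e; split; [exact: oe|exact: Ce|move=> i].
  by have [j ->|->] := unliftP ord0 i; [exact: se|exact: r0].
have Clin (c : 'I_N -> R) : C (lincomb e c).
  rewrite /lincomb; elim: (index_enum _) => [|i l ihl].
    by have -> : (fun x => \sum_(i <- [::]) c i * e i x) = fun=> 0
      by apply/funext => x; rewrite big_nil.
  have -> : (fun x => \sum_(i <- i :: l) c i * e i x) =
            fun x => c i * e i x + \sum_(i <- l) c i * e i x.
    by apply/funext => x; rewrite big_cons.
  exact: CD.
have Cr : C r.
  have -> : r = fun x => -1 * oproj e f x + f x.
    by apply/funext => x; rewrite /r; ring.
  by apply: CD => //; [exact: Clin|exact: Cs].
have rp : 0 < ip r r by rewrite lt_def rn0 ip_ge0.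
pose n := Num.sqrt (ip r r); have np : 0 < n by rewrite sqrtr_gt0.
pose e0 := fun x => n^-1 * r x.
have Le0 : sqint e0 by exact: sqintZ.
pose e' := fun i : 'I_N.+1 => if unlift ord0 i is Some j then e j else e0.
have e'0 : e' ord0 = e0 by rewrite /e' unlift_none.
have e'S j : e' (lift ord0 j) = e j by rewrite /e' liftK.
have Le' i : sqint (e' i).
  by have [j ->|->] := unliftP ord0 i; rewrite ?e'S ?e'0.
have oe' : orthonormal e'.
  split=> // i j.
  have e0e k : ip e0 (e k) = 0.
    by rewrite ipZl// oproj_ortho ?mulr0.
  have [i' ->|->] := unliftP ord0 i; have [j' ->|->] := unliftP ord0 j;
    rewrite ?e'S ?e'0.
  - by rewrite oe.2 (inj_eq lift_inj).
  - by rewrite ipC e0e eq_sym (negbTE (neq_lift _ _)).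
  - by rewrite e0e (negbTE (neq_lift _ _)).
  - rewrite eqxx ipZl// ipZr// -[ip r r]sqr_sqrtr ?ltW// -/n.
    by rewrite expr2 mulKf ?gt_eqF// mulVf// gt_eqF.
exists N.+1, e'; split=> //.
  move=> i; have [j ->|->] := unliftP ord0 i; rewrite ?e'S ?e'0//.
  have -> : e0 = fun x => n^-1 * r x + (fun=> 0) x by apply/funext => x; rewrite addr0.
  exact: CD.
(* By optimality of the projection it suffices to exhibit one combination of [e'] with error of norm
   zero: the old projection for an old generator, and that of [f] plus [n] times [e0] for the new
   one. *)
move=> i; apply/eqP; rewrite eq_le ip_ge0 andbT.
have [j ->|->] := unliftP ord0 i.
  rewrite -(se j).
  pose c := fun i => if unlift ord0 i is Some k then ip (s (lift ord0 j)) (e k) else 0.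
  have := oproj_best c oe' (Ls (lift ord0 j)).
  congr (_ <= ip _ _); apply/funext => x; congr (_ - _);
  by rewrite /oproj /lincomb big_ord_recl /c unlift_none mul0r add0r;
    apply: eq_bigr => k _; rewrite liftK e'S.
pose c := fun i => if unlift ord0 i is Some k then ip f (e k) else n.
have := oproj_best c oe' Lf; rewrite -/f => h; apply: le_trans h _ => /=.
have -> : (fun x => f x - lincomb e' c x) = fun=> 0.
  apply/funext => x; rewrite /lincomb big_ord_recl /c unlift_none e'0 /e0 mulrA.
  rewrite mulfV ?gt_eqF// mul1r (eq_bigr (fun k => ip f (e k) * e k x)).
    by rewrite -[\sum_(_ < _) _]/(oproj e f x) subrK subrr.
  by move=> k _; rewrite liftK e'S.
by rewrite ip0l.
Qed.

End square_integrable.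

(** * Measures restricted to the unit interval and to the unit cube *)

Section restricted_integral.
Context d (T : measurableType d) (R : realType).
Variables (mu nu : {measure set T -> \bar R}) (D : set T).
Hypothesis mD : measurable D.
Hypothesis nuE : forall A, measurable A -> nu A = mu (A `&` D).

Lemma integral_restricted (f : T -> \bar R) : measurable_fun setT f ->
  (\int[nu]_x f x = \int[mu]_(x in D) f x)%E.
Proof.
move=> mf.
have H (g : T -> \bar R) : measurable_fun setT g -> (forall x, 0 <= g x)%E ->
    (\int[nu]_x g x = \int[mu]_(x in D) g x)%E.
  move=> mg g0; rewrite (@ge0_negligible_integral _ _ _ nu setT (~` D))//.
  - rewrite setTD setCK; apply: eq_measure_integral => A mA AD.
    by rewrite nuE// setIidl.
  - exact: measurableC.
  - by rewrite nuE ?setICl ?measure0//; exact: measurableC.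
by rewrite integralE [in RHS]integralE !H//; [exact: measurable_funeneg|exact: measurable_funepos].
Qed.

End restricted_integral.

Section unit_interval_measure.
Context (R : realType).

Definition unit_itv : set R := `]0, 1[%classic.

Lemma measurable_unit_itv : measurable (unit_itv : set (measurableTypeR R)).
Proof. exact: measurable_itv. Qed.

(** Restricting the measure instead of the domain of integration gives a probability measure on the
    whole line: constants are square integrable, and total functions need no domain conditions. *)
Definition mu01 (A : set (measurableTypeR R)) : \bar R := lebesgue_measure (A `&` unit_itv).

Let mu01_0 : mu01 set0 = 0%E. Proof. by rewrite /mu01 set0I measure0. Qed.

Let mu01_ge0 A : (0 <= mu01 A)%E. Proof. exact: measure_ge0. Qed.

Let mu01_sigma_additive : semi_sigma_additive mu01.
Proof.
exact: (@measure_semi_sigma_additive _ _ _ (mrestr lebesgue_measure measurable_unit_itv)).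
Qed.

HB.instance Definition _ := isMeasure.Build _ _ _ mu01 mu01_0 mu01_ge0 mu01_sigma_additive.

Lemma mu01T : mu01 setT = 1%E.
Proof. by rewrite /mu01 setTI lebesgue_measure_itv/= lte_fin ltr01 oppr0 adde0. Qed.

Let mu01_finite : fin_num_fun mu01.
Proof.
move=> A mA; rewrite ge0_fin_numE// (@le_lt_trans _ _ (mu01 setT))//.
  by rewrite le_measure// inE.
by rewrite mu01T ltry.
Qed.

HB.instance Definition _ := @Measure_isFinite.Build _ _ _ mu01 mu01_finite.

Lemma integral_mu01 (f : measurableTypeR R -> \bar R) : measurable_fun setT f ->
  (\int[mu01]_x f x = \int[lebesgue_measure]_(x in unit_itv) f x)%E.
Proof. by move=> mf; apply: integral_restricted => //; exact: measurable_unit_itv. Qed.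

End unit_interval_measure.
Arguments unit_itv R : clear implicits.
Arguments mu01 R : clear implicits.


Section cube_measure.
Context (R : realType).

Lemma measurable_unit_cube n : measurable (unit_cube R n).
Proof.
have -> : unit_cube R n = \bigcap_(i in [set: 'I_n]) (coord_rV i @^-1` unit_itv R).
  apply/seteqP; split=> x /=.
    by move=> h i _; rewrite /unit_itv /= in_itv/=; exact: h.
  by move=> h i; have := h i Logic.I; rewrite /unit_itv /= in_itv.
apply: fin_bigcap_measurable => [|i _]; first exact: finite_finset.
rewrite -[X in measurable X]setTI; apply: measurable_coord_rV => //.
exact: measurable_unit_itv.
Qed.

Variable n : nat.

Definition mucube (A : set 'rV[R]_n) : \bar R := lebesgue_rV n (A `&` unit_cube R n).

Let mucube_0 : mucube set0 = 0%E. Proof. by rewrite /mucube set0I measure0. Qed.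

Let mucube_ge0 A : (0 <= mucube A)%E. Proof. exact: measure_ge0. Qed.

Let mucube_sigma_additive : semi_sigma_additive mucube.
Proof.
exact: (@measure_semi_sigma_additive _ _ _ (mrestr (lebesgue_rV n) (@measurable_unit_cube n))).
Qed.

HB.instance Definition _ := isMeasure.Build _ _ _ mucube
  mucube_0 mucube_ge0 mucube_sigma_additive.

Lemma integral_mucube (f : 'rV[R]_n -> \bar R) : measurable_fun setT f ->
  (\int[mucube]_x f x = \int[lebesgue_rV n]_(x in unit_cube R n) f x)%E.
Proof. by apply: integral_restricted => //; exact: measurable_unit_cube. Qed.

End cube_measure.
Arguments mucube R n : clear implicits.

Section cube_succ.
Context (R : realType).

Lemma unit_cube_cons n (p : 'rV[R]_n * R) :
  unit_cube R n.+1 (cons_rV p) <-> unit_cube R n p.1 /\ unit_itv R p.2.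
Proof.
have E0 : cons_rV p ord0 ord0 = p.2.
  have -> : ord0 = lshift n (ord0 : 'I_1) :> 'I_n.+1 by exact/val_inj.
  by rewrite /cons_rV (row_mxEl (p.2%:M : 'M[R]_1) p.1 ord0 ord0) mxE.
have ES j : cons_rV p ord0 (lift ord0 j) = p.1 ord0 j.
  have -> : lift ord0 j = rshift 1 j by exact/val_inj.
  by rewrite /cons_rV (row_mxEr (p.2%:M : 'M[R]_1) p.1 ord0 j).
split=> [h|[h1 h2] i].
  split=> [j|]; first by rewrite -ES; exact: h.
  by rewrite /unit_itv/= in_itv/= -E0; exact: h.
have [j ->|->] := unliftP ord0 i; first by rewrite ES.
by rewrite E0; move: h2; rewrite /unit_itv/= in_itv.
Qed.

(** A section over a tail outside the cube is empty, so cutting down to the cube commutes with the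
    product construction of [lebesgue_rV]. *)
Lemma mucube_succ n (A : set 'rV[R]_n.+1) : measurable A ->
  mucube R n.+1 A = (mucube R n \x mu01 R)%E (@cons_rV R n @^-1` A).
Proof.
move=> mA; have mc := @measurable_cons_rV R n.
have mcA : measurable (@cons_rV R n @^-1` A) by rewrite -[X in measurable X]setTI; exact: mc.
rewrite /mucube /= /lebesgue_rV_succ /pushforward /product_measure1.
rewrite -/(mucube R n) integral_mucube; last exact: measurable_fun_xsection.
rewrite [in RHS]integral_mkcond; apply: eq_integral => X _ /=.
rewrite patchE; case: ifPn => XD; rewrite /mu01 /=.
  congr (lebesgue_measure _).
  apply/seteqP; split=> t; rewrite /xsection /= !inE /=.
    by move=> [At /unit_cube_cons[]].
  move=> [At tu]; split => //; apply/unit_cube_cons; split=> //.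
  by move: XD; rewrite inE.
rewrite [X in lebesgue_measure X](_ : _ = set0) ?measure0//.
apply/seteqP; split=> t //; rewrite /xsection /= !inE /=.
by move=> [_ /unit_cube_cons[/= XC _]]; move: XD; rewrite notin_setE.
Qed.

Lemma mucube_finite n : fin_num_fun (mucube R n).
Proof.
elim: n => [|n ih] A mA.
  rewrite /mucube /= ge0_fin_numE//.
  by apply: le_lt_trans (ltry 1); rewrite diracE; case: (_ \in _); rewrite ?lee01.
have AT : (mucube R n.+1 A <= mucube R n.+1 setT)%E by rewrite le_measure// inE.
rewrite ge0_fin_numE// (le_lt_trans AT)// mucube_succ// preimage_setT -setXTT.
rewrite product_measure1E//= mu01T mule1.
by rewrite -ge0_fin_numE//; exact: ih.
Qed.

HB.instance Definition _ n := @Measure_isFinite.Build _ _ _ (mucube R n) (@mucube_finite n).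

End cube_succ.

(** * Almost everywhere statements, finite measures and product measures *)

Section ae_lemmas.
Context d (T : measurableType d) (R : realType) (mu : {measure set T -> \bar R}).
Implicit Types f g : T -> R.

Lemma ae_mono (P Q : T -> Prop) : (forall x, P x -> Q x) ->
  {ae mu, forall x, P x} -> {ae mu, forall x, Q x}.
Proof. by move=> PQ; apply: filterS. Qed.

Lemma ae_and (P Q : T -> Prop) :
  {ae mu, forall x, P x} -> {ae mu, forall x, Q x} -> {ae mu, forall x, P x /\ Q x}.
Proof. by move=> aP aQ; apply: filterI. Qed.

Lemma integrable_EFin_sum I (s : seq I) (F : I -> T -> R) :
  (forall i, mu.-integrable setT (EFin \o F i)) ->
  mu.-integrable setT (EFin \o (fun x => \sum_(i <- s) F i x)).
Proof.
move=> IF; have : mu.-integrable setT (fun x => \sum_(i <- s) (F i x)%:E)%E.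
  by apply: integrable_sum => // i _; exact: IF.
by congr integrable; apply/funext => x; rewrite /= -sumEFin.
Qed.

Lemma Rintegral_sum I (s : seq I) (F : I -> T -> R) :
  (forall i, mu.-integrable setT (EFin \o F i)) ->
  \int[mu]_x (\sum_(i <- s) F i x) = \sum_(i <- s) \int[mu]_x F i x.
Proof.
move=> IF; elim: s => [|i s ih].
  by rewrite big_nil; under eq_Rintegral do rewrite big_nil; rewrite /Rintegral integral0.
under eq_Rintegral do rewrite big_cons.
by rewrite RintegralD ?ih ?big_cons//; exact: integrable_EFin_sum.
Qed.

Lemma ae_eq_Rintegral f g : measurable_fun setT f -> measurable_fun setT g ->
  {ae mu, forall x, f x = g x} -> \int[mu]_x f x = \int[mu]_x g x.
Proof.
move=> mf mg fg; rewrite /Rintegral; congr fine; apply: ae_eq_integral => //.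
- exact/measurable_EFinP.
- exact/measurable_EFinP.
- by apply: filterS fg => x -> _.
Qed.

Lemma ae_le_Rintegral f g : mu.-integrable setT (EFin \o f) ->
  mu.-integrable setT (EFin \o g) -> (forall x, 0 <= f x) -> (forall x, 0 <= g x) ->
  {ae mu, forall x, f x <= g x} -> \int[mu]_x f x <= \int[mu]_x g x.
Proof.
move=> If Ig f0 g0 fg; apply: fine_le.
- exact: integrable_fin_num If.
- exact: integrable_fin_num Ig.
apply: ae_ge0_le_integral => //.
- by move=> x _; rewrite lee_fin.
- exact: measurable_int If.
- by move=> x _; rewrite lee_fin.
- exact: measurable_int Ig.
- by apply: filterS fg => x fgx _; rewrite lee_fin.
Qed.

Lemma ae_eq_ipr f g k : measurable_fun setT f -> measurable_fun setT g -> measurable_fun setT k ->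
  {ae mu, forall x, f x = g x} -> ip mu f k = ip mu g k.
Proof.
move=> mf mg mk fg; apply: ae_eq_Rintegral; [exact: measurable_funM..|].
by apply: filterS fg => x ->.
Qed.

Lemma ae_sqint_eq f g : measurable_fun setT g -> {ae mu, forall x, f x = g x} ->
  sqint mu f -> sqint mu g.
Proof.
move=> mg fg [mf f2]; split=> //; rewrite (_ : integral _ _ _ = \int[mu]_x ((f x) ^+ 2)%:E)%E//.
apply: ae_eq_integral => //.
- by apply/measurable_EFinP; exact: measurable_funX.
- by apply/measurable_EFinP; exact: measurable_funX.
- by apply: filterS fg => x ->.
Qed.

End ae_lemmas.

Section finite_sqint.
Context d (T : measurableType d) (R : realType) (mu : {finite_measure set T -> \bar R}).
Implicit Types f g : T -> R.

Lemma sqint_bounded f M : measurable_fun setT f -> (forall x, `|f x| <= M) -> sqint mu f.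
Proof.
move=> mf fM; split=> //.
apply: (@le_lt_trans _ _ (\int[mu]_x (M ^+ 2)%:E)%E).
  apply: ge0_le_integral => //.
  - by move=> x _; rewrite lee_fin sqr_ge0.
  - by apply/measurable_EFinP; exact: measurable_funX.
  - move=> x _; rewrite lee_fin -real_normK ?num_real// lerXn2r ?nnegrE//.
    exact: le_trans (fM x).
rewrite integral_cst// lte_mul_pinfty ?lee_fin ?sqr_ge0//.
by rewrite -ge0_fin_numE//; exact: fin_num_measure.
Qed.

Lemma sqint_cst (c : R) : sqint mu (fun=> c).
Proof. by apply: (@sqint_bounded _ `|c|). Qed.

Lemma sqint_integrable f : sqint mu f -> mu.-integrable setT (EFin \o f).
Proof.
move=> Lf; have := sqint_mul Lf (sqint_cst 1); congr integrable.
by apply/funext => x /=; rewrite mulr1.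
Qed.

Lemma ip_cstr f : ip mu f (fun=> 1) = \int[mu]_x f x.
Proof. by rewrite /ip; under eq_Rintegral do rewrite mulr1. Qed.

End finite_sqint.

Section product_measure.
Context d1 d2 (T1 : measurableType d1) (T2 : measurableType d2) (R : realType).
Variable m1 : {finite_measure set T1 -> \bar R}.
Variable m2 : {finite_measure set T2 -> \bar R}.
Local Notation P := (m1 \x m2)%E.
Implicit Types F u : T1 * T2 -> R.

(** The real-valued integral turns an infinite value into 0, so it is dominated by [fubini_F] at
    every [X], including the null set of sections that are not integrable. *)
Lemma integrable_section1 F : P.-integrable setT (EFin \o F) ->
  m1.-integrable setT (EFin \o (fun X => \int[m2]_t F (X, t))).
Proof.
move=> IF; apply: (le_integrable measurableT _ _ (integrable_fubini_F IF)).
  apply/measurable_EFinP; apply: measurableT_comp => //.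
  exact: measurable_fubini_F IF.
by move=> X _ /=; rewrite /Rintegral /fubini_F; case: (integral _ _ _) => //=; rewrite leey.
Qed.

Lemma Rintegral_section1 F : P.-integrable setT (EFin \o F) ->
  \int[P]_z F z = \int[m1]_X \int[m2]_t F (X, t).
Proof.
move=> IF; rewrite /Rintegral -integral12_prod_meas1//; congr fine.
apply: ae_eq_integral => //.
- exact: measurable_fubini_F IF.
- exact: measurable_int (integrable_section1 IF).
- have := integrable_ae measurableT (integrable_fubini_F IF).
  by apply: filterS => X h /h fX; rewrite fineK.
Qed.

Lemma measurable_section u X : measurable_fun setT u -> measurable_fun setT (fun t => u (X, t)).
Proof. by move=> mu; apply: measurableT_comp => //; exact: pair1_measurable. Qed.

Let integrable_fubini_G F : P.-integrable setT (EFin \o F) ->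
  m2.-integrable setT (fubini_G m1 (EFin \o F)).
Proof.
move=> IF; have mF := measurable_int _ IF; have [_ Foo] := integrableP _ _ _ IF.
apply/integrableP; split; first exact: measurable_fubini_G IF.
have maF : measurable_fun setT (abse \o (EFin \o F)) by exact: measurableT_comp mF.
have aF0 z : (0 <= (abse \o (EFin \o F)) z)%E by exact: abse_ge0.
have := fubini_tonelli2 (m1 := m1) (m2 := m2) _ maF aF0 => /= FE; rewrite FE {FE} in Foo.
apply: le_lt_trans Foo; apply: ge0_le_integral => //.
- by apply: measurableT_comp => //; exact: measurable_fubini_G IF.
- exact: (measurable_fun_fubini_tonelli_G _ maF aF0).
move=> t _; apply: le_abse_integral => //.
by apply: measurableT_comp mF _; exact: pair2_measurable.
Qed.

Lemma integrable_section2 F : P.-integrable setT (EFin \o F) ->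
  m2.-integrable setT (EFin \o (fun t => \int[m1]_X F (X, t))).
Proof.
move=> IF; apply: (le_integrable measurableT _ _ (integrable_fubini_G IF)).
  apply/measurable_EFinP; apply: measurableT_comp => //.
  exact: measurable_fubini_G IF.
by move=> X _ /=; rewrite /Rintegral /fubini_G; case: (integral _ _ _) => //=; rewrite leey.
Qed.

Lemma Rintegral_section2 F : P.-integrable setT (EFin \o F) ->
  \int[P]_z F z = \int[m2]_t \int[m1]_X F (X, t).
Proof.
move=> IF; rewrite /Rintegral -integral21_prod_meas1//; congr fine.
apply: ae_eq_integral => //.
- exact: measurable_fubini_G IF.
- exact: measurable_int (integrable_section2 IF).
- have := integrable_ae measurableT (integrable_fubini_G IF).
  by apply: filterS => X h /h fX; rewrite fineK.
Qed.

Lemma ae_sqint_section u : sqint P u -> {ae m1, forall X, sqint m2 (fun t => u (X, t))}.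
Proof.
move=> Lu; have Iu := sqint_integrable2 Lu.
apply: filterS (ae_integrable1 Iu) => X IX; split.
  by apply: measurable_section; exact: Lu.1.
exact: integrable_lty IX.
Qed.

(** The measure of the exceptional set is the integral of the measures of its sections; [mQ] makes
    the exceptional set itself measurable. *)
Lemma ae_of_section (Q : T1 * T2 -> Prop) : measurable [set z | Q z] ->
  {ae m1, forall X, {ae m2, forall t, Q (X, t)}} -> {ae P, forall z, Q z}.
Proof.
move=> mQ h; exists (~` [set z | Q z]); split => //; first exact: measurableC.
rewrite /product_measure1.
transitivity (\int[m1]_X (cst 0%E X))%E; last exact: integral0.
apply: ae_eq_integral => //; first exact: measurable_fun_xsection (measurableC mQ).
apply: filterS h => X [N [mN N0 QN]] _ /=.
apply: (subset_measure0 _ mN _ N0).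
  exact: measurable_xsection (measurableC mQ).
by move=> t; rewrite /xsection /= inE /= => nQ; apply: QN.
Qed.

Lemma ae_to_section (Q : T1 * T2 -> Prop) : measurable [set z | Q z] ->
  {ae P, forall z, Q z} -> {ae m1, forall X, {ae m2, forall t, Q (X, t)}}.
Proof.
move=> mQ [N [mN N0 QN]].
have mQC := measurableC mQ.
have : (\int[m1]_X `|(m2 \o xsection (~` [set z | Q z])) X|)%E = 0%E.
  under eq_integral do rewrite gee0_abs//.
  apply/eqP; rewrite eq_le integral_ge0// andbT -N0 /product_measure1.
  apply: ge0_le_integral => //; [exact: measurable_fun_xsection..|].
  move=> X _; apply: le_measure; rewrite ?inE; [exact: measurable_xsection..|].
  by move=> t; rewrite /xsection /= !inE /= => nQ; apply: QN.
move=> /(ae_eq_integral_abs _ measurableT (measurable_fun_xsection _ mQC)).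
apply: filterS => X /(_ Logic.I) /= X0.
exists (xsection (~` [set z | Q z]) X); split => //; first exact: measurable_xsection.
by move=> t /= nQ; rewrite /xsection /= inE.
Qed.

Lemma sqint_tensor f g : sqint m1 f -> sqint m2 g -> sqint P (fun z => f z.1 * g z.2).
Proof.
move=> [mf f2] [mg g2].
have mF : measurable_fun setT (fun z : T1 * T2 => f z.1 * g z.2).
  apply: measurable_funM.
    by apply: (measurableT_comp mf); exact: measurable_fst.
  by apply: (measurableT_comp mg); exact: measurable_snd.
split => //; rewrite fubini_tonelli1; last 2 first.
- by apply/measurable_EFinP; exact: measurable_funX.
- by move=> z; rewrite lee_fin sqr_ge0.
rewrite /fubini_F /=.
under eq_integral.
  move=> X _; under eq_integral do rewrite exprMn EFinM.
  rewrite ge0_integralZl//; last 3 first.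
  - by apply/measurable_EFinP; exact: measurable_funX.
  - by move=> x _; rewrite lee_fin sqr_ge0.
  - by rewrite lee_fin sqr_ge0.
  over.
rewrite ge0_integralZr//.
- rewrite lte_mul_pinfty ?integral_ge0// => [x _|]; first by rewrite lee_fin sqr_ge0.
  by rewrite ge0_fin_numE// integral_ge0//; move=> x _; rewrite lee_fin sqr_ge0.
- by apply/measurable_EFinP; exact: measurable_funX.
- by move=> x _; rewrite lee_fin sqr_ge0.
- by rewrite integral_ge0// => x _; rewrite lee_fin sqr_ge0.
Qed.

Lemma sqint_fst f : sqint m1 f -> sqint P (fun z => f z.1).
Proof.
move=> Lf; have := sqint_tensor Lf (sqint_cst m2 1).
by congr sqint; apply/funext => z; rewrite mulr1.
Qed.

Lemma sqint_snd f : sqint m2 f -> sqint P (fun z => f z.2).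
Proof.
move=> Lf; have := sqint_tensor (sqint_cst m1 1) Lf.
by congr sqint; apply/funext => z; rewrite mul1r.
Qed.

End product_measure.

(** * Splines on the unit interval *)

Lemma integrable_measurable d (T : measurableType d) (R : realType)
    (mu : {measure set T -> \bar R}) (f : T -> R) :
  mu.-integrable setT (EFin \o f) -> measurable_fun setT f.
Proof. by move=> If; apply/measurable_EFinP; exact: measurable_int If. Qed.

Lemma measurable_eq_set d (T : measurableType d) (R : realType) (f g : T -> R) :
  measurable_fun setT f -> measurable_fun setT g -> measurable [set x | f x = g x].
Proof.
move=> mf mg; have := measurable_fun_eqr mf mg measurableT (Y := [set true]).
rewrite setTI => /(_ Logic.I); congr measurable.
by apply/seteqP; split=> x /= /eqP.
Qed.

(** * The primitive operator and its skew symmetry *)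

Section primitive.
Context (R : realType).
Local Notation mu := (mu01 R).
Implicit Types f g : R -> R.

Definition ltind (y x : R) : R := (y < x)%R%:R.

(** With the kernel 1_{y < x} the domain of integration does not depend on [x], so measurability in
    [x] and Fubini's theorem reduce to joint measurability of the kernel. *)
Definition primitive f (x : R) : R := \int[mu]_y (ltind y x * f y).

Lemma measurable_lt_indic :
  measurable_fun setT (fun z : measurableTypeR R * measurableTypeR R => ltind z.2 z.1).
Proof.
have -> : (fun z : measurableTypeR R * measurableTypeR R => ltind z.2 z.1) =
    \1_((fun z : measurableTypeR R * measurableTypeR R => (z.1 : R) - z.2) @^-1` `]0, +oo[%classic).
  apply/funext => z; rewrite /ltind indicE; congr ((nat_of_bool _)%:R).
  by apply/idP/idP; rewrite inE /= in_itv/= andbT subr_gt0.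
apply: measurable_indic; rewrite -[X in measurable X]setTI.
have m : measurable_fun setT (fun z : measurableTypeR R * measurableTypeR R => (z.1 : R) - z.2).
  by apply: measurable_funB; [exact: measurable_fst|exact: measurable_snd].
by apply: m => //; exact: measurable_itv.
Qed.

Lemma measurable_lt_r (x : R) :
  measurable_fun setT (fun y : measurableTypeR R => ltind y x).
Proof. exact: measurableT_comp measurable_lt_indic (pair1_measurable _). Qed.

Lemma sqint_lt_indic : sqint (mu \x mu)%E (fun z => ltind z.2 z.1).
Proof.
have [m1 i1] := sqint_tensor (sqint_cst mu 1) (sqint_cst mu 1).
split; first exact: measurable_lt_indic.
apply: le_lt_trans i1; apply: ge0_le_integral => //.
- by move=> z _; rewrite lee_fin sqr_ge0.
- by apply/measurable_EFinP; apply: measurable_funX; exact: measurable_lt_indic.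
by move=> z _; rewrite lee_fin mulr1 expr1n; rewrite /ltind; case: (_ < _); rewrite ?expr1n ?expr0n ?ler01.
Qed.

Lemma integrable_lt_kernel (r : measurableTypeR R * measurableTypeR R -> R) :
  (mu \x mu)%E.-integrable setT (EFin \o r) ->
  (mu \x mu)%E.-integrable setT (EFin \o (fun z => ltind z.2 z.1 * r z)).
Proof.
move=> Ir; apply: (le_integrable measurableT _ _ Ir) => //.
  apply/measurable_EFinP; apply: measurable_funM; first exact: measurable_lt_indic.
  exact: integrable_measurable Ir.
by move=> z _ /=; rewrite lee_fin; rewrite /ltind; case: (_ < _); rewrite ?mul1r// mul0r normr0.
Qed.

Lemma integrable_lt f x : mu.-integrable setT (EFin \o f) ->
  mu.-integrable setT (EFin \o (fun y => ltind y x * f y)).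
Proof.
move=> If; apply: (le_integrable measurableT _ _ If) => //.
  apply/measurable_EFinP; apply: measurable_funM; first exact: measurable_lt_r.
  exact: integrable_measurable If.
by move=> z _ /=; rewrite lee_fin; rewrite /ltind; case: (_ < _); rewrite ?mul1r// mul0r normr0.
Qed.

Lemma sqint_primitive f : sqint mu f -> sqint mu (primitive f).
Proof.
move=> Lf; have If := sqint_integrable Lf.
apply: (@sqint_bounded _ _ _ _ _ (\int[mu]_y `|f y|)).
  have I2 := sqint_mul sqint_lt_indic (sqint_snd mu Lf).
  exact: integrable_measurable (integrable_section1 I2).
move=> x; apply: le_trans (le_normr_Rintegral measurableT (integrable_lt x If)) _.
apply: le_Rintegral => //; [exact: integrable_norm (integrable_lt x If)|exact: integrable_norm|].
by move=> y _; rewrite normrM; rewrite /ltind; case: (_ < _); rewrite ?normr1 ?mul1r// normr0 mul0r.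
Qed.

Lemma primitiveD f g x : sqint mu f -> sqint mu g ->
  primitive (fun y => f y + g y) x = primitive f x + primitive g x.
Proof.
move=> /sqint_integrable Lf /sqint_integrable Lg.
rewrite /primitive -RintegralD//; [|exact: integrable_lt..].
by under eq_Rintegral do rewrite mulrDr.
Qed.

Lemma primitiveZ a f x : sqint mu f -> primitive (fun y => a * f y) x = a * primitive f x.
Proof.
move=> /sqint_integrable Lf; rewrite /primitive -RintegralZl//; last exact: integrable_lt.
by under eq_Rintegral do rewrite mulrCA.
Qed.

Lemma primitive0 x : primitive (fun=> 0) x = 0.
Proof. by rewrite /primitive /Rintegral; under eq_integral do rewrite mulr0; rewrite integral0. Qed.

Lemma primitiveB f g x : sqint mu f -> sqint mu g ->
  primitive (fun y => f y - g y) x = primitive f x - primitive g x.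
Proof.
move=> Lf Lg; rewrite -(mulN1r (primitive g x)) -primitiveZ// -primitiveD//; last exact: sqintZ.
by congr (primitive _ x); apply/funext => y; rewrite mulN1r.
Qed.

Lemma primitive_lincomb N (e : 'I_N -> R -> R) c x : (forall i, sqint mu (e i)) ->
  primitive (lincomb e c) x = lincomb (fun i => primitive (e i)) c x.
Proof.
move=> Le; rewrite /lincomb; elim: (index_enum _) => [|i s ih].
  by rewrite big_nil -[RHS](primitive0 x); congr (primitive _ x); apply/funext => y; rewrite big_nil.
rewrite big_cons -ih -primitiveZ// -primitiveD//; last 2 first.
- exact: sqintZ.
- by apply: sqint_sum => j; exact: sqintZ.
by congr (primitive _ x); apply/funext => y; rewrite big_cons.
Qed.

Lemma mu01_ae_neq (x : R) : {ae mu, forall y, y != x}.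
Proof.
exists [set x]; split => //.
  rewrite /mu01; apply/eqP; rewrite eq_le measure_ge0 andbT.
  rewrite -(lebesgue_measure_set1 x); apply: le_measure; rewrite ?inE//.
  by apply: measurableI => //; exact: measurable_unit_itv.
by move=> y /= /negP; rewrite negbK => /eqP.
Qed.

(* The two iterated integrals cover the two triangles of the unit square. *)
Lemma ip_primitive f g : sqint mu f -> sqint mu g ->
  ip mu f (primitive g) + ip mu g (primitive f) = (\int[mu]_x f x) * (\int[mu]_x g x).
Proof.
move=> Lf Lg.
have If := sqint_integrable Lf; have Ig := sqint_integrable Lg.
have I2 := sqint_mul (sqint_fst mu Lf) (sqint_snd mu Lg).
have I2' := sqint_mul (sqint_fst mu Lg) (sqint_snd mu Lf).
have Ik := integrable_lt_kernel I2.
have Ik' := integrable_lt_kernel I2'.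
have mfg := integrable_measurable I2.
pose B z := ltind z.1 z.2 * (f z.1 * g z.2).
have mB : measurable_fun setT B.
  apply: measurable_funM => //.
  apply: (measurableT_comp measurable_lt_indic (g := fun z => (z.2, z.1))).
  by apply/measurable_fun_pairP; split => /=; [exact: measurable_snd|exact: measurable_fst].
have IB : (mu \x mu)%E.-integrable setT (EFin \o B).
  apply: (le_integrable measurableT _ _ I2) => //; first exact/measurable_EFinP.
  by move=> z _ /=; rewrite lee_fin /B; rewrite /ltind; case: (_ < _); rewrite ?mul1r// mul0r normr0.
have -> : ip mu f (primitive g) = \int[(mu \x mu)%E]_z (ltind z.2 z.1 * (f z.1 * g z.2)).
  rewrite Rintegral_section1//=; apply: eq_Rintegral => x _.
  rewrite -RintegralZl//; last exact: integrable_lt.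
  by apply: eq_Rintegral => y _; rewrite mulrCA.
have -> : ip mu g (primitive f) = \int[(mu \x mu)%E]_z B z.
  rewrite Rintegral_section2//=; apply: eq_Rintegral => x _.
  rewrite -RintegralZl//; last exact: integrable_lt.
  by apply: eq_Rintegral => y _; rewrite /B /=; ring.
rewrite -RintegralD//.
transitivity (\int[(mu \x mu)%E]_z (f z.1 * g z.2)).
  apply: ae_eq_Rintegral => //.
    by apply: measurable_funD => //; exact: integrable_measurable Ik.
  (* On the section over x, the point y = x is the only one in neither triangle. *)
  apply: ae_of_section.
    apply: measurable_eq_set => //.
    by apply: measurable_funD => //; exact: integrable_measurable Ik.
  apply: aeW => x; apply: ae_mono (mu01_ae_neq x) => y yx.
  by rewrite /B/ltind/=; case: ltgtP yx => //= _ _; rewrite mul0r mul1r ?addr0 ?add0r.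
rewrite Rintegral_section1//=.
under eq_Rintegral do rewrite RintegralZl//.
by rewrite RintegralZr.
Qed.

End primitive.

(** * Degree zero: step functions on the grid *)

Section step_functions.
Context (R : realType).
Local Notation mu := (mu01 R).
Variables (h : R) (N : nat).
Hypotheses (h0 : 0 < h) (hN : h * N%:R = 1).
Implicit Types f g : R -> R.

Lemma ltind_sqint x : sqint mu (fun y => ltind y x).
Proof.
apply: (@sqint_bounded _ _ _ _ _ 1); first exact: measurable_lt_r.
by move=> y; rewrite /ltind; case: (_ < _); rewrite ?normr1 ?normr0.
Qed.

Lemma measurable_lt_l (x : R) :
  measurable_fun setT (fun y : measurableTypeR R => ltind x y).
Proof.
have m := @pair2_measurable _ _ _ _ x : measurable_fun setT (fun y : measurableTypeR R => (y, x : measurableTypeR R)).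
exact: measurableT_comp (@measurable_lt_indic R) m.
Qed.

Lemma ltind_sqint_l x : sqint mu (ltind x).
Proof.
apply: (@sqint_bounded _ _ _ _ _ 1); first exact: measurable_lt_l.
by move=> y; rewrite /ltind; case: (_ < _); rewrite ?normr1 ?normr0.
Qed.

Lemma mean_cst (c : R) : \int[mu]_x c = c.
Proof. by rewrite Rintegral_cst//= mu01T mulr1. Qed.

Lemma mean_ltind x : 0 <= x <= 1 -> \int[mu]_y ltind y x = x.
Proof.
move=> /andP[x0 x1].
have -> : (fun y => ltind y x) = \1_([set y : R | y < x]).
  apply/funext => y; rewrite /ltind indicE; congr ((nat_of_bool _)%:R).
  by apply/idP/idP; rewrite inE.
have mx : measurable ([set y : R | y < x] : set (measurableTypeR R)).
  rewrite [X in measurable X](_ : _ = `]-oo, x[%classic); first exact: measurable_itv.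
  by apply/seteqP; split=> y /=; rewrite in_itv.
rewrite /Rintegral integral_indic//= setIT /mu01.
rewrite (_ : _ `&` _ = `]0, x[%classic).
  rewrite lebesgue_measure_itv/= lte_fin; case: ltP => [_|x0']; first by rewrite /= subr0.
  by apply: le_anti; rewrite /= x0 x0'.
apply/seteqP; split=> y; rewrite /unit_itv/= !in_itv/=.
  by move=> [yx /andP[y0 _]]; rewrite y0.
by move=> /andP[y0 yx]; rewrite y0 yx (lt_le_trans yx).
Qed.

Lemma mean_ltind_l x : 0 <= x <= 1 -> \int[mu]_y ltind x y = 1 - x.
Proof.
move=> x01; rewrite -{2}(mean_ltind x01) -(mean_cst 1) -RintegralB//; last 2 first.
- exact: sqint_integrable (sqint_cst mu 1).
- exact: sqint_integrable (ltind_sqint x).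
apply: ae_eq_Rintegral; first exact: measurable_lt_l.
  by apply: measurable_funB => //; exact: measurable_lt_r.
apply: ae_mono (mu01_ae_neq x) => y.
by rewrite /ltind; case: ltgtP => // _ _; rewrite ?subr0 ?subrr.
Qed.

Definition node j : R := h * j%:R.

Lemma node_le j k : (j <= k)%N -> node j <= node k.
Proof. by move=> jk; rewrite /node ler_pM2l// ler_nat. Qed.

Lemma node_itv j : (j <= N)%N -> 0 <= node j <= 1.
Proof.
move=> jN; rewrite -hN; apply/andP; split; last exact: node_le.
by rewrite mulr_ge0// ltW.
Qed.

Lemma nodeS j : node j.+1 = node j + h.
Proof. by rewrite /node -natr1 mulrDr mulr1. Qed.

(** The indicator of the half-open cell (hj, h(j+1)], with the endpoint convention of [spline]. *)
Definition cellind j x := ltind (node j) x - ltind (node j.+1) x.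

Definition stepf (c : nat -> R) : R -> R := fun x => \sum_(j < N) c j * cellind j x.

Lemma sqint_cellind j : sqint mu (cellind j).
Proof. by apply: sqintB; exact: ltind_sqint_l. Qed.

Lemma mean_cellind j : (j < N)%N -> \int[mu]_x cellind j x = h.
Proof.
move=> jN; rewrite RintegralB//; [|exact: sqint_integrable (ltind_sqint_l _)..].
by rewrite !mean_ltind_l ?node_itv// 1?ltnW// nodeS; ring.
Qed.

Lemma sqint_stepf c : sqint mu (stepf c).
Proof. exact: (sqint_lincomb (fun j : 'I_N => c j) (fun j : 'I_N => sqint_cellind j)). Qed.

Lemma stepfE c j x : (j < N)%N -> node j < x <= node j.+1 -> stepf c x = c j.
Proof.
move=> jN /andP[jx xj]; rewrite /stepf (bigD1 (Ordinal jN))//= big1 ?addr0.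
  by rewrite /cellind /ltind jx ltNge xj subr0 mulr1.
move=> i ij; rewrite /cellind /ltind.
have [ij'|ji|E] := ltngtP i j.
- by rewrite !(le_lt_trans _ jx) ?node_le// 1?ltnW// subrr mulr0.
- by rewrite !ltNge !(le_trans xj) ?node_le// 1?ltnW// subrr mulr0.
- by move: ij; rewrite -val_eqE /= E eqxx.
Qed.

Lemma cell_exists x n : 0 < x <= node n -> exists2 j, (j < n)%N & node j < x <= node j.+1.
Proof.
elim: n => [|n ih] /andP[x0 xn]; first by move: xn; rewrite /node mulr0 leNgt x0.
have [xn'|nx] := leP x (node n).
  by have [|j jn xj] := ih; [rewrite x0|exists j => //; exact: ltnW].
by exists n => //; rewrite nx.
Qed.

Lemma mu01_ae_unit : {ae mu, forall x, 0 < x < 1}.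
Proof.
exists (~` unit_itv R); split.
- by apply: measurableC; exact: measurable_unit_itv.
- by rewrite /mu01 setICl measure0.
- by move=> x /= nx; rewrite /unit_itv/= in_itv.
Qed.

Lemma ae_cell : {ae mu, forall x, exists2 j, (j < N)%N & node j < x <= node j.+1}.
Proof.
apply: ae_mono mu01_ae_unit => x /andP[x0 x1]; apply: cell_exists.
by rewrite x0 /node hN ltW.
Qed.

(** The indicator of [hj, h(j+1)), closed on the left: this is the convention imposed by the strict
    kernel y < x when y is the variable of integration. *)
Definition revind j y := ltind y (node j.+1) - ltind y (node j).

Lemma revind_sum y : \sum_(j < N) revind j y <= 1.
Proof.
have -> : \sum_(j < N) revind j y = ltind y (node N) - ltind y (node 0).
  rewrite -(big_mkord xpredT (revind^~ y)) telescope_sumr//.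
by rewrite /ltind; do 2 case: (_ < _); rewrite ?subrr ?subr0 ?sub0r ?ler01//= lerN10.
Qed.

Lemma revind_bool j y : (revind j y == 0) || (revind j y == 1).
Proof.
rewrite /revind /ltind; case: (ltP y (node j)) => yj; first by rewrite (lt_le_trans yj) ?node_le// subrr eqxx.
by case: (_ < _); rewrite subr0 eqxx ?orbT.
Qed.

Lemma sqint_revind j : sqint mu (revind j).
Proof. by apply: sqintB; exact: ltind_sqint. Qed.

Lemma mean_revind j : (j < N)%N -> \int[mu]_x revind j x = h.
Proof.
move=> jN; rewrite RintegralB//; [|exact: sqint_integrable (ltind_sqint _)..].
by rewrite !mean_ltind ?node_itv// 1?ltnW// nodeS; ring.
Qed.

Lemma sqint_revindM j f : sqint mu f -> sqint mu (fun y => revind j y * f y).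
Proof.
move=> [mf f2]; have [mr _] := sqint_revind j.
have m : measurable_fun setT (fun y : measurableTypeR R => revind j y * f y).
  exact: measurable_funM.
split=> //; apply: le_lt_trans f2; apply: ge0_le_integral => //.
- by move=> y _; rewrite lee_fin sqr_ge0.
- by apply/measurable_EFinP; exact: measurable_funX.
- by apply/measurable_EFinP; exact: measurable_funX.
move=> y _; rewrite lee_fin exprMn; case/orP: (revind_bool j y) => /eqP ->.
  by rewrite expr0n mul0r sqr_ge0.
by rewrite expr1n mul1r.
Qed.

(** The difference is the inner product of [f] with the indicator [k] of [hj, x). As [k] lives on
    the cell, [f] may be cut down to the cell, and the squared norm of [k] is at most the cell
    length [h]; Cauchy-Schwarz concludes. *)
Lemma interpolation_cell f j x : sqint mu f -> (j < N)%N -> node j < x <= node j.+1 ->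
  (primitive f x - primitive f (node j)) ^+ 2 <=
  h * ip mu (fun y => revind j y * f y) (fun y => revind j y * f y).
Proof.
move=> Lf jN /andP[jx xj]; have If := sqint_integrable Lf.
pose k y := ltind y x - ltind y (node j).
have Lk : sqint mu k by apply: sqintB; exact: ltind_sqint.
have Lrf := sqint_revindM j Lf.
have kr y : k y = k y * revind j y /\ k y ^+ 2 <= revind j y.
  rewrite /k /revind /ltind; case: (ltP y (node j)) => [yj|yj].
    by rewrite (lt_trans yj jx) (lt_le_trans yj) ?node_le// !subrr mul0r expr0n.
  case: (ltP y x) => [yx|xy]; first by rewrite (lt_le_trans yx xj) !subr0 mulr1 expr1n.
  by rewrite !subr0 mul0r expr0n/=; case: (_ < _).
have -> : primitive f x - primitive f (node j) = ip mu k (fun y => revind j y * f y).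
  rewrite /primitive -RintegralB//; [|exact: integrable_lt..].
  by apply: eq_Rintegral => y _; rewrite mulrA -(kr y).1 mulrBl.
apply: le_trans (cauchy_schwarz Lk Lrf) _; apply: ler_wpM2r; first exact: ip_ge0.
rewrite -(mean_revind jN); apply: le_Rintegral => //.
- exact: sqint_mul.
- exact: sqint_integrable (sqint_revind j).
- by move=> y _; rewrite -expr2; exact: (kr y).2.
Qed.

(** The bound of [interpolation_cell] is constant on each cell, so its integral over the cell yields
    the second factor [h]. The local norms add up to at most the norm of [f] because the cells are
    disjoint. *)
Lemma interpolation_error f : sqint mu f ->
  let r := fun x => primitive f x - stepf (fun j => primitive f (node j)) x in
  ip mu r r <= h ^+ 2 * ip mu f f.
Proof.
move=> Lf /=; set r := fun x : R => _.
have Lr : sqint mu r by apply: sqintB; [exact: sqint_primitive|exact: sqint_stepf].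
pose q j := ip mu (fun y => revind j y * f y) (fun y => revind j y * f y).
have q0 j : 0 <= q j by exact: ip_ge0.
have cell0 j x : 0 <= cellind j x.
  rewrite /cellind /ltind; case: (ltP (node j.+1)) => xj.
    by rewrite (le_lt_trans _ xj) ?subrr// node_le.
  by rewrite subr0; case: (_ < _).
apply: (@le_trans _ _ (\int[mu]_x stepf (fun j => h * q j) x)).
  apply: ae_le_Rintegral.
  - exact: sqint_mul.
  - exact: sqint_integrable (sqint_stepf _).
  - by move=> x; rewrite -expr2 sqr_ge0.
  - by move=> x; apply: sumr_ge0 => j _; rewrite !mulr_ge0// ltW.
  apply: ae_mono ae_cell => x [j jN xj]; rewrite /r -expr2 !(stepfE _ jN xj).
  exact: interpolation_cell.
have -> : \int[mu]_x stepf (fun j => h * q j) x = h ^+ 2 * \sum_(j < N) q j.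
  have := ip_lincomb (fun j : 'I_N => h * q j) (fun j : 'I_N => sqint_cellind j) (sqint_cst mu 1).
  rewrite ip_cstr => ->; rewrite mulr_sumr; apply: eq_bigr => j _.
  by rewrite ip_cstr mean_cellind//; ring.
apply: ler_wpM2l; first exact: sqr_ge0.
have Iq (j : 'I_N) := sqint_mul (sqint_revindM j Lf) (sqint_revindM j Lf).
rewrite /q -(Rintegral_sum _ Iq).
have E y : \sum_(j < N) revind j y * f y * (revind j y * f y) = (\sum_(j < N) revind j y) * (f y * f y).
  rewrite mulr_suml; apply: eq_bigr => j _.
  by case/orP: (revind_bool j y) => /eqP ->; ring.
apply: le_Rintegral => //.
- exact: integrable_EFin_sum.
- exact: sqint_mul.
move=> y _ /=; rewrite E -[leRHS]mul1r ler_wpM2r ?revind_sum// -expr2 sqr_ge0//.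
Qed.

Lemma stepf1 : {ae mu, forall x, stepf (fun=> 1) x = 1}.
Proof. by apply: ae_mono ae_cell => x [j jN xj]; rewrite (stepfE _ jN xj). Qed.

End step_functions.

(** * Projections and spans up to functions of norm zero *)

Section almost_everywhere_span.
Context d (T : measurableType d) (R : realType) (mu : {measure set T -> \bar R}).
Implicit Types f v : T -> R.

Definition oresidual N (e : 'I_N -> T -> R) f : T -> R := fun x => f x - oproj mu e f x.

Lemma sqint_oproj N (e : 'I_N -> T -> R) f : orthonormal mu e -> sqint mu (oproj mu e f).
Proof. by move=> oe; apply: sqint_lincomb; exact: oe.1. Qed.

Lemma sqint_oresidual N (e : 'I_N -> T -> R) f : orthonormal mu e -> sqint mu f ->
  sqint mu (oresidual e f).
Proof. by move=> oe Lf; apply: sqintB => //; exact: sqint_oproj. Qed.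

Lemma aespan_lincomb N M (e : 'I_N -> T -> R) (s : 'I_M -> T -> R) c :
  orthonormal mu e -> (forall i, sqint mu (s i)) -> (forall i, aespan mu e (s i)) ->
  aespan mu e (lincomb s c).
Proof.
move=> oe Ls se; rewrite /aespan /=.
have -> : (fun x => lincomb s c x - oproj mu e (lincomb s c) x) =
          lincomb (fun i => oresidual e (s i)) c.
  apply/funext => x; rewrite /lincomb /oresidual.
  under [RHS]eq_bigr do rewrite mulrBr; rewrite sumrB; congr (_ - _).
  rewrite /oproj /lincomb; under eq_bigr => k _.
    rewrite (ip_lincomb c Ls (oe.1 k)) mulr_suml; over.
  rewrite exchange_big/=; apply: eq_bigr => i _; rewrite mulr_sumr.
  by apply: eq_bigr => k _; ring.
rewrite ip_lincomb; last 2 first.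
- by move=> i; exact: sqint_oresidual.
- by apply: sqint_lincomb => i; exact: sqint_oresidual.
rewrite big1// => i _; rewrite ip_eq0l ?mulr0//; first exact: sqint_oresidual.
- by apply: sqint_lincomb => j; exact: sqint_oresidual.
- exact: se.
Qed.

(** The competitor actually used is the projection of [v]. It differs from [v] by a function of norm
    zero, which is orthogonal to everything by Cauchy-Schwarz. *)
Lemma oresidual_best N (e : 'I_N -> T -> R) f v :
  orthonormal mu e -> sqint mu f -> sqint mu v -> aespan mu e v ->
  ip mu (oresidual e f) (oresidual e f) <= ip mu (fun x => f x - v x) (fun x => f x - v x).
Proof.
move=> oe Lf Lv ev.
have Lfv := sqintB Lf Lv; have Lr := sqint_oresidual oe Lv.
apply: le_trans (oproj_best (fun i => ip mu v (e i)) oe Lf) _ => /=.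
rewrite le_eqVlt; apply/orP; left; apply/eqP.
have -> : (fun x => f x - lincomb e (fun i => ip mu v (e i)) x) =
          (fun x => (f x - v x) + oresidual e v x).
  by apply/funext => x; rewrite /oresidual /oproj; ring.
rewrite ipDl ?(ipDr Lfv Lr)//; last exact: sqintD.
rewrite (ip_eq0l Lr Lr ev) (ip_eq0l Lr Lfv ev) ipC.
by rewrite (ip_eq0l Lr Lfv ev) !addr0.
Qed.

Lemma ip_oresidual_aespan N (e : 'I_N -> T -> R) f v :
  orthonormal mu e -> sqint mu f -> sqint mu v -> aespan mu e v -> ip mu (oresidual e f) v = 0.
Proof.
move=> oe Lf Lv ev.
have Lr := sqint_oresidual oe Lf; have Lrv := sqint_oresidual oe Lv.
have -> : v = fun x => oproj mu e v x + oresidual e v x.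
  by apply/funext => x; rewrite /oresidual; ring.
rewrite ipDr//; last exact: sqint_oproj.
by rewrite ip_residual_lincomb// add0r ipC ip_eq0l.
Qed.

Lemma ip_oresidual_le N (e : 'I_N -> T -> R) f : orthonormal mu e -> sqint mu f ->
  ip mu (oresidual e f) (oresidual e f) <= ip mu f f.
Proof.
move=> oe Lf; rewrite ip_oproj_residual// gerBl.
by apply: sumr_ge0 => i _; exact: sqr_ge0.
Qed.

End almost_everywhere_span.

(** * The approximation of primitives, degree by degree *)

Section spline_projection.
Context (R : realType).
Local Notation mu := (mu01 R).
Variables (h : R) (N : nat).
Hypotheses (h0 : 0 < h) (hN : h * N%:R = 1).
Implicit Types f g s t : R -> R.

Definition mean01 f := \int[mu]_x f x.

Lemma mean01E f : mean01 f = ip mu f (fun=> 1).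
Proof. by rewrite ip_cstr. Qed.

Lemma mean01_lincomb M (e : 'I_M -> R -> R) c : (forall i, sqint mu (e i)) ->
  mean01 (lincomb e c) = \sum_(i < M) c i * mean01 (e i).
Proof.
move=> Le; rewrite mean01E (ip_lincomb c Le (sqint_cst mu 1)).
by apply: eq_bigr => i _; rewrite mean01E.
Qed.

Lemma mean01D f g : sqint mu f -> sqint mu g -> mean01 (fun x => f x + g x) = mean01 f + mean01 g.
Proof. by move=> Lf Lg; rewrite !mean01E ipDl//; exact: sqint_cst. Qed.

Lemma mean01Z a f : sqint mu f -> mean01 (fun x => a * f x) = a * mean01 f.
Proof. by move=> Lf; rewrite !mean01E ipZl//; exact: sqint_cst. Qed.

(* [b = true]: odd derivatives vanish at the endpoints (the space S~ of the paper);
   [b = false]: even derivatives vanish there. *)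
Fixpoint reduced_spline (b : bool) (p : nat) s : Prop :=
  if p is q.+1 then
    if b then exists c t, reduced_spline false q t /\ s = (fun x => c + primitive t x)
    else exists t, [/\ reduced_spline true q t, mean01 t = 0 & s = primitive t]
  else exists c, s = stepf h N c.

Lemma sqint_reduced_spline b p s : reduced_spline b p s -> sqint mu s.
Proof.
elim: p b s => [|p ih] [] s /=.
- by move=> [c ->]; exact: sqint_stepf.
- by move=> [c ->]; exact: sqint_stepf.
- move=> [c [t [tp ->]]]; apply: sqintD; first exact: sqint_cst.
  exact: sqint_primitive (ih _ _ tp).
- by move=> [t [tp _ ->]]; exact: sqint_primitive (ih _ _ tp).
Qed.

Lemma reduced_spline_lin b p a f g : reduced_spline b p f -> reduced_spline b p g ->
  reduced_spline b p (fun x => a * f x + g x).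
Proof.
elim: p b f g => [|p ih] [] f g /=.
- move=> [c ->] [c' ->]; exists (fun j => a * c j + c' j); apply/funext => x.
  rewrite /stepf mulr_sumr -big_split/=; apply: eq_bigr => j _; ring.
- move=> [c ->] [c' ->]; exists (fun j => a * c j + c' j); apply/funext => x.
  rewrite /stepf mulr_sumr -big_split/=; apply: eq_bigr => j _; ring.
- move=> [c [t [tp ->]]] [c' [t' [tp' ->]]].
  exists (a * c + c'), (fun x => a * t x + t' x); split; first exact: ih.
  have Lt := sqint_reduced_spline tp; have Lt' := sqint_reduced_spline tp'.
  apply/funext => x; rewrite primitiveD ?primitiveZ//; first by ring.
  exact: sqintZ.
- move=> [t [tp t0 ->]] [t' [tp' t'0 ->]].
  have Lt := sqint_reduced_spline tp; have Lt' := sqint_reduced_spline tp'.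
  exists (fun x => a * t x + t' x); split; first exact: ih.
    by rewrite mean01D ?mean01Z ?t0 ?t'0 ?mulr0 ?addr0//; exact: sqintZ.
  by apply/funext => x; rewrite primitiveD ?primitiveZ//; exact: sqintZ.
Qed.

Lemma reduced_spline0 b p : reduced_spline b p (fun=> 0).
Proof.
elim: p b => [|p ih] [] /=.
- by exists (fun=> 0); apply/funext => x; rewrite /stepf big1// => j _; rewrite mul0r.
- by exists (fun=> 0); apply/funext => x; rewrite /stepf big1// => j _; rewrite mul0r.
- exists 0, (fun=> 0); split; first exact: ih.
  by apply/funext => x; rewrite primitive0 addr0.
- exists (fun=> 0); split; first exact: ih.
    by rewrite /mean01 Rintegral_cst// mul0r.
  by apply/funext => x; rewrite primitive0.
Qed.

(** In degree 0 the constant is reached only almost everywhere, since [stepf] vanishes outside the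
    cells. *)
Lemma reduced_spline1 p : exists2 s, reduced_spline true p s & {ae mu, forall x, s x = 1}.
Proof.
case: p => [|p].
  by exists (stepf h N (fun=> 1)); [exists (fun=> 1)|exact: stepf1].
exists (fun=> 1); last by apply: aeW.
exists 1, (fun=> 0); split; first exact: reduced_spline0.
by apply/funext => x; rewrite primitive0 addr0.
Qed.

(** In positive degree the members for [b = false] vanish at 0 and at 1, so they can only be
    expected to approximate primitives that vanish at 1, hence the condition that [f] have mean
    zero. For [b = true] the constants are required in the span because this gives residuals mean
    zero, which the next degree uses. *)
Definition primitive_approx (b : bool) (p : nat) : Prop :=
  exists M (e : 'I_M -> R -> R),
    [/\ orthonormal mu e, forall i, reduced_spline b p (e i),
        b -> aespan mu e (fun=> 1) &
        forall f, sqint mu f -> b || (mean01 f == 0) ->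
          ip mu (oresidual mu e (primitive f)) (oresidual mu e (primitive f)) <=
          h ^+ 2 * ip mu f f].

Lemma ae_eq_aespan M (e : 'I_M -> R -> R) (f g : R -> R) : orthonormal mu e ->
  sqint mu f -> sqint mu g -> {ae mu, forall x, f x = g x} -> aespan mu e f -> aespan mu e g.
Proof.
move=> oe Lf Lg fg; rewrite /aespan /= => <-.
have Lof : sqint mu (oresidual mu e f) by exact: sqint_oresidual.
have Log : sqint mu (oresidual mu e g) by exact: sqint_oresidual.
have E : oproj mu e g = oproj mu e f.
  apply/funext => x; rewrite /oproj /lincomb; apply: eq_bigr => i _; congr (_ * _).
  by apply/esym; apply: ae_eq_ipr fg; [exact: Lf.1|exact: Lg.1|exact: (oe.1 i).1].
apply: ae_eq_Rintegral.
- by apply: measurable_funM; exact: Log.1.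
- by apply: measurable_funM; exact: Lof.1.
- by apply: ae_mono fg => x fgx; rewrite E fgx.
Qed.

(** The cell indicators generate the space, and the step function interpolating the primitive at the
    left nodes competes with the projection. *)
Lemma primitive_approx0 b : primitive_approx b 0.
Proof.
have sI (i : nat) : sqint mu (stepf h N (fun j => (j == i)%:R)) by exact: sqint_stepf.
have Cs (i : 'I_N) : reduced_spline b 0 (stepf h N (fun j => (j == i :> nat)%:R)).
  by exists (fun j : nat => (j == i :> nat)%:R).
have [M [e [oe Ce se]]] := @gram_schmidt _ _ _ mu (reduced_spline b 0) N
  (fun i => stepf h N (fun j => (j == i :> nat)%:R)) (reduced_spline0 b 0)
  (fun a f g => @reduced_spline_lin b 0 a f g) (fun i => sI i) Cs.
have spane c : aespan mu e (stepf h N c).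
  have -> : stepf h N c = lincomb (fun i : 'I_N => stepf h N (fun j => (j == i :> nat)%:R)) (fun i => c i).
    apply/funext => x; rewrite /lincomb /stepf; apply: eq_bigr => i _; congr (_ * _).
    rewrite (bigD1 i)//= eqxx mul1r big1 ?addr0// => j ji.
    by rewrite val_eqE (negbTE ji) mul0r.
  exact: aespan_lincomb.
exists M, e; split => //.
  move=> _; have S1 := sqint_stepf h N (fun=> 1).
  exact: (ae_eq_aespan oe S1 (sqint_cst mu 1) (stepf1 h0 hN) (spane (fun=> 1))).
move=> f Lf _; apply: le_trans (interpolation_error h0 hN Lf).
apply: oresidual_best => //; [exact: sqint_primitive|exact: sqint_stepf].
Qed.

Lemma mean_oresidual M (e : 'I_M -> R -> R) f : orthonormal mu e -> aespan mu e (fun=> 1) ->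
  sqint mu f -> mean01 (oresidual mu e f) = 0.
Proof.
move=> oe e1 Lf; rewrite mean01E; apply: ip_oresidual_aespan => //.
exact: sqint_cst.
Qed.

(* The duality at the heart of the argument: on residuals the primitive is skew-adjoint. *)
Lemma skew_duality M (t : 'I_M -> R -> R) f y :
  orthonormal mu t -> sqint mu f -> sqint mu y ->
  ip mu y y = - ip mu (oresidual mu t f) (primitive y) ->
  ip mu (oresidual mu t (primitive y)) (oresidual mu t (primitive y)) <= h ^+ 2 * ip mu y y ->
  ip mu y y <= h ^+ 2 * ip mu f f.
Proof.
move=> ot Lf Ly yE Bz.
set r := oresidual mu t f in yE; set z := oresidual mu t (primitive y) in Bz.
have Lr : sqint mu r by exact: sqint_oresidual.
have LKy : sqint mu (primitive y) by exact: sqint_primitive.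
have Lz : sqint mu z by exact: sqint_oresidual.
(* The residual [r] sees only the residual [z] of [primitive y]. Hence <y,y>^2 <= |r|^2 |z|^2 <=
   |f|^2 h^2 <y,y>, and one factor <y,y> cancels. *)
have yrz : ip mu y y = - ip mu r z.
  rewrite yE; congr (- _); rewrite /z /oresidual (ipBr LKy (sqint_oproj _ ot) Lr).
  by rewrite [X in _ - X](ip_residual_lincomb _ ot Lf) subr0.
have [->|yn0] := eqVneq (ip mu y y) 0; first by rewrite mulr_ge0 ?sqr_ge0 ?ip_ge0.
have yp : 0 < ip mu y y by rewrite lt_def yn0 ip_ge0.
rewrite -(ler_pM2l yp) -[leLHS]expr2 [in leLHS]yrz sqrrN.
apply: le_trans (cauchy_schwarz Lr Lz) _.
have rf : ip mu r r <= ip mu f f by exact: ip_oresidual_le.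
apply: le_trans (ler_pM (ip_ge0 _ _) (ip_ge0 _ _) rf Bz) _.
by rewrite le_eqVlt; apply/orP; left; apply/eqP; ring.
Qed.

(** The competitor is the primitive of the projection of [f] plus the constant [m], so that the
    error [y] is [primitive r] minus its mean. Since [y] has mean zero, the product in
    [ip_primitive] vanishes, [m] is orthogonal to [y], and the estimate for data of mean zero
    applies to [y]. *)
Lemma primitive_approx_cos p : primitive_approx false p -> primitive_approx true p.+1.
Proof.
move=> [M [t [ot Ct _ Bt]]]; have Lt := ot.1.
pose s (i : 'I_M.+1) := if unlift ord0 i is Some j then primitive (t j) else fun=> 1.
have s0 : s ord0 = fun=> 1 by rewrite /s unlift_none.
have sS j : s (lift ord0 j) = primitive (t j) by rewrite /s liftK.
have Ls i : sqint mu (s i).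
  by have [j ->|->] := unliftP ord0 i; rewrite ?sS ?s0; [exact: sqint_primitive|exact: sqint_cst].
have Cs i : reduced_spline true p.+1 (s i).
  have [j ->|->] := unliftP ord0 i; rewrite ?sS ?s0 /=.
    by exists 0, (t j); split=> //; apply/funext => x; rewrite add0r.
  exists 1, (fun=> 0); split; first exact: reduced_spline0.
  by apply/funext => x; rewrite primitive0 addr0.
have [M' [e [oe Ce se]]] := @gram_schmidt _ _ _ mu (reduced_spline true p.+1) _ s
  (reduced_spline0 true p.+1) (fun a f g => @reduced_spline_lin true p.+1 a f g) Ls Cs.
exists M', e; split => //; first by move=> _; rewrite -s0; exact: se.
move=> f Lf _.
set r := oresidual mu t f.
have Lr : sqint mu r by exact: sqint_oresidual.
have LKr : sqint mu (primitive r) by exact: sqint_primitive.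
pose m := mean01 (primitive r); pose y x := primitive r x - m.
have Lm := sqint_cst mu m; have L1 := sqint_cst mu 1.
have Ly : sqint mu y := sqintB LKr Lm.
pose c (i : 'I_M.+1) := if unlift ord0 i is Some j then ip mu f (t j) else m.
have vE x : lincomb s c x = m + primitive (oproj mu t f) x.
  rewrite /lincomb big_ord_recl /c unlift_none s0 mulr1; congr (_ + _).
  rewrite primitive_lincomb//; apply: eq_bigr => j _; by rewrite liftK sS.
have Lv : sqint mu (lincomb s c) by exact: sqint_lincomb.
have ve : aespan mu e (lincomb s c) by exact: aespan_lincomb.
have LKf := sqint_primitive Lf.
apply: le_trans (oresidual_best oe LKf Lv ve) _.
have -> : (fun x => primitive f x - lincomb s c x) = y.
  apply/funext => x; rewrite vE /y /r /oresidual primitiveB//; last exact: sqint_oproj.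
  by ring.
have y0 : mean01 y = 0.
  by rewrite mean01E /y (ipBl LKr Lm L1) -!mean01E [X in _ - X]mean_cst subrr.
apply: (skew_duality ot Lf Ly); last by apply: (Bt _ Ly); rewrite y0 eqxx.
have := ip_primitive Ly Lr; rewrite [X in X * _]y0 mul0r => /eqP; rewrite addr_eq0 => /eqP <-.
rewrite {2}/y (ipBr LKr Lm Ly).
have -> : (fun=> m) = (fun x => m * (fun=> 1) x) :> (R -> R) by apply/funext => x; rewrite mulr1.
by rewrite (ipZr m L1 Ly) -mean01E y0 mulr0 subr0.
Qed.

(** Here the error is [primitive r] itself, and the product in [ip_primitive] vanishes because [r]
    has mean zero, the constants being in the span of [t]. The competitor must be the primitive of a
    spline of mean zero; the projection of [f] is one, as both [f] and [r] have mean zero. *)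
Lemma primitive_approx_sin p : primitive_approx true p -> primitive_approx false p.+1.
Proof.
move=> [M [t [ot Ct t1 Bt]]]; have Lt := ot.1.
have [w1 Co oE] := reduced_spline1 p.
have Lo := sqint_reduced_spline Co.
have mean_o : mean01 w1 = 1.
  by rewrite -[RHS]mean_cst; apply: ae_eq_Rintegral => //; exact: Lo.1.
(* The generators need not have mean zero one by one; subtracting a multiple of [w1], the spline
   version of 1, corrects them inside the space. *)
pose t' j x := - mean01 (t j) * w1 x + t j x.
have Ct' j : reduced_spline true p (t' j) by exact: reduced_spline_lin.
have Lt' j := sqint_reduced_spline (Ct' j).
have mean_t' j : mean01 (t' j) = 0.
  by rewrite mean01D//; [rewrite mean01Z// mean_o mulr1 addNr|exact: sqintZ].
pose s j := primitive (t' j).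
have Ls j : sqint mu (s j) by exact: sqint_primitive.
have Cs j : reduced_spline false p.+1 (s j) by exists (t' j).
have [M' [e [oe Ce se]]] := @gram_schmidt _ _ _ mu (reduced_spline false p.+1) _ s
  (reduced_spline0 false p.+1) (fun a f g => @reduced_spline_lin false p.+1 a f g) Ls Cs.
exists M', e; split => // f Lf /= /eqP f0.
set r := oresidual mu t f.
have Lr : sqint mu r by exact: sqint_oresidual.
pose y := primitive r; have Ly : sqint mu y by exact: sqint_primitive.
have r0 : mean01 r = 0 := mean_oresidual ot (t1 isT) Lf.
(* This sum is the total multiple of [w1] subtracted in the combination with the coefficients of
   [f]: the corrections cancel. *)
have P0 : \sum_(j < M) ip mu f (t j) * mean01 (t j) = 0.
  rewrite -mean01_lincomb// -/(oproj mu t f).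
  have : mean01 r = mean01 f - mean01 (oproj mu t f).
    have Lof : sqint mu (oproj mu t f) := sqint_oproj _ ot; have L1 := sqint_cst mu 1.
    by rewrite !mean01E ipBl.
  by rewrite r0 f0 sub0r => /esym/eqP; rewrite oppr_eq0 => /eqP.
pose c j := ip mu f (t j).
have vE x : lincomb s c x = primitive (oproj mu t f) x.
  rewrite -primitive_lincomb//; congr (primitive _ x); apply/funext => w.
  rewrite /lincomb /t'; under eq_bigr do rewrite mulrDr.
  rewrite big_split/= [X in X + _](_ : _ = - w1 w * \sum_(j < M) ip mu f (t j) * mean01 (t j)).
    by rewrite P0 mulr0 add0r.
  by rewrite mulr_sumr; apply: eq_bigr => j _; rewrite /c; ring.
have Lv : sqint mu (lincomb s c) by exact: sqint_lincomb.
have ve : aespan mu e (lincomb s c) by exact: aespan_lincomb.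
have LKf := sqint_primitive Lf.
apply: le_trans (oresidual_best oe LKf Lv ve) _.
have -> : (fun x => primitive f x - lincomb s c x) = y.
  by apply/funext => x; rewrite vE /y /r /oresidual primitiveB//; exact: sqint_oproj.
apply: (skew_duality ot Lf Ly); last exact: (Bt _ Ly isT).
have := ip_primitive Ly Lr; rewrite [X in _ * X]r0 mulr0 => /eqP.
by rewrite addr_eq0 => /eqP <-.
Qed.

Lemma primitive_approxP b p : primitive_approx b p.
Proof.
elim: p b => [|p ih] b; first exact: primitive_approx0.
by case: b; [exact: primitive_approx_cos|exact: primitive_approx_sin].
Qed.

End spline_projection.

(** * Test functions and weak derivatives on the line *)

Section primitive_of_derivative.
Context (R : realType).
Local Notation mu := (mu01 R).
Implicit Types f g s t F : R -> R.

Lemma derivable_continuous F : (forall x, derivable F x 1) -> continuous F.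
Proof. by move=> dF x; apply/differentiable_continuous; rewrite -derivable1_diffP. Qed.

Lemma measurable_continuous f : continuous f -> measurable_fun setT (f : measurableTypeR R -> R).
Proof. by move=> cf; exact: continuous_measurable_fun. Qed.

Lemma primitive_lebesgue f x : measurable_fun setT (f : measurableTypeR R -> R) -> 0 <= x <= 1 ->
  primitive f x = \int[lebesgue_measure]_(y in `[0, x]) f y.
Proof.
move=> mf /andP[x0 x1]; rewrite /primitive /Rintegral; congr fine.
rewrite -integral_itv_obnd_cbnd; last by apply/measurable_EFinP; exact: measurable_funTS.
rewrite -integral_itv_bndo_bndc; last by apply/measurable_EFinP; exact: measurable_funTS.
rewrite integral_mu01; last first.
  by apply/measurable_EFinP; apply: measurable_funM => //; exact: measurable_lt_r.
rewrite integral_mkcond [RHS]integral_mkcond; congr integral; apply/funext => y.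
rewrite !patchE /unit_itv /ltind.
have [yx|xy] := ltP y x; last first.
  rewrite mul0r [y \in `]0, x[%classic](_ : _ = false); first by case: ifP.
  by apply/negbTE; rewrite notin_setE /= in_itv/= => /andP[_]; rewrite ltNge xy.
rewrite mul1r; congr (if _ then _ else _).
by apply/idP/idP; rewrite !inE /= !in_itv/= yx => /andP[-> _]//=; exact: lt_le_trans yx x1.
Qed.

Lemma primitive_derive1 F x : (forall y, derivable F y 1) -> continuous F^`() -> 0 <= x <= 1 ->
  primitive F^`() x = F x - F 0.
Proof.
move=> dF cF x01; rewrite primitive_lebesgue//; last exact: measurable_continuous.
have [x0|x0] := eqVneq x 0.
  by rewrite x0 set_itv1 Rintegral_set1 subrr.
have xp : 0 < x by rewrite lt_def x0; case/andP: x01.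
have CF := derivable_continuous dF.
rewrite /Rintegral (@continuous_FTC2 _ F^`() F)//.
- by apply: continuous_subspaceT => y; exact: cF.
- split=> //; first by apply: cvg_at_right_filter; exact: CF.
  by apply: cvg_at_left_filter; exact: CF.
Qed.

Lemma mean01_primitive f : measurable_fun setT (f : measurableTypeR R -> R) ->
  primitive f 1 = \int[mu]_x f x.
Proof.
move=> mf; apply: ae_eq_Rintegral => //.
  by apply: measurable_funM => //; exact: measurable_lt_r.
by apply: ae_mono (@mu01_ae_unit R) => x /andP[_ x1]; rewrite /ltind x1 mul1r.
Qed.

End primitive_of_derivative.

Section test_functions.
Context (R : realType).
Local Notation mu := (mu01 R).
Implicit Types f g s t phi : R -> R.

Definition smooth1 phi := forall k x, derivable (derive1n k phi) x 1.

Lemma smooth1_derive1 phi : smooth1 phi -> smooth1 phi^`().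
Proof. by move=> sphi k x; rewrite -derive1Sn; exact: sphi. Qed.

Lemma eq_derive1_near f g (x : R) : (\near x, f x = g x) -> f^`() x = g^`() x.
Proof. by move=> fg; rewrite !derive1E; apply: near_eq_derive => //; rewrite oner_neq0. Qed.

Lemma test_function_derive1 (D : set R) phi : test_function D phi -> test_function D phi^`().
Proof.
move=> [sphi [cphi Dphi]]; split; first exact: smooth1_derive1.
have sub : closure [set x | phi^`() x != 0] `<=` closure [set x | phi x != 0].
  rewrite [X in _ `<=` X](closure_id _).1; last exact: closed_closure.
  apply: closure_subset => x /= phi'x; apply: contrapT => nx.
  move/negP: phi'x; apply; apply/eqP.
  have <- : (fun=> 0 : R)^`() x = 0 by rewrite derive1_cst.
  apply: eq_derive1_near.
  have := open_nbhs_nbhs (conj (closed_openC (@closed_closure _ [set x | phi x != 0])) nx).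
  apply: filterS => y ny; apply/eqP; apply: contrapT => /negP phiy.
  by apply: ny; exact: subset_closure.
split; last exact: subset_trans Dphi.
by apply: subclosed_compact cphi sub => //; exact: closed_closure.
Qed.

Lemma test_function_derive1n (D : set R) k phi : test_function D phi -> test_function D (derive1n k phi).
Proof. by elim: k => // k ih /ih; rewrite derive1nS; exact: test_function_derive1. Qed.

Lemma test_function_out (D : set R) phi x : test_function D phi -> ~ D x -> phi x = 0.
Proof.
move=> [_ [_ Dphi]] Dx; apply/eqP; apply: contrapT => /negP phix; apply: Dx; apply: Dphi.
exact: subset_closure.
Qed.

Lemma test_function_continuous (D : set R) phi : test_function D phi -> continuous phi.
Proof. by move=> [sphi _]; apply: derivable_continuous => x; exact: (sphi 0%N). Qed.

Lemma primitive_test_function phi x : test_function `]0, 1[ phi -> 0 <= x <= 1 ->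
  primitive phi^`() x = phi x.
Proof.
move=> tphi x01; rewrite primitive_derive1//.
- rewrite (test_function_out (x := 0) tphi) ?subr0//=.
  by rewrite in_itv/= ltxx.
- by move=> y; exact: (tphi.1 0%N).
- exact: test_function_continuous (test_function_derive1 tphi).
Qed.

Lemma sqint_continuous f : continuous f -> sqint mu f.
Proof.
move=> cf; have mf : measurable_fun setT (f : measurableTypeR R -> R) by exact: measurable_continuous.
have [x _ xmax] := EVT_max ler01 (continuous_subspaceT cf : {within `[0, 1], continuous f}).
have [y _ ymin] := EVT_min ler01 (continuous_subspaceT cf : {within `[0, 1], continuous f}).
pose M := `|f x| + `|f y|.
(* A continuous function may be unbounded on the line, so it is replaced by 0 where [mu] has no
   mass. *)
pose k z := if 0 < z < 1 then f z else 0.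
have kE : {ae mu, forall z, k z = f z}.
  by apply: ae_mono (@mu01_ae_unit R) => z; rewrite /k => ->.
apply: ae_sqint_eq kE _ => //; apply: (@sqint_bounded _ _ _ _ _ M).
  rewrite (_ : k = patch (fun=> 0) `]0, 1[%classic f); last first.
    by apply/funext => z; rewrite patchE mem_setE in_itv.
  by apply/(measurable_restrictT f (measurable_itv _)); exact: measurable_funTS.
move=> z; rewrite /k; case: ifPn => [/andP[z0 z1]|_]; last by rewrite normr0 addr_ge0.
have z01 : z \in `[0, 1]%R by rewrite in_itv/= !ltW.
have := xmax _ z01; have := ymin _ z01; rewrite /M.
have := ler_norm (f x); have := ler_norm (- f y); rewrite normrN.
have := normr_ge0 (f x); have := normr_ge0 (f y) => ? ? ? ? ? ?.
by rewrite ler_norml; apply/andP; split; lra.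
Qed.

Lemma sqint_test_function phi : test_function `]0, 1[ phi -> sqint mu phi.
Proof. by move=> tphi; apply: sqint_continuous; exact: test_function_continuous tphi. Qed.

Lemma mean_test_function_derive1 phi : test_function `]0, 1[ phi -> mean01 phi^`() = 0.
Proof.
move=> tphi; have tphi' := test_function_derive1 tphi.
rewrite /mean01 -mean01_primitive; last first.
  by apply: measurable_continuous; exact: test_function_continuous tphi'.
rewrite primitive_test_function// ?ler01 ?lexx//.
by apply: (test_function_out tphi); rewrite /= in_itv/= ltxx andbF.
Qed.

(** Integration by parts is the skew symmetry of [primitive] paired with the derivative of [phi],
    which has mean zero and whose primitive is [phi] on the interval. *)
Lemma ip_primitive_test_function t phi : sqint mu t -> test_function `]0, 1[ phi ->
  ip mu (primitive t) phi^`() = - ip mu t phi.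
Proof.
move=> Lt tphi; have tphi' := test_function_derive1 tphi.
have Lphi := sqint_test_function tphi; have Lphi' := sqint_test_function tphi'.
have := ip_primitive Lphi' Lt; rewrite [X in X * _](mean_test_function_derive1 tphi) mul0r.
move=> /eqP; rewrite addr_eq0 ipC => /eqP ->; congr (- _); rewrite ipC [RHS]ipC.
have LK := sqint_primitive Lphi'.
apply: ae_eq_ipr; [exact: LK.1|exact: Lphi.1|exact: Lt.1|].
apply: ae_mono (@mu01_ae_unit R) => x /andP[x0 x1].
by rewrite primitive_test_function// !ltW.
Qed.

End test_functions.

Section square_integrable_on.
Context d (T : measurableType d) (R : realType).
Variables (mu nu : {measure set T -> \bar R}) (D : set T).
Hypothesis mD : measurable D.
Hypothesis nuE : forall A, measurable A -> nu A = mu (A `&` D).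
Implicit Types f g : T -> R.

Lemma L2normE f : measurable_fun setT (f \_ D) ->
  L2norm mu D f = ((\int[nu]_x (((f \_ D) x) ^+ 2)%:E) `^ 2^-1)%E.
Proof.
move=> mf; rewrite /L2norm unlock; congr (_ `^ _)%E.
have mf2 : measurable_fun setT (fun x => (((f \_ D) x) ^+ 2)%:E).
  by apply/measurable_EFinP; exact: measurable_funX.
rewrite (integral_restricted mD nuE mf2) [RHS]integral_mkcond.
apply: eq_integral => x _ /=; rewrite powR_mulrn//.
rewrite real_normK ?num_real// !patchE; case: ifPn => // _.
by rewrite expr0n.
Qed.

Lemma in_L2P f : in_L2 mu D f <-> sqint nu (f \_ D).
Proof.
have E : measurable_fun setT (f \_ D) ->
    (L2norm mu D f < +oo)%E <-> (\int[nu]_x (((f \_ D) x) ^+ 2)%:E < +oo)%E.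
  move=> mf; rewrite L2normE//; split; last exact: poweR_lty.
  rewrite !ltey; apply: contraNN => /eqP ->.
  by rewrite poweRE invr_eq0 pnatr_eq0.
rewrite /in_L2 /sqint; split.
  move=> fL; have mf : measurable_fun setT (f \_ D) by have := sub_Lfun_mfun fL; rewrite inE.
  by split=> //; apply/E => //; have := sub_Lfun_finLfun fL; rewrite inE.
move=> [mf f2]; apply/andP; split; first by rewrite inE.
by rewrite inE /=; apply/E.
Qed.

Lemma Rintegral_restricted f : measurable_fun setT f ->
  \int[nu]_x f x = \int[mu]_(x in D) f x.
Proof.
by move=> mf; rewrite /Rintegral (integral_restricted mD nuE)//; exact/measurable_EFinP.
Qed.

Lemma sqint_restrict f : sqint nu f -> sqint nu (f \_ D).
Proof.
move=> [mf f2]; have mfD : measurable_fun setT (f \_ D).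
  by apply/(measurable_restrictT f mD); exact: measurable_funTS.
split=> //; apply: le_lt_trans f2; apply: ge0_le_integral => //.
- by move=> x _; rewrite lee_fin sqr_ge0.
- by apply/measurable_EFinP; exact: measurable_funX.
- by apply/measurable_EFinP; exact: measurable_funX.
by move=> x _; rewrite lee_fin patchE; case: ifP => // _; rewrite expr0n sqr_ge0.
Qed.

End square_integrable_on.

(** * Reduced splines belong to the spline spaces of the theorem *)

Section spline_regularity.
Context (R : realType).
Local Notation mu := (mu01 R).
Variables (h : R) (N : nat).
Hypotheses (h0 : 0 < h) (hN : h * N%:R = 1).
Implicit Types f g s t : R -> R.

Lemma in_L2_unit_itv f : sqint mu f -> in_L2 lebesgue_measure `]0, 1[ f.
Proof.
move=> Lf; apply/(in_L2P (nu := mu) (@measurable_unit_itv R)) => //.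
by apply: sqint_restrict => //; exact: measurable_unit_itv.
Qed.

Lemma ip_unit_itv f g : sqint mu f -> sqint mu g ->
  \int[lebesgue_measure]_(x in `]0, 1[) (f x * g x) = ip mu f g.
Proof.
move=> Lf Lg; symmetry.
apply: (@Rintegral_restricted _ _ _ lebesgue_measure mu _ (@measurable_unit_itv R)) => //.
by apply: measurable_funM; [exact: Lf.1|exact: Lg.1].
Qed.

(** Each derivative removes one primitive and flips [b]. The additive constant is invisible because
    the derivative of a test function has mean zero. *)
Lemma reduced_spline_weak_derivative b p k s : reduced_spline h N b p s -> (k <= p)%N ->
  exists2 g, sqint mu g & forall phi, test_function `]0, 1[ phi ->
    ip mu s (derive1n k phi) = (-1) ^+ k * ip mu g phi.
Proof.
elim: k b p s => [|k ih] b p s Cs kp.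
  exists s; first exact: sqint_reduced_spline Cs.
  by move=> phi _; rewrite expr0 mul1r.
case: p Cs kp => // p Cs kp.
have [c [t [Ct ->]]] : exists c t, reduced_spline h N (~~ b) p t /\ s = (fun x => c + primitive t x).
  case: b Cs => /=; first by move=> [c [t [Ct ->]]]; exists c, t.
  by move=> [t [Ct _ ->]]; exists 0, t; split=> //; apply/funext => x; rewrite add0r.
have [g Lg gE] := ih _ _ _ Ct kp.
have Lt := sqint_reduced_spline Ct.
exists g => // phi tphi.
have tk := test_function_derive1n k tphi; have tk' := test_function_derive1 tk.
have Ltk' := sqint_test_function tk'.
rewrite derive1nS (ipDl (sqint_cst mu c) (sqint_primitive Lt) Ltk').
rewrite (ip_primitive_test_function Lt tk) gE// exprS mulN1r mulNr.
suff -> : ip mu (fun=> c) (derive1n k phi)^`() = 0 by rewrite add0r.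
have -> : (fun=> c) = (fun x => c * (fun=> 1) x) :> (R -> R) by apply/funext => x; rewrite mulr1.
rewrite (ipZl c (sqint_cst mu 1) Ltk') ipC -mean01E.
by rewrite (mean_test_function_derive1 tk) mulr0.
Qed.

Lemma reduced_spline_sobolev b p s : reduced_spline h N b p s -> sobolev `]0, 1[ p s.
Proof.
move=> Cs; have Ls := sqint_reduced_spline Cs; split; first exact: in_L2_unit_itv.
move=> k kp; have [g Lg gE] := reduced_spline_weak_derivative Cs kp.
exists g; first exact: in_L2_unit_itv.
move=> phi tphi; rewrite ip_unit_itv//; last first.
  by apply: sqint_test_function; exact: test_function_derive1n.
by rewrite ip_unit_itv ?gE//; exact: sqint_test_function.
Qed.

Definition antideriv (q : {poly R}) : {poly R} := \poly_(i < (size q).+1) (q`_i.-1 / i%:R *+ (i != 0)%N).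

Lemma antiderivK q : ((antideriv q)^`())%R = q.
Proof.
apply/polyP => i; rewrite coef_deriv coef_poly ltnS.
case: ltnP => [iq|qi]; last by rewrite nth_default// mul0rn.
by rewrite /= mulr1n -[LHS]mulr_natr mulfVK// pnatr_eq0.
Qed.

Lemma size_antideriv q : (size (antideriv q) <= (size q).+1)%N.
Proof. exact: size_poly. Qed.

Lemma primitive_horner (q : {poly R}) x : 0 <= x <= 1 ->
  primitive (horner q) x = (antideriv q).[x] - (antideriv q).[0].
Proof.
move=> x01; have dQ y : derivable (horner (antideriv q)) y 1 by exact: derivable_horner.
have Q' : (horner (antideriv q))^`() = horner q by rewrite -derivE antiderivK.
have cQ : continuous (horner (antideriv q))^`().
  by rewrite Q'; apply: derivable_continuous => y; exact: derivable_horner.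
by have := primitive_derive1 dQ cQ x01; rewrite Q'.
Qed.

(** The difference of the primitives at [x] and [a] integrates over [a, x) only, where [t] and [q]
    agree except possibly at the point [a]. *)
Lemma primitive_piece t (q : {poly R}) a x : sqint mu t -> 0 <= a -> a <= x -> x <= 1 ->
  (forall y, a < y <= x -> t y = q.[y]) ->
  primitive t x = primitive t a + (antideriv q).[x] - (antideriv q).[a].
Proof.
move=> Lt a0 ax x1 tq; have a01 : 0 <= a <= 1 by rewrite a0 (le_trans ax).
have x01 : 0 <= x <= 1 by rewrite x1 (le_trans a0).
have Lq : sqint mu (horner q).
  by apply: sqint_continuous; apply: derivable_continuous => y; exact: derivable_horner.
suff : primitive t x - primitive t a = primitive (horner q) x - primitive (horner q) a.
  by rewrite !primitive_horner// => E; rewrite -(subrK (primitive t a) (primitive t x)) E; ring.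
rewrite /primitive -!RintegralB//; try by apply: integrable_lt; exact: sqint_integrable.
have m (f : R -> R) : sqint mu f ->
    measurable_fun setT ((fun y => ltind y x * f y - ltind y a * f y) : measurableTypeR R -> R).
  by move=> [mf _]; apply: measurable_funB; apply: measurable_funM => //; exact: measurable_lt_r.
apply: ae_eq_Rintegral; [exact: m|exact: m|].
apply: ae_mono (mu01_ae_neq a) => y ya; rewrite /ltind.
have [yx|xy] := ltP y x; last by rewrite [y < a](_ : _ = false) ?mul0r//; apply/negbTE; rewrite -leNgt (le_trans ax).
move: ya; case: ltgtP => // ay _; first by rewrite !subrr.
by rewrite tq// ay ltW.
Qed.

(** The boundary conditions are put on the first and last polynomial, where derivatives are
    algebraic. Differentiating a piece lowers the degree and flips the parity, so the only new
    condition is the value itself for [b = false]: a primitive vanishes at 0, and at 1 it equals the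
    mean of [t]. *)
Lemma reduced_spline_pieces b p s : reduced_spline h N b p s ->
  exists q : nat -> {poly R}, [/\ forall j, (size (q j) <= p.+1)%N,
    forall j x, (j < N)%N -> node h j < x <= node h j.+1 -> s x = (q j).[x] &
    forall k, (k < p)%N -> odd k == b -> ((q 0%N)^`(k).[0])%R = 0 /\ ((q N.-1)^`(k).[1])%R = 0].
Proof.
have N0 : (0 < N)%N.
  by rewrite lt0n; apply/eqP => N0; have /eqP := hN; rewrite N0 mulr0 eq_sym oner_eq0.
have nodeN : node h N = 1 by [].
have last_cell : node h N.-1 < 1 <= node h N.-1.+1.
  by rewrite prednK// nodeN lexx andbT -nodeN /node ltr_pM2l// ltr_nat ltn_predL.
elim: p b s => [|p ih] b s Cs.
  have [c ->] : exists c, s = stepf h N c by case: b Cs.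
  exists (fun j => (c j)%:P); split=> [j|j x jN jx|//]; first exact: size_polyC_leq1.
  by rewrite (stepfE h0 _ jN jx) hornerC.
have [c [t [Ct sE bc]]] : exists c t, [/\ reduced_spline h N (~~ b) p t,
    s = (fun x => c + primitive t x) & ~~ b -> c = 0 /\ mean01 t = 0].
  case: b Cs => /=; first by move=> [c [t [Ct ->]]]; exists c, t.
  by move=> [t [Ct t0 ->]]; exists 0, t; split=> //; apply/funext => x; rewrite add0r.
have Lt := sqint_reduced_spline Ct.
have [q [sq tq qbc]] := ih _ _ Ct.
pose Q j := antideriv (q j) + (s (node h j) - (antideriv (q j)).[node h j])%:P.
(* The cell is closed on the left here, since the value at 0 must be read off from the first
   piece. *)
have sQ j x : (j < N)%N -> node h j <= x <= node h j.+1 -> s x = (Q j).[x].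
  move=> jN /andP[jx xj]; have /andP[n0 _] := node_itv h0 hN (ltnW jN).
  have /andP[_ n1] := node_itv h0 hN jN.
  rewrite hornerD hornerC sE (primitive_piece (q := q j) Lt n0 jx (le_trans xj n1)); first by ring.
  by move=> y /andP[jy yx]; apply: tq => //; rewrite jy (le_trans yx).
have Q' j : ((Q j)^`())%R = q j by rewrite derivD derivC addr0 antiderivK.
exists Q; split.
- move=> j; rewrite (leq_trans (size_polyD _ _))// geq_max.
  by rewrite (leq_trans (size_antideriv _)) ?ltnS ?sq// (leq_trans (size_polyC_leq1 _)).
- by move=> j x jN /andP[jx xj]; apply: sQ => //; rewrite (ltW jx).
case=> [_ /eqP b0|k kp kb]; last first.
  rewrite !derivSn !Q'; apply: qbc => //.
  by move: kb => /=; case: (odd k); case: b {Cs Ct ih bc sQ}.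
have [c0 t0] : c = 0 /\ mean01 t = 0 by apply: bc; rewrite -b0.
have node0 : node h 0 = 0 by rewrite /node mulr0.
have Q0 : (Q 0%N).[0] = s 0.
  by rewrite -sQ// node0 lexx/= /node mulr1 ltW.
have Q1 : (Q N.-1).[1] = s 1.
  by case/andP: last_cell => l1 l2; rewrite -sQ ?ltn_predL// (ltW l1).
rewrite !derivn0 Q0 Q1 sE c0 !add0r mean01_primitive; last exact: Lt.1.
split; last exact: t0.
rewrite /primitive -[RHS](mean_cst 0); apply: ae_eq_Rintegral => //.
  by apply: measurable_funM; [exact: measurable_lt_r|exact: Lt.1].
apply: ae_mono (@mu01_ae_unit R) => y /andP[y0 _].
by rewrite /ltind ltNge (ltW y0) mul0r.
Qed.

Lemma eq_derive1n_open f g (U : set R) k : open U -> {in U, f =1 g} ->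
  {in U, derive1n k f =1 derive1n k g}.
Proof.
move=> oU fg; elim: k => [//|k ih] x Ux; rewrite !derive1nS.
apply: eq_derive1_near; have := open_nbhs_nbhs (conj oU (set_mem Ux)).
by apply: filterS => y Uy; apply: ih; rewrite inE.
Qed.

Lemma derive1n_horner (q : {poly R}) k : derive1n k (horner q) = horner (q^`(k))%R.
Proof. by elim: k => [|k ih]; rewrite ?derivn0// derive1nS ih -derivE -derivnS. Qed.

Lemma continuous_horner (q : {poly R}) : continuous (horner q).
Proof. by apply: derivable_continuous => y; exact: derivable_horner. Qed.

(** In the open first and last cells the spline is a polynomial, so its derivatives are those of the
    polynomial and the one-sided limits are polynomial values at 0 and 1. *)
Lemma reduced_spline_tilde p s : N = Num.truncn h^-1 -> reduced_spline h N true p s ->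
  spline_tilde p h s.
Proof.
move=> NE Cs; have [q [sq sE bc]] := reduced_spline_pieces Cs.
split; first (split; first exact: reduced_spline_sobolev Cs).
  move=> j; rewrite -NE => jN; exists (q j) => // x; rewrite inE /= in_itv/= => xj.
  exact: sE.
have N0 : (0 < N)%N.
  by rewrite lt0n; apply/eqP => N0; have /eqP := hN; rewrite N0 mulr0 eq_sym oner_eq0.
have nodeN : node h N.-1 + h = 1 by rewrite -nodeS prednK.
have nodelt : node h N.-1 < 1 by rewrite -nodeN ltrDl.
have agree k j x : (j < N)%N -> node h j < x < node h j + h ->
    derive1n k s x = (horner (q j)^`(k)%R) x.
  move=> jN jx; rewrite -derive1n_horner.
  apply: (@eq_derive1n_open _ _ `]node h j, node h j + h[%classic) => //.
  - by move=> y; rewrite inE /= in_itv/= -nodeS => /andP[y1 y2]; apply: sE; rewrite // y1 ltW.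
  - by rewrite inE /= in_itv.
move=> l lp; have [|b0 b1] := bc (2 * l).+1 lp; first by rewrite oddS oddM.
split.
- rewrite -[X in _ --> X]b0; have := cvg_at_right_filter (@continuous_horner (q 0%N)^`((2 * l).+1)%R 0).
  apply: cvg_trans; apply: near_eq_cvg; near=> x.
  rewrite (@agree _ 0%N)// /node mulr0 add0r; apply/andP; split; first by near: x; exact: nbhs_right_gt.
  by near: x; exact: nbhs_right_lt.
- rewrite -[X in _ --> X]b1; have := cvg_at_left_filter (@continuous_horner (q N.-1)^`((2 * l).+1)%R 1).
  apply: cvg_trans; apply: near_eq_cvg; near=> x.
  rewrite (@agree _ N.-1) ?ltn_predL// nodeN; apply/andP; split; last by near: x; exact: nbhs_left_lt.
  by near: x; exact: (nbhs_left_gt nodelt).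
Unshelve. all: by end_near.
Qed.

End spline_regularity.

(** * Smooth cutoffs and the fundamental lemma *)

Section smooth_calculus.
Context (R : realType).
Implicit Types f g : R -> R.

(** A truncation of [smooth1] that recurses on the derivative of [f]; products and affine
    substitutions then go by induction, without a Leibniz formula for [derive1n]. *)
Fixpoint smooth_upto k f : Prop :=
  (forall x, derivable f x 1) /\ if k is k'.+1 then smooth_upto k' f^`() else True.

Lemma smooth1P f : smooth1 f <-> forall k, smooth_upto k f.
Proof.
split=> [sf k|].
  elim: k f sf => [|k ih] f sf /=; first by split=> // x; exact: (sf 0%N).
  split; first by move=> x; exact: (sf 0%N).
  by apply: ih; exact: smooth1_derive1.
move=> sf k; elim: k f sf => [|k ih] f sf x; first by have [] := sf 0%N.
by rewrite derive1Sn; apply: ih => k'; have [] := sf k'.+1.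
Qed.

Lemma smooth_uptoS k f : smooth_upto k.+1 f -> smooth_upto k f.
Proof. by elim: k f => [|k ih] f /= [df //] sf; split=> //; exact: ih. Qed.

Lemma smooth_uptoD k f g : smooth_upto k f -> smooth_upto k g -> smooth_upto k (fun x => f x + g x).
Proof.
elim: k f g => [|k ih] f g /= [df sf] [dg sg].
  by split=> // x; exact: derivableD.
split; first by move=> x; exact: derivableD.
have -> : (fun x => f x + g x)^`() = (fun x => derive1 f x + derive1 g x).
  by apply/funext => x; rewrite !derive1E; exact: deriveD.
exact: ih.
Qed.

Lemma smooth_uptoM k f g : smooth_upto k f -> smooth_upto k g -> smooth_upto k (fun x => f x * g x).
Proof.
elim: k f g => [|k ih] f g.
  by move=> [df sf] [dg sg]; split=> // x; exact: derivableM.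
move=> sf sg; have [df sf'] := sf; have [dg sg'] := sg.
split; first by move=> x; exact: derivableM.
have -> : (fun x => f x * g x)^`() = (fun x => f x * derive1 g x + g x * derive1 f x).
  by apply/funext => x; rewrite !derive1E; exact: deriveM.
by apply: smooth_uptoD; apply: ih => //; exact: smooth_uptoS.
Qed.

Lemma smooth1M f g : smooth1 f -> smooth1 g -> smooth1 (fun x => f x * g x).
Proof. by move=> /smooth1P sf /smooth1P sg; apply/smooth1P => k; exact: smooth_uptoM. Qed.

Lemma smooth_upto_cst k (c : R) : smooth_upto k (fun=> c).
Proof.
elim: k c => [|k ih] c /=; first by split=> // x; exact: derivable_cst.
split; first by move=> x; exact: derivable_cst.
by rewrite [_^`()](_ : _ = fun=> 0); [exact: ih|apply/funext => x; exact: derive1_cst].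
Qed.

Lemma is_derive_affine (a b x : R) : is_derive x 1 (fun y : R => a * y + b) a.
Proof.
have := is_deriveD (is_deriveM (is_derive_cst a x 1) (is_derive_id x 1)) (is_derive_cst b x 1).
by rewrite -[a *: 1]/(a * 1) mulr1 scaler0 !addr0.
Qed.

Lemma derivable_affine (a b x : R) : derivable (fun y : R => a * y + b) x 1.
Proof. by have [] := is_derive_affine a b x. Qed.

Lemma derive1_affine (a b x : R) : (fun y : R => a * y + b)^`() x = a.
Proof. by rewrite derive1E; have [] := is_derive_affine a b x. Qed.

Lemma smooth_upto_affine k f (a b : R) : smooth_upto k f -> smooth_upto k (fun x => f (a * x + b)).
Proof.
have dfa g : (forall x, derivable g x 1) -> forall x, derivable (fun x => g (a * x + b)) x 1.
  move=> dg x; apply/derivable1_diffP; apply: (@differentiable_comp _ _ _ _ (fun y => a * y + b) g).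
    exact/derivable1_diffP/derivable_affine.
  exact/derivable1_diffP.
elim: k f => [|k ih] f /= [df sf]; first by split=> //; exact: dfa.
split; first exact: dfa.
have -> : (fun x => f (a * x + b))^`() = (fun x => derive1 f (a * x + b) * (fun=> a) x).
  apply/funext => x; have := @derive1_comp _ (fun y => a * y + b) f x (@derivable_affine a b x) (df (a * x + b)).
  by rewrite derive1_affine.
by apply: smooth_uptoM; [exact: ih|exact: smooth_upto_cst].
Qed.

Lemma smooth1_affine f (a b : R) : smooth1 f -> smooth1 (fun x => f (a * x + b)).
Proof. by move=> /smooth1P sf; apply/smooth1P => k; exact: smooth_upto_affine. Qed.

End smooth_calculus.

(** * The flat function exp(-1/x) and its derivatives *)

Section bump.
Context (R : realType).

Lemma derive_quadratic0 (f : R -> R) (C : R) : (forall x, `|f x| <= C * x ^+ 2) ->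
  derivable f 0 1 /\ f^`() 0 = 0.
Proof.
move=> fC.
have f0 : f 0 = 0 by apply/eqP; rewrite -normr_eq0 eq_le normr_ge0 (le_trans (fC 0))// expr0n mulr0.
have C0 : 0 <= C by have := fC 1; rewrite expr1n mulr1; apply: le_trans.
have cv : h^-1 *: (f (h *: 1 + 0) - f 0) @[h --> (0:R)^'] --> (0 : R).
  have M0 : 0 < C + 1 by rewrite ltr_wpDl.
  apply/cvgr0Pnorm_le => e e0; have eM : 0 < e / (C + 1) by rewrite divr_gt0.
  near=> y.
  have y0 : y != 0 by near: y; exact: nbhs_dnbhs_neq.
  have yC : C * `|y| <= e.
    apply: (@le_trans _ _ ((C + 1) * `|y|)); first by rewrite ler_wpM2r// lerDl.
    by rewrite mulrC -ler_pdivlMr//; near: y; exact: dnbhs0_le.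
  rewrite f0 /= subr0 addr0 -[_ *: _]/(y^-1 * _) -[y *: 1]/(y * 1) mulr1 normrM normfV.
  rewrite ler_pdivrMl ?normr_gt0// (le_trans (fC y))// mulrC -real_normK ?num_real//.
  by rewrite expr2 -mulrA ler_wpM2l// mulrC.
split; first by apply/cvg_ex; exists 0.
by rewrite derive1E /derive; apply/cvg_lim => //; exact: cv.
Unshelve. all: by end_near. Qed.

(* The family is closed under differentiation, so a quadratic bound at 0 shared by
   all its members makes them smooth. *)
Definition flat (P : {poly R}) (x : R) : R :=
  if 0 < x then P.[x^-1] * expR (- x^-1) else 0.

(** With z = 1/x, the exponential series gives z^(i+2) exp(-z) <= (i+2)!, applied to each monomial
    of [P]; the two extra powers of z are the factor x^2. *)
Lemma flat_bound (P : {poly R}) : exists C, forall x, `|flat P x| <= C * x ^+ 2.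
Proof.
exists (\sum_(i < size P) `|P`_i| * (i.+2)`!%:R) => x; rewrite /flat.
case: ifPn => [x0|_]; last first.
  by rewrite normr0 mulr_ge0 ?sqr_ge0// sumr_ge0// => i _; rewrite mulr_ge0.
have z0 : 0 < x^-1 by rewrite invr_gt0.
set z := x^-1 in z0 *.
have -> : x ^+ 2 = (z ^+ 2)^-1 by rewrite /z exprVn invrK.
rewrite normrM (ger0_norm (expR_ge0 _)) ler_pdivlMr ?exprn_gt0// horner_coef.
apply: (@le_trans _ _ ((\sum_(i < size P) `|P`_i| * z ^+ i) * expR (- z) * z ^+ 2)).
  apply: ler_wpM2r; first exact: sqr_ge0.
  apply: ler_wpM2r; first exact: expR_ge0.
  apply: le_trans (ler_norm_sum _ _ _) _; apply: ler_sum => i _.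
  by rewrite normrM normrX (gtr0_norm z0).
rewrite -mulrA mulr_suml; apply: ler_sum => i _; rewrite -mulrA ler_wpM2l//.
rewrite mulrCA -exprD expRN mulrC ler_pdivrMr ?expR_gt0//.
have := @expR_ge1Dxn _ z i.+1 (ltW z0); rewrite addn2.
have F0 : 0 < (i.+2)`!%:R :> R by rewrite ltr0n fact_gt0.
move=> H; rewrite -ler_pdivrMl// mulrC; apply: le_trans H; by rewrite lerDr.
Qed.

(** For x > 0 both terms of the product rule carry the factor x^-2 from the chain rule through 1/x,
    which becomes ['X^2]. At 0 the derivative is settled by the quadratic bound. *)
Lemma flat_derive (P : {poly R}) :
  (forall x, derivable (flat P) x 1) /\ (flat P)^`() = flat ('X^2 * (P - (P^`())%R)).
Proof.
suff H x : derivable (flat P) x 1 /\ (flat P)^`() x = flat ('X^2 * (P - (P^`())%R)) x.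
  by split=> [x|]; [exact: (H x).1|apply/funext => x; exact: (H x).2].
have [x0|x0|->] := ltgtP x 0.
- have E : \near x, cst 0 x = flat P x.
    near=> y; rewrite /flat ltNge ltW//=; near: y.
    exact: lt_nbhsl.
  split; first by apply: (near_eq_derivable E); exact: derivable_cst.
  rewrite derive1E -(near_eq_derive _ E) ?derive_cst.
  by rewrite /flat ltNge ltW.
- have E : \near x, P.[x^-1] * expR (- x^-1) = flat P x.
    near=> y; rewrite /flat [0 < y](_ : _ = true)//; near: y.
    exact: lt_nbhsr.
  have xn0 : x != 0 by rewrite gt_eqF.
  have dV : is_derive x 1 (fun y : R => y^-1) (- x ^- 2).
    by have := @is_deriveV _ id x 1 1 xn0 (is_derive_id _ _); rewrite -[_ *: 1]/(_ * 1) mulr1.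
  have dP : is_derive x 1 (horner P \o (fun y : R => y^-1)) ((P^`())%R.[x^-1] * - x ^- 2).
    have dH : is_derive (x^-1) 1 (horner P) (P^`())%R.[x^-1].
      by split; [exact: derivable_horner|rewrite derivE derive1E].
    exact: is_derive1_comp.
  have dE : is_derive x 1 (expR \o (fun y : R => - y^-1)) (expR (- x^-1) * x ^- 2).
    have dN : is_derive x 1 (fun y : R => - y^-1) (x ^- 2) by have := is_deriveN dV; rewrite opprK.
    exact: is_derive1_comp.
  have [dM dMv] := is_deriveM dP dE.
  split; first exact: (near_eq_derivable E).
  rewrite derive1E -(near_eq_derive _ E) [LHS]dMv.
  rewrite /flat x0 !hornerE -![_ *: _]/(_ * _) /= exprVn; ring.
- have [C HC] := flat_bound P.
  have [d ->] := derive_quadratic0 HC; split=> //.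
  by rewrite /flat ltxx.
Unshelve. all: by end_near. Qed.

End bump.

Section cutoff.
Context (R : realType).

Lemma smooth1_flat (P : {poly R}) : smooth1 (flat P).
Proof.
move=> k; elim: k P => [|k ih] P x; first exact: (flat_derive P).1.
by rewrite derive1Sn (flat_derive P).2; exact: ih.
Qed.

Definition flat1 : R -> R := flat 1%:P.

Lemma flat1_itv x : 0 <= flat1 x <= 1.
Proof.
rewrite /flat1 /flat; case: ifPn => x0; last by rewrite lexx ler01.
by rewrite hornerC mul1r expR_ge0 expR_le1 oppr_le0 invr_ge0 ltW.
Qed.

Lemma flat1_le0 x : x <= 0 -> flat1 x = 0.
Proof. by move=> x0; rewrite /flat1 /flat ltNge x0. Qed.

Lemma flat1_ge x : 0 < x -> 1 - x^-1 <= flat1 x.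
Proof. by move=> x0; rewrite /flat1 /flat x0 hornerC mul1r expR_ge1Dx. Qed.

(** The factors vanish for x <= 1/(m+1) and for x >= min(b,1) - 1/(m+1), which keeps the support
    compact in (0,1). On (0, min(b,1)) both arguments tend to infinity, where exp(-1/y) tends to
    1. *)
Definition cutoff (b : R) (m : nat) (x : R) : R :=
  flat1 (m.+1%:R * x + -1) * flat1 (- m.+1%:R * x + (m.+1%:R * Num.min b 1 - 1)).

Lemma cutoff_itv b m x : 0 <= cutoff b m x <= 1.
Proof.
have /andP[h0 h1] := flat1_itv (m.+1%:R * x + -1).
have /andP[k0 k1] := flat1_itv (- m.+1%:R * x + (m.+1%:R * Num.min b 1 - 1)).
by rewrite /cutoff mulr_ge0// mulr_ile1.
Qed.

Lemma test_function_cutoff b m : test_function `]0, 1[ (cutoff b m).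
Proof.
have m0 : (0 : R) < m.+1%:R by rewrite ltr0n.
have mn0 : m.+1%:R != 0 :> R by rewrite gt_eqF.
split; first by apply: smooth1M; apply: smooth1_affine; exact: smooth1_flat.
have sub : closure [set x | cutoff b m x != 0] `<=` `[m.+1%:R^-1, Num.min b 1 - m.+1%:R^-1].
  rewrite [X in _ `<=` X](closure_id _).1; last exact: itv_closed.
  apply: closure_subset => x /=; rewrite in_itv/=; apply: contraNT; rewrite negb_and -!ltNge.
  case/orP => hx; rewrite /cutoff; apply/eqP.
    rewrite flat1_le0 ?mul0r// subr_le0 ltW//.
    by rewrite -[X in _ < X](mulfV mn0) ltr_pM2l.
  rewrite [X in _ * X]flat1_le0 ?mulr0// mulNr addrC subr_le0 ltW// ltrBlDr.
  by rewrite -[X in _ < _ + X](mulfV mn0) -mulrDr ltr_pM2l// -ltrBlDr.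
split; first by apply: subclosed_compact sub; [exact: closed_closure|exact: segment_compact].
apply: subset_trans sub _ => x /=; rewrite !in_itv/= => /andP[h1 h2].
rewrite (lt_le_trans _ h1) ?invr_gt0//= (le_lt_trans h2)// ltrBlDr.
by rewrite ltr_pwDr ?invr_gt0// ge_min lexx orbT.
Qed.

Lemma cvg_flat1 (y : nat -> R) : y m @[m --> \oo] --> +oo -> flat1 (y m) @[m --> \oo] --> (1 : R).
Proof.
move=> /cvgryPge yoo; apply/cvgrPdist_le => e e0; near=> m.
have ye : e^-1 <= y m by near: m; exact: yoo.
have y0 : 0 < y m by rewrite (lt_le_trans _ ye)// invr_gt0.
have /andP[f0 f1] := flat1_itv (y m).
rewrite ger0_norm ?subr_ge0// (le_trans (_ : _ <= (y m)^-1))//.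
  by have := flat1_ge y0; rewrite lerBlDr lerBlDr addrC.
by rewrite -[leRHS]invrK lef_pV2 ?posrE ?invr_gt0.
Unshelve. all: by end_near. Qed.

Lemma cvg_affine_pinfty (c d : R) : 0 < c -> m.+1%:R * c + d @[m --> \oo] --> +oo.
Proof.
move=> c0; apply/cvgryPge => A; near=> m.
rewrite -lerBlDr -ler_pdivrMr// (@le_trans _ _ m%:R) ?ler_nat//.
by near: m; exact: nbhs_infty_ger.
Unshelve. all: by end_near. Qed.

Lemma cvg_cutoff b x : 0 < x < 1 -> cutoff b m x @[m --> \oo] --> ((x < b)%R%:R : R).
Proof.
move=> /andP[x0 x1]; have [xb|bx] := ltP x b.
  rewrite -[X in _ --> X](mulr1 1); apply: cvgM; apply: cvg_flat1.
    exact: cvg_affine_pinfty.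
  have d0 : 0 < Num.min b 1 - x by rewrite subr_gt0 lt_min xb.
  have -> : (fun m : nat => - m.+1%:R * x + (m.+1%:R * Num.min b 1 - 1)) =
            (fun m : nat => m.+1%:R * (Num.min b 1 - x) + -1).
    by apply/funext => m; ring.
  exact: cvg_affine_pinfty.
have -> : (fun m => cutoff b m x) = fun=> 0; last exact: cvg_cst.
apply/funext => m; rewrite /cutoff [X in _ * X]flat1_le0 ?mulr0//.
have bE : Num.min b 1 = b by rewrite min_l// (le_trans bx)// ltW.
rewrite bE (_ : _ + _ = m.+1%:R * (b - x) - 1); last by ring.
by rewrite subr_le0 (@le_trans _ _ 0)// mulr_ge0_le0// subr_le0.
Qed.

End cutoff.

(** * Functions whose integrals over a generating family vanish *)

Section vanishing_integrals.
Context d (T : measurableType d) (R : realType) (mu : {measure set T -> \bar R}).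
Variable F : T -> R.
Hypothesis IF : mu.-integrable setT (EFin \o F).

Lemma integral0_ae0 : (forall A, measurable A -> (\int[mu]_(x in A) (F x)%:E = 0)%E) ->
  {ae mu, forall x, F x = 0}.
Proof.
move=> F0; have mF := integrable_measurable IF.
have mP : measurable [set x | 0 <= F x].
  rewrite -[X in measurable X]setTI (_ : [set x | _] = F @^-1` `[0, +oo[%classic).
    exact: mF.
  by apply/seteqP; split=> x /=; rewrite in_itv/= andbT.
have mPC := measurableC mP.
have : (\int[mu]_x `|(F x)%:E|)%E = 0%E.
  rewrite -(setUv [set x | 0 <= F x]) ge0_integral_setU//; last 2 first.
  - by rewrite setUv; apply: measurableT_comp => //; exact/measurable_EFinP.
  - exact/disj_setPCl.
  rewrite (eq_integral (fun x => (F x)%:E)); last first.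
    by move=> x; rewrite inE /= => x0; rewrite ger0_norm.
  rewrite F0// add0e (eq_integral (fun x => (-1)%:E * (F x)%:E)%E); last first.
    move=> x; rewrite inE /= => /negP; rewrite -ltNge => x0.
    by rewrite ltr0_norm// -EFinM mulN1r.
  by rewrite integralZl ?F0 ?mule0//; exact: integrableS IF.
move=> /(ae_eq_integral_abs _ measurableT (measurable_int _ IF)).
by apply: filterS => x /(_ Logic.I) [].
Qed.

Lemma integral_setC0 A : measurable A -> (\int[mu]_x (F x)%:E = 0)%E ->
  (\int[mu]_(x in A) (F x)%:E = 0)%E -> (\int[mu]_(x in ~` A) (F x)%:E = 0)%E.
Proof.
move=> mA FT FA; have := FT; rewrite -(setUv A) integral_setU//; last 3 first.
- exact: measurableC.
- by rewrite setUv; exact: measurable_int IF.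
- exact/disj_setPCl.
by rewrite FA add0e.
Qed.

(** The sets on which [F] integrates to 0 form a Dynkin system: complements use that the total
    integral is 0, disjoint unions that [F] is integrable. *)
Lemma pi_system_integral0 (G : set (set T)) :
  @measurable _ T = <<s G >> -> setI_closed G -> G setT ->
  (forall A, G A -> (\int[mu]_(x in A) (F x)%:E = 0)%E) -> {ae mu, forall x, F x = 0}.
Proof.
move=> GE GI GT G0; apply: integral0_ae0 => A mA.
apply: (dynkin_induction (P := fun A => (\int[mu]_(x in A) (F x)%:E = 0)%E) GE GI) => //; last by rewrite -GE.
- exact: G0.
- by move=> S mS; apply: integral_setC0 => //; exact: G0.
move=> S mS tS S0; rewrite integral_bigcup//; last first.
  by apply: integrableS IF => //; exact: bigcup_measurable.
by apply: eseries0 => i _ _; exact: S0.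
Qed.

(** Dominated convergence with majorant |F|. *)
Lemma integral_cutoff0 (A : set T) (phi : nat -> T -> R) : measurable A ->
  (forall m, measurable_fun setT (phi m)) -> (forall m x, 0 <= phi m x <= 1) ->
  {ae mu, forall x, phi m x @[m --> \oo] --> (\1_A x : R)} ->
  (forall m, \int[mu]_x (phi m x * F x) = 0) -> (\int[mu]_(x in A) (F x)%:E = 0)%E.
Proof.
move=> mA mphi phi01 cphi phi0; have mF := integrable_measurable IF.
have phiF m x : `|phi m x * F x| <= `|F x|.
  have /andP[p0 p1] := phi01 m x.
  by rewrite normrM (ger0_norm p0) -[leRHS]mul1r ler_wpM2r.
have Iphi m : mu.-integrable setT (EFin \o (fun x => phi m x * F x)).
  apply: (le_integrable measurableT _ _ IF).
    by apply/measurable_EFinP; exact: measurable_funM.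
  by move=> x _; rewrite /= lee_fin.
have L0 m : (\int[mu]_x (phi m x * F x)%:E = 0)%E.
  rewrite -[LHS]fineK; last exact: integrable_fin_num (Iphi m).
  by congr EFin; exact: phi0.
have cphiF : {ae mu, forall x, setT x -> (phi m x * F x)%:E @[m --> \oo] --> (\1_A x * F x)%:E}.
  apply: ae_mono cphi => x cx _; apply: cvg_EFin; first by apply: nearW.
  by apply: cvgM => //; exact: cvg_cst.
have dom : {ae mu, forall x m, setT x -> (`|(phi m x * F x)%:E| <= `|(F x)%:E|)%E}.
  by apply: aeW => x m _ /=; rewrite lee_fin.
have m1 : measurable_fun setT (fun x => (\1_A x * F x)%:E).
  by apply/measurable_EFinP; apply: measurable_funM => //; exact: measurable_indic.
have [_ _ cv] := dominated_convergence measurableT (fun m => measurable_int _ (Iphi m)) m1 cphiF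
  (integrable_abse IF) dom.
have : (\int[mu]_x (\1_A x * F x)%:E = 0)%E.
  move: cv; rewrite [X in X @ _](_ : _ = fun=> 0%E); last by apply/funext => m; exact: L0.
  by move=> cv; apply/esym; apply: (cvg_unique _ (cvg_cst 0%E) cv).
move=> <-; rewrite [LHS]integral_mkcond; apply: eq_integral => x _.
by rewrite patchE indicE; case: (x \in A); rewrite ?mul1r ?mul0r.
Qed.

End vanishing_integrals.

(** * Head and tail of a row vector, and tensor products of test functions *)

Section head_tail.
Context (R : realType).
Implicit Types n : nat.

Definition rV_head n (x : 'rV[R]_n.+1) : R := x ord0 ord0.

Definition rV_tail n (x : 'rV[R]_n.+1) : 'rV[R]_n := @rsubmx R 1 1 n x.

Lemma rV_tailE n (x : 'rV[R]_n.+1) i j : rV_tail x i j = x ord0 (lift ord0 j).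
Proof. by rewrite /rV_tail mxE ord1; congr (x _ _); exact/val_inj. Qed.

Lemma cons_rV_head n (p : 'rV[R]_n * R) : rV_head (cons_rV p) = p.2.
Proof.
have -> : rV_head (cons_rV p) = row_mx (p.2%:M : 'M[R]_1) p.1 ord0 (lshift n (ord0 : 'I_1)).
  by rewrite /rV_head /cons_rV; congr (row_mx _ _ _ _); exact/val_inj.
by rewrite row_mxEl mxE.
Qed.

Lemma cons_rV_tail n (p : 'rV[R]_n * R) : rV_tail (cons_rV p) = p.1.
Proof. by rewrite /rV_tail /cons_rV; exact: row_mxKr. Qed.

Lemma cons_rVK n (x : 'rV[R]_n.+1) : cons_rV (rV_tail x, rV_head x) = x.
Proof.
apply/rowP => i; have [j ->|->] := unliftP ord0 i.
  by rewrite -(rV_tailE _ ord0) cons_rV_tail/= rV_tailE.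
by rewrite -/(rV_head _) cons_rV_head.
Qed.

Lemma rV_head_lin n (h : R) (v x : 'rV[R]_n.+1) : rV_head (h *: v + x) = h *: rV_head v + rV_head x.
Proof. by rewrite /rV_head !mxE. Qed.

Lemma rV_tail_lin n (h : R) (v x : 'rV[R]_n.+1) : rV_tail (h *: v + x) = h *: rV_tail v + rV_tail x.
Proof.
apply/rowP => j; rewrite rV_tailE [LHS]mxE [RHS]mxE rV_tailE; congr (_ + _).
by rewrite [LHS]mxE [RHS]mxE rV_tailE.
Qed.

Lemma measurable_rV_head n : measurable_fun setT (@rV_head n).
Proof. exact: measurable_coord_rV. Qed.

Lemma measurable_rV_tail n : measurable_fun setT (@rV_tail n).
Proof.
apply: measurable_fun_rV => i.
rewrite (_ : _ \o _ = coord_rV (lift ord0 i)); first exact: measurable_coord_rV.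
by apply/funext => x; rewrite /= /coord_rV rV_tailE.
Qed.

Lemma differentiable_rV_head n (x : 'rV[R]_n.+1) : differentiable (@rV_head n) x.
Proof. exact: differentiable_coord. Qed.

Lemma differentiable_rV_tail n (x : 'rV[R]_n.+1) : differentiable (@rV_tail n) x.
Proof. exact: (@differentiable_rsubmx _ 1 1 n). Qed.

End head_tail.

Section tensor_test_function.
Context (R : realType).

Lemma derive_comp_lin (V W : normedModType R) (L : V -> W) (f : W -> R) (x v : V) :
  (forall (h : R) u y, L (h *: u + y) = h *: L u + L y) ->
  'D_v (f \o L) x = 'D_(L v) f (L x).
Proof.
move=> lL; rewrite /derive.
have -> : (fun h : R => h^-1 *: ((f \o L \o shift x) (h *: v) - (f \o L) x)) =
          (fun h : R => h^-1 *: ((f \o shift (L x)) (h *: L v) - f (L x))) => //.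
by apply/funext => t /=; rewrite lL.
Qed.

Lemma derive_dir0 (W : normedModType R) (f : W -> R) (x : W) : 'D_0 f x = 0.
Proof.
rewrite /derive (_ : (fun h : R => h^-1 *: ((f \o shift x) (h *: (0 : W)) - f x)) = fun=> 0).
  exact: lim_cst.
by apply/funext => t; rewrite /= scaler0 add0r subrr scaler0.
Qed.

Definition tensor_fun n (psi : R -> R) (phi : 'rV[R]_n -> R) (x : 'rV[R]_n.+1) : R :=
  psi (rV_head x) * phi (rV_tail x).

Lemma differentiable_tensor n (psi : R -> R) (phi : 'rV[R]_n -> R) x :
  (forall t, derivable psi t 1) -> (forall y, differentiable phi y) ->
  differentiable (tensor_fun psi phi) x.
Proof.
move=> dpsi dphi; apply: differentiableM.
  apply: (@differentiable_comp _ _ _ _ (@rV_head R n) psi); first exact: differentiable_rV_head.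
  exact/derivable1_diffP.
by apply: (@differentiable_comp _ _ _ _ (@rV_tail R n) phi); first exact: differentiable_rV_tail.
Qed.

Lemma partial_tensor n (psi : R -> R) (phi : 'rV[R]_n -> R) i :
  (forall t, derivable psi t 1) -> (forall y, differentiable phi y) ->
  partial i (tensor_fun psi phi) =
  if unlift ord0 i is Some j then tensor_fun psi (partial j phi)
  else tensor_fun (derive1 psi) phi.
Proof.
move=> dpsi dphi; apply/funext => x; set v := delta_mx ord0 i : 'rV[R]_n.+1.
have dh : differentiable (psi \o @rV_head R n) x.
  apply: differentiable_comp; first exact: differentiable_rV_head.
  exact/derivable1_diffP.
have dt : differentiable (phi \o @rV_tail R n) x.
  by apply: differentiable_comp; first exact: differentiable_rV_tail.
rewrite /partial -/v (_ : tensor_fun psi phi = (psi \o @rV_head R n) * (phi \o @rV_tail R n))//.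
rewrite deriveM; [|exact: diff_derivable..].
rewrite (derive_comp_lin psi _ _ (@rV_head_lin R n)) (derive_comp_lin phi _ _ (@rV_tail_lin R n)).
have [j ij|ij] := unliftP ord0 i.
  have -> : rV_head v = 0 by rewrite /rV_head /v ij mxE (negbTE (neq_lift _ _)) andbF.
  have -> : rV_tail v = delta_mx ord0 j.
    by apply/rowP => k; rewrite rV_tailE !mxE ij (inj_eq lift_inj).
  by rewrite derive_dir0 scaler0 addr0.
have -> : rV_head v = 1 by rewrite /rV_head /v ij mxE !eqxx.
have -> : rV_tail v = 0.
  by apply/rowP => k; rewrite rV_tailE !mxE ij [lift _ _ == _]eq_sym (negbTE (neq_lift _ _)) andbF.
by rewrite derive_dir0 scaler0 add0r -derive1E /tensor_fun mulrC.
Qed.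

Lemma smooth_tensor n (psi : R -> R) (phi : 'rV[R]_n -> R) : smooth1 psi -> smooth_rV phi ->
  smooth_rV (tensor_fun psi phi).
Proof.
move=> spsi sphi s x.
(* A partial derivative acts on one factor only, so every iterated partial of a tensor is again a
   tensor of derivatives. *)
have : exists k s', foldr (@partial R n.+1) (tensor_fun psi phi) s =
    tensor_fun (derive1n k psi) (foldr (@partial R n) phi s').
  elim: s => [|i s ih]; first by exists 0%N, nil.
  have [k [s' IH]] := ih; rewrite /=.
  rewrite IH partial_tensor; [|exact: spsi|exact: sphi].
  case: unliftP => [j _|_]; first by exists k, (j :: s').
  by exists k.+1, s'.
by case=> k [s' ->]; apply: differentiable_tensor; [exact: spsi|exact: sphi].
Qed.

Lemma test_function_tensor n (psi : R -> R) (phi : 'rV[R]_n -> R) :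
  test_function `]0, 1[ psi -> test_function_rV (unit_cube R n) phi ->
  test_function_rV (unit_cube R n.+1) (tensor_fun psi phi).
Proof.
move=> [spsi [cpsi psiD]] [sphi [cphi phiD]]; split; first exact: smooth_tensor.
set K1 := closure [set t | psi t != 0] in cpsi psiD; set K2 := closure [set y | phi y != 0] in cphi phiD.
(* Compactness comes from [rV_compact], which handles products of sets of coordinates; K1 x K2 is
   therefore enclosed in the box of its coordinate projections. *)
pose A (i : 'I_n.+1) : set R :=
  if unlift ord0 i is Some j then (fun y : 'rV[R]_n => y ord0 j) @` K2 else K1.
have cA i : compact (A i).
  rewrite /A; case: unliftP => // j _.
  apply: continuous_compact => //; apply: continuous_subspaceT.
  exact: coord_continuous.
pose C : set 'rV[R]_n.+1 := (@rV_head R n @^-1` K1) `&` (@rV_tail R n @^-1` K2).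
have clC : closed C.
  apply: closedI; apply: preimage_closed.
  - by move=> x _; apply/differentiable_continuous; exact: differentiable_rV_head.
  - exact: closed_closure.
  - by move=> x _; apply/differentiable_continuous; exact: differentiable_rV_tail.
  - exact: closed_closure.
have sub : closure [set x | tensor_fun psi phi x != 0] `<=` C.
  rewrite [X in _ `<=` X](closure_id _).1//; apply: closure_subset => x /=.
  by rewrite mulf_eq0 negb_or => /andP[ex px]; split; exact: subset_closure.
have CA : C `<=` [set v | forall i, A i (v ord0 i)].
  move=> x [h1 h2] i; rewrite /A; case: unliftP => [j ->|->]; last exact: h1.
  by exists (rV_tail x) => //; rewrite rV_tailE.
split.
  apply: subclosed_compact (subset_trans sub CA); first exact: closed_closure.
  exact: rV_compact.
apply: subset_trans sub _ => x [/psiD h1 /phiD h2].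
by rewrite -(cons_rVK x); apply/unit_cube_cons; split.
Qed.

End tensor_test_function.

(** * The fundamental lemma on the interval and on the cube *)

Section fundamental_lemma_line.
Context (R : realType).
Local Notation mu := (mu01 R).

(** Only the trace on the interval has to be a ray; in this way the whole line belongs to the
    family, with b = 1. *)
Definition rays01 : set (set (measurableTypeR R)) :=
  [set A | measurable A /\ exists b : R, A `&` unit_itv R = [set x | x < b] `&` unit_itv R].

Lemma rays01_generate : @measurable _ (measurableTypeR R) = <<s rays01 >>.
Proof.
apply/seteqP; split; last first.
  apply: smallest_sub; first by apply: sigma_algebra_measurable.
  by move=> A [].
rewrite [X in X `<=` _]RGenInftyO.measurableE; apply: sub_sigma_algebra2 => A [b ->].
split; first exact: measurable_itv.
by exists b; apply/seteqP; split=> x; rewrite /= in_itv.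
Qed.

Lemma rays01_setI : setI_closed rays01.
Proof.
move=> A B [mA [a Aa]] [mB [b Bb]]; split; first exact: measurableI.
exists (Num.min a b); rewrite setIIl Aa Bb -setIIl; congr (_ `&` _).
by apply/seteqP; split=> x /=; rewrite lt_min; [move=> [-> ->]|move=> /andP].
Qed.

Lemma rays01_setT : rays01 setT.
Proof.
split=> //; exists 1; apply/seteqP; split=> x [_]; last by [].
by move=> x01; split=> //; move: x01; rewrite /unit_itv/= in_itv/= => /andP[].
Qed.

Lemma fundamental01 (F : R -> R) : mu.-integrable setT (EFin \o F) ->
  (forall psi, test_function `]0, 1[ psi -> \int[mu]_x (psi x * F x) = 0) ->
  {ae mu, forall x, F x = 0}.
Proof.
move=> IF F0; apply: (pi_system_integral0 IF rays01_generate rays01_setI rays01_setT).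
move=> A [mA [b Ab]].
apply: (integral_cutoff0 IF (phi := cutoff b) mA).
- by move=> m; apply: measurable_continuous; apply: test_function_continuous (test_function_cutoff b m).
- exact: cutoff_itv.
- apply: ae_mono (@mu01_ae_unit R) => x x01.
  have -> : \1_A x = (x < b)%R%:R :> R; last exact: cvg_cutoff.
  have xu : unit_itv R x by rewrite /unit_itv/= in_itv.
  rewrite indicE; congr ((nat_of_bool _)%:R); apply/idP/idP.
    by rewrite inE => Ax; have : (A `&` unit_itv R) x by []; rewrite Ab => -[].
  by move=> xb; rewrite inE; have : ([set x | x < b] `&` unit_itv R) x by []; rewrite -Ab => -[].
- by move=> m; apply: F0; exact: test_function_cutoff.
Qed.

End fundamental_lemma_line.

Section fundamental_lemma_cube.
Context (R : realType).

Definition quadrants n : set (set 'rV[R]_n) :=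
  [set A | measurable A /\ exists b : 'I_n -> R,
    A `&` unit_cube R n = [set x : 'rV[R]_n | forall i, x ord0 i < b i] `&` unit_cube R n].

Arguments quadrants n : clear implicits.

Lemma quadrants_generate n : @measurable _ 'rV[R]_n = <<s quadrants n >>.
Proof.
apply/seteqP; split; last first.
  apply: smallest_sub; first by apply: sigma_algebra_measurable.
  by move=> A [].
apply: smallest_sub; first exact: smallest_sigma_algebra.
rewrite -bigcup_seq/=; apply: bigcup_sub => i _ _ [B mB <-]; rewrite setTI; move: B mB.
have rays B : (@measurable _ (measurableTypeR R)) B -> <<s quadrants n >> (coord_rV i @^-1` B).
  rewrite [measurable]RGenInftyO.measurableE; move: B.
  apply: smallest_sub => /=.
    split => [|A mA|A mA] /=.
    - by rewrite preimage_set0; exact: sigma_algebra0.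
    - by rewrite setTD -preimage_setC -setTD; exact: sigma_algebraCD.
    - by rewrite preimage_bigcup; exact: sigma_algebra_bigcup.
  move=> _ [b ->]; apply: sub_sigma_algebra; split.
    rewrite -[X in measurable X]setTI; apply: measurable_coord_rV => //.

  (* On the cube the bound 1 imposes nothing on the other coordinates. *)
  exists (fun k => if k == i then b else 1); apply/seteqP; split=> x [] /=.
    rewrite in_itv/= => xb xc; split=> // k; case: eqP => [->//|_].
    by case/andP: (xc k).
  by move=> /(_ i); rewrite eqxx => xb xc; rewrite in_itv.
exact: rays.
Qed.

Lemma quadrants_setI n : setI_closed (quadrants n).
Proof.
move=> A B [mA [a Aa]] [mB [b Bb]]; split; first exact: measurableI.
exists (fun i => Num.min (a i) (b i)); rewrite setIIl Aa Bb -setIIl; congr (_ `&` _).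
apply/seteqP; split=> x /=; first by move=> [xa xb] i; rewrite lt_min xa xb.
by move=> xab; split=> i; have := xab i; rewrite lt_min => /andP[].
Qed.

Lemma quadrants_setT n : quadrants n setT.
Proof.
split=> //; exists (fun=> 1); apply/seteqP; split=> x [_]; last by [].
by move=> xc; split=> // i; case/andP: (xc i).
Qed.

Definition cutoff_rV n (b : 'I_n -> R) (m : nat) (x : 'rV[R]_n) : R :=
  \prod_(i < n) cutoff (b i) m (x ord0 i).

Lemma cutoff_rVS n (b : 'I_n.+1 -> R) m :
  cutoff_rV b m = tensor_fun (cutoff (b ord0) m) (cutoff_rV (fun i => b (lift ord0 i)) m).
Proof.
apply/funext => x; rewrite /cutoff_rV big_ord_recl; congr (_ * _).
by apply: eq_bigr => i _; rewrite rV_tailE.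
Qed.

Lemma test_function_cutoff_rV n (b : 'I_n -> R) m : test_function_rV (unit_cube R n) (cutoff_rV b m).
Proof.
elim: n b => [|n ih] b; last first.
  by rewrite cutoff_rVS; apply: test_function_tensor => //; exact: test_function_cutoff.
(* In dimension 0 the empty product is the constant 1 on a one-point space, where every set is
   compact. *)
split.
  case=> [|[]//] x /=.
  have -> : cutoff_rV b m = cst 1 by apply/funext => y; rewrite /cutoff_rV big_ord0.
  exact: differentiable_cst.
split; last by move=> x _ [].
apply: subclosed_compact (@closed_closure _ _) (@rV_compact R 0 (fun=> setT) _) _; first by case.
by move=> x _ [].
Qed.

Lemma cutoff_rV_itv n (b : 'I_n -> R) m x : 0 <= cutoff_rV b m x <= 1.
Proof.
rewrite /cutoff_rV; apply: (big_ind (fun y => 0 <= y <= 1)); first by rewrite ler01 lexx.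
  by move=> y z /andP[y0 y1] /andP[z0 z1]; rewrite mulr_ge0// mulr_ile1.
by move=> i _; exact: cutoff_itv.
Qed.

Lemma measurable_cutoff_rV n (b : 'I_n -> R) m : measurable_fun setT (cutoff_rV b m).
Proof.
rewrite /cutoff_rV; apply: measurable_prod => i _.
apply: (@measurableT_comp _ _ _ _ _ _ (cutoff (b i) m)) (measurable_coord_rV i).
by apply: continuous_measurable_fun; apply: test_function_continuous (test_function_cutoff _ m).
Qed.

Lemma cvg_cutoff_rV n (b : 'I_n -> R) x : unit_cube R n x ->
  cutoff_rV b m x @[m --> \oo] --> (\prod_(i < n) (x ord0 i < b i)%R%:R : R).
Proof.
move=> xc; rewrite /cutoff_rV; elim: (index_enum 'I_n) => [|i s ih].
  by rewrite big_nil; under eq_fun do rewrite big_nil; exact: cvg_cst.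
rewrite big_cons; under eq_fun do rewrite big_cons.
by apply: cvgM => //; exact: cvg_cutoff.
Qed.

Lemma mucube_ae n : {ae mucube R n, forall x, unit_cube R n x}.
Proof.
exists (~` unit_cube R n); split => //.
- by apply: measurableC; exact: measurable_unit_cube.
- by rewrite /mucube setICl measure0.
Qed.

Lemma fundamental_cube n (F : 'rV[R]_n -> R) : (mucube R n).-integrable setT (EFin \o F) ->
  (forall b m, \int[mucube R n]_x (cutoff_rV b m x * F x) = 0) ->
  {ae mucube R n, forall x, F x = 0}.
Proof.
move=> IF F0.
apply: (pi_system_integral0 IF (@quadrants_generate n) (@quadrants_setI n) (quadrants_setT n)).
move=> A [mA [b Ab]].
apply: (integral_cutoff0 IF (phi := cutoff_rV b) mA).
- exact: measurable_cutoff_rV.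
- exact: cutoff_rV_itv.
- apply: ae_mono (@mucube_ae n) => x xc.
  suff -> : \1_A x = \prod_(i < n) (x ord0 i < b i)%R%:R :> R by exact: cvg_cutoff_rV.
  have [xb|nxb] := pselect (forall i, x ord0 i < b i).
    rewrite big1 => [|i _]; last by rewrite xb.
    by rewrite indicE mem_set//; have : ([set x : 'rV[R]_n | forall i, x ord0 i < b i] `&` unit_cube R n) x by []; rewrite -Ab => -[].
  have /existsNP[i nxi] := nxb.
  rewrite (bigD1 i)//= (negbTE (introN idP nxi)) mul0r indicE memNset// => Ax.
  by have : (A `&` unit_cube R n) x by []; rewrite Ab => -[].
- by move=> m; exact: F0.
Qed.

End fundamental_lemma_cube.

(** * Sections of functions on the cube *)

Section cube_succ_transfer.
Context (R : realType) (n : nat).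
Local Notation P := (mucube R n \x mu01 R)%E.
Local Notation cons := (@cons_rV R n).

Lemma integral_cube_succ (f : 'rV[R]_n.+1 -> \bar R) : measurable_fun setT f ->
  (\int[mucube R n.+1]_x f x = \int[P]_z f (cons z))%E.
Proof.
have mc := @measurable_cons_rV R n.
have H (g : 'rV[R]_n.+1 -> \bar R) : measurable_fun setT g -> (forall x, 0 <= g x)%E ->
    (\int[mucube R n.+1]_x g x = \int[P]_z g (cons z))%E.
  move=> mg g0.
  have -> : (\int[mucube R n.+1]_x g x = \int[pushforward P cons]_x g x)%E.
    by apply: eq_measure_integral => A mA _; first [exact: (mucube_succ mA)|exact/esym/(mucube_succ mA)].
  by rewrite ge0_integral_pushforward.
move=> mf; rewrite integralE [in RHS]integralE.
rewrite (H (f^\+)%E)//; last exact: measurable_funepos.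
rewrite (H (f^\-)%E)//; last exact: measurable_funeneg.
by congr (_ - _)%E; apply: eq_integral => z _; rewrite ?funeposE ?funenegE.
Qed.

Lemma Rintegral_cube_succ (f : 'rV[R]_n.+1 -> R) : measurable_fun setT f ->
  \int[mucube R n.+1]_x f x = \int[P]_z f (cons z).
Proof. by move=> mf; rewrite /Rintegral integral_cube_succ//; exact/measurable_EFinP. Qed.

Lemma sqint_cube_succ (f : 'rV[R]_n.+1 -> R) : sqint (mucube R n.+1) f -> sqint P (f \o cons).
Proof.
move=> [mf f2]; split; first exact: measurableT_comp mf (@measurable_cons_rV R n).
by rewrite -(integral_cube_succ (f := fun x => (f x ^+ 2)%:E))//; apply/measurable_EFinP; exact: measurable_funX.
Qed.

Lemma ip_cube_succ (f g : 'rV[R]_n.+1 -> R) : measurable_fun setT f -> measurable_fun setT g ->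
  ip (mucube R n.+1) f g = ip P (f \o cons) (g \o cons).
Proof. by move=> mf mg; rewrite /ip Rintegral_cube_succ//; exact: measurable_funM. Qed.

Definition uncons_fun (F : 'rV[R]_n * R -> R) (x : 'rV[R]_n.+1) : R := F (rV_tail x, rV_head x).

Lemma uncons_funK F : uncons_fun F \o cons = F.
Proof.
by apply/funext => -[X t]; rewrite /uncons_fun /= cons_rV_tail cons_rV_head.
Qed.

Lemma measurable_uncons_fun (F : 'rV[R]_n * measurableTypeR R -> R) :
  measurable_fun setT F -> measurable_fun setT (uncons_fun F).
Proof.
move=> mF; apply: (@measurableT_comp _ _ _ _ _ _ F _ (fun x => (rV_tail x, rV_head x : measurableTypeR R))) => //.
by apply/measurable_fun_pairP; split; [exact: measurable_rV_tail|exact: measurable_rV_head].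
Qed.

Lemma ae_cube_succ (Q : 'rV[R]_n.+1 -> Prop) :
  {ae mucube R n.+1, forall x, Q x} -> {ae P, forall z, Q (cons z)}.
Proof.
move=> [N [mN N0 QN]]; exists (cons @^-1` N); split.
- by rewrite -[X in measurable X]setTI; exact: measurable_cons_rV.
- by rewrite -mucube_succ.
- by move=> z /= nQ; exact: QN.
Qed.

Lemma integrable_uncons_fun F : P.-integrable setT (EFin \o F) ->
  (mucube R n.+1).-integrable setT (EFin \o uncons_fun F).
Proof.
move=> IF; have mF := integrable_measurable IF.
have mU := measurable_uncons_fun mF.
apply/integrableP; split; first exact/measurable_EFinP.
rewrite integral_cube_succ; last by apply: measurableT_comp => //; exact/measurable_EFinP.
have [_] := integrableP _ _ _ IF; congr (_ < _)%E.
by apply: eq_integral => z _ /=; rewrite -[uncons_fun F (cons z)]/((uncons_fun F \o cons) z) uncons_funK.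
Qed.

End cube_succ_transfer.

(** * Continuous functions and test functions on the cube are measurable and bounded as required *)

Section continuous_measurable_rV.
Context (R : realType) (n : nat).

(** The sigma-algebra is generated by the coordinates, so an open set has to be written as a
    countable union of boxes with rational corners. *)
Lemma open_measurable_rV (U : set 'rV[R]_n) : open U -> measurable U.
Proof.
move=> oU.
pose box (ab : {ffun 'I_n -> rat * rat}) : set 'rV[R]_n :=
  [set x | forall i, ratr (ab i).1 < x ord0 i < ratr (ab i).2].
have mbox ab : measurable (box ab).
  rewrite (_ : box ab = \bigcap_(i in [set: 'I_n])
    (coord_rV i @^-1` (`](ratr (ab i).1 : R), (ratr (ab i).2 : R)[%classic : set R))).
    apply: fin_bigcap_measurable => [|i _]; first exact: finite_finset.
    by rewrite -[X in measurable X]setTI; exact: measurable_coord_rV.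
  apply/seteqP; split=> x /= h i; first by move=> _; rewrite /= in_itv/=; exact: h.
  by have := h i Logic.I; rewrite /= in_itv.
(* Boxes that are not inside [U] are replaced by the empty set, so the union runs over a full
   countable type. *)
pose cell ab := if pselect (box ab `<=` U) then box ab else set0.
rewrite (_ : U = \bigcup_ab cell ab).
  apply: countable_bigcupT_measurable; first exact: countableP.
  by move=> ab; rewrite /cell; case: pselect => ?; [exact: mbox|exact: measurable0].
apply/seteqP; split; last first.
  by move=> x [ab _]; rewrite /cell; case: pselect => [bU xab|//]; exact (bU _ xab).
move=> x Ux; have := open_nbhs_nbhs (conj oU Ux).
move=> /nbhs_ballP[e /= e0 xeU].
have /choice[a aP] i : exists q : rat * rat,
    x ord0 i - e < ratr q.1 < x ord0 i /\ x ord0 i < ratr q.2 < x ord0 i + e.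
  have xe1 : x ord0 i - e < x ord0 i by rewrite ltrBlDr ltrDl.
  have xe2 : x ord0 i < x ord0 i + e by rewrite ltrDl.
  have [q1] := @rat_in_itvoo _ (x ord0 i - e) (x ord0 i) xe1.
  have [q2] := @rat_in_itvoo _ (x ord0 i) (x ord0 i + e) xe2.
  by rewrite !in_itv/= => h2 h1; exists (q1, q2).
exists [ffun i => a i] => //; rewrite /cell; case: pselect => [bU|nbU].
  by move=> i; rewrite ffunE; have [/andP[_ ->] /andP[-> _]] := aP i.
exfalso; apply: (nbU) => y yb; apply: xeU; split=> // i j; rewrite ord1.
have [/andP[h1 h2] /andP[h3 h4]] := aP j; have := yb j; rewrite ffunE => /andP[h5 h6].
by rewrite /ball /= ltr_norml; apply/andP; split; lra.
Qed.

Lemma continuous_measurable_rV (f : 'rV[R]_n -> R) : continuous f -> measurable_fun setT f.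
Proof.
move=> cf; apply: (measurability _ (RGenOpens.measurableE R)).
move=> _ [_ [a [b ->] <-]]; rewrite setTI; apply: open_measurable_rV.
by apply: open_comp => [x _|]; [exact: cf|exact: interval_open].
Qed.

End continuous_measurable_rV.

Section test_function_rV_facts.
Context (R : realType) (n : nat).
Local Notation mu := (mucube R n).
Local Notation cube := (unit_cube R n).
Implicit Types phi : 'rV[R]_n -> R.

Lemma test_function_rV_continuous phi : test_function_rV cube phi -> continuous phi.
Proof. by move=> [sphi _] x; apply: differentiable_continuous; exact: (sphi nil). Qed.

Lemma test_function_rV_partial i phi : test_function_rV cube phi -> test_function_rV cube (partial i phi).
Proof.
move=> [sphi [cphi Dphi]]; split.
  by move=> s x; have := sphi (rcons s i) x; rewrite foldr_rcons.
have sub : closure [set x | partial i phi x != 0] `<=` closure [set x | phi x != 0].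
  rewrite [X in _ `<=` X](closure_id _).1; last exact: closed_closure.
  apply: closure_subset => x /= phi'x; apply: contrapT => nx.
  move/negP: phi'x; apply; apply/eqP.
  transitivity ('D_(delta_mx ord0 i) (cst (0 : R)) x); last by rewrite derive_cst.
  apply: near_eq_derive.
  have := open_nbhs_nbhs (conj (closed_openC (@closed_closure _ [set x | phi x != 0])) nx).
  apply: filterS => y ny; apply/eqP; apply: contrapT => /negP phiy.
  by apply: ny; exact: subset_closure.
split; last exact: subset_trans Dphi.
by apply: subclosed_compact cphi sub => //; exact: closed_closure.
Qed.

Lemma test_function_rV_bounded phi : test_function_rV cube phi -> exists M, forall x, `|phi x| <= M.
Proof.
move=> tphi; have [_ [cphi _]] := tphi.
have cont := test_function_rV_continuous tphi.
have := compact_bounded (continuous_compact (continuous_subspaceT cont) cphi).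
move=> [M [_ HM]]; exists (Num.max 0 (M + 1)) => x.
have [->|phix] := eqVneq (phi x) 0; first by rewrite normr0 le_max lexx.
rewrite le_max; apply/orP; right; apply: HM; first by rewrite ltrDl.
by exists x => //; exact: subset_closure.
Qed.

Lemma sqint_test_function_rV phi : test_function_rV cube phi -> sqint mu phi.
Proof.
move=> tphi; have [M HM] := test_function_rV_bounded tphi.
apply: (@sqint_bounded _ _ _ _ _ M) => //.
by apply: continuous_measurable_rV; exact: test_function_rV_continuous.
Qed.

End test_function_rV_facts.

(** * Test functions of mean zero are derivatives of test functions *)

Section test_function_antiderivative.
Context (R : realType).
Local Notation mu := (mu01 R).
Implicit Types psi : R -> R.

Lemma test_function_support psi : test_function `]0, 1[ psi ->
  exists a b, [/\ 0 < a, b < 1 & forall x, psi x != 0 -> a <= x <= b].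
Proof.
move=> [_ [_ sub]]; set K := closure _ in sub.
have oK : open (~` K) by apply: closed_openC; exact: closed_closure.
have far y : ~ `]0, 1[%classic y -> exists2 e : R, 0 < e & forall x, `|y - x| < e -> psi x = 0.
  move=> y01; have Ky : (~` K) y by move=> Ky; apply: y01; exact: sub.
  have /nbhs_ballP[e /= e0 He] := open_nbhs_nbhs (conj oK Ky).
  exists e => // x xe; apply/eqP; apply: contrapT => /negP psix.
  by apply: (He x xe); exact: subset_closure.
have [e1 e10 H1] := far 0 (ltac:(by rewrite /= in_itv/= ltxx)).
have [e2 e20 H2] := far 1 (ltac:(by rewrite /= in_itv/= ltxx andbF)).
exists e1, (1 - e2); split=> [//||x psix]; first by rewrite ltrBlDr ltrDl.
have : psi x != 0 by [].
have /andP[x0 x1] : 0 < x < 1.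
  have Kx : K x by exact: subset_closure.
  by have := sub x Kx; rewrite /= in_itv.
move=> nz; apply/andP; split; rewrite leNgt; apply: contra nz => hx; apply/eqP.
  by apply: H1; rewrite sub0r normrN gtr0_norm.
by apply: H2; rewrite gtr0_norm ?subr_gt0// ltrBlDl -ltrBlDr.
Qed.

Lemma test_function_integrable psi : test_function `]0, 1[ psi ->
  lebesgue_measure.-integrable setT (EFin \o psi).
Proof.
move=> tpsi; have Lpsi := sqint_test_function tpsi.
have [mpsi _] := Lpsi; have [mE] := integrableP _ _ _ (sqint_integrable Lpsi).
move=> Ioo; apply/integrableP; split; first exact/measurable_EFinP.
move: Ioo; rewrite integral_mu01; last exact: measurableT_comp mE.
rewrite [X in (X < _)%E -> _]integral_mkcond; congr (_ < _)%E; apply: eq_integral => x _.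
rewrite patchE; case: ifPn => // xu; rewrite /= (test_function_out tpsi) ?normr0//.
by move: xu; rewrite notin_setE.
Qed.

(** The integral from minus infinity vanishes to the left of the support of [psi], and to its right
    because it has reached the total integral 0. *)
Lemma test_function_antiderivative psi : test_function `]0, 1[ psi -> mean01 psi = 0 ->
  exists2 Psi, test_function `]0, 1[ Psi & derive1 Psi = psi.
Proof.
move=> tpsi psi0; have Ipsi := test_function_integrable tpsi.
have cpsi := test_function_continuous tpsi.
pose Psi x := \int[lebesgue_measure]_(t in `]-oo, x]) psi t.
have dPsi x : derivable Psi x 1 /\ derive1 Psi x = psi x.
  apply: (@continuous_FTC1 _ psi -oo%O x (x + 1)) => //.
  - by rewrite ltrDl.
  - by apply: integrableS Ipsi => //; exact: measurable_itv.
  - by rewrite ltNyr.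
  - exact: cpsi.
have Psi' : derive1 Psi = psi by apply/funext => x; exact: (dPsi x).2.
exists Psi => //; have [a [b [a0 b1 supp]]] := test_function_support tpsi.
have low x : x < a -> Psi x = 0.
  move=> xa; rewrite /Psi /Rintegral (eq_integral (fun=> 0%E)) ?integral0// => t.
  rewrite inE /= in_itv/= => tx; congr EFin; apply/eqP; apply: contrapT => /negP /supp /andP[at_ _].
  by have := le_lt_trans (le_trans at_ tx) xa; rewrite ltxx.
have high x : b < x -> Psi x = 0.
  move=> bx; rewrite -psi0 /mean01 /Psi /Rintegral integral_mu01; last first.
    by apply/measurable_EFinP; exact: measurable_continuous.
  congr fine; rewrite integral_mkcond [RHS]integral_mkcond; apply: eq_integral => t _.
  have [psit|psit] := eqVneq (psi t) 0; first by rewrite !patchE /= psit; do 2 case: ifP.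
  have /andP[t1 t2] := supp _ psit; rewrite !patchE !mem_set//.
    by rewrite /unit_itv/= in_itv/= (lt_le_trans a0 t1) (le_lt_trans t2 b1).
  by rewrite /= in_itv/= (le_trans t2)// ltW.
have sub : closure [set x | Psi x != 0] `<=` `[a, b].
  rewrite [X in _ `<=` X](closure_id _).1; last exact: itv_closed.
  apply: closure_subset => x /=; rewrite in_itv/=; apply: contraNT; rewrite negb_and -!ltNge.
  by case/orP => hx; [rewrite (low _ hx)|rewrite (high _ hx)].
split.
  case=> [x|k x]; first exact: (dPsi x).1.
  by rewrite derive1Sn Psi'; exact: tpsi.1.
split; first by apply: subclosed_compact sub; [exact: closed_closure|exact: segment_compact].
apply: subset_trans sub _ => x /=; rewrite !in_itv/= => /andP[h1 h2].
by rewrite (lt_le_trans a0 h1) (le_lt_trans h2 b1).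
Qed.

Lemma test_function_scale psi c : test_function `]0, 1[ psi -> test_function `]0, 1[ (fun x => c * psi x).
Proof.
move=> [spsi [cpsi sub]].
have cl : closure [set x | c * psi x != 0] `<=` closure [set x | psi x != 0].
  by apply: closure_subset => x /=; rewrite mulf_eq0 negb_or => /andP[].
split; first by apply: (smooth1M (f := fun=> c)) => //; apply/smooth1P => k; exact: smooth_upto_cst.
split; last exact: subset_trans sub.
by apply: subclosed_compact cpsi cl; exact: closed_closure.
Qed.

Lemma test_functionD psi1 psi2 : test_function `]0, 1[ psi1 -> test_function `]0, 1[ psi2 ->
  test_function `]0, 1[ (fun x => psi1 x + psi2 x).
Proof.
move=> [s1 [c1 d1]] [s2 [c2 d2]].
have cl : closure [set x | psi1 x + psi2 x != 0] `<=`
    closure [set x | psi1 x != 0] `|` closure [set x | psi2 x != 0].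
  rewrite -closureU; apply: closure_subset => x /=.
  by have [->|n1 _] := eqVneq (psi1 x) 0; [rewrite add0r; right|left].
split.
  apply/smooth1P => k; apply: smooth_uptoD; [exact: (smooth1P _).1 s1 k|exact: (smooth1P _).1 s2 k].
split.
  by apply: subclosed_compact (compactU c1 c2) cl; exact: closed_closure.
by apply: subset_trans cl _ => x [/d1|/d2].
Qed.

(** Some test function has nonzero mean and can be normalised: otherwise the fundamental lemma,
    applied to the constant 1, would make the unit interval a null set. *)
Lemma unit_test_function : exists2 rho : R -> R, test_function `]0, 1[ rho & mean01 rho = 1.
Proof.
have [[psi [tpsi psi0]]|H] := pselect (exists psi : R -> R, test_function `]0, 1[ psi /\ mean01 psi <> 0).
  exists (fun x => (mean01 psi)^-1 * psi x); first exact: test_function_scale.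
  by rewrite mean01Z; [rewrite mulVf//; exact/eqP|exact: sqint_test_function].
exfalso; have F0 (psi : R -> R) : test_function `]0, 1[ psi -> \int[mu]_x (psi x * 1) = 0.
  move=> tpsi; under eq_Rintegral do rewrite mulr1.
  by apply: contrapT => n0; apply: H; exists psi.
have [N [mN N0 sN]] := fundamental01 (sqint_integrable (sqint_cst mu 1)) F0.
have : mu setT = 0%E.
  apply/eqP; rewrite eq_le measure_ge0 andbT -N0; apply: le_measure; rewrite ?inE//.
  by move=> x _; apply: (sN x) => /= /eqP; rewrite oner_eq0.
by rewrite mu01T => /eqP; rewrite onee_eq0.
Qed.

End test_function_antiderivative.

(** * Coefficients of the sections of a function of two variables *)

Section sections_of_sqint.
Context d1 d2 (T1 : measurableType d1) (T2 : measurableType d2) (R : realType).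
Variable m1 : {finite_measure set T1 -> \bar R}.
Variable m2 : {finite_measure set T2 -> \bar R}.
Local Notation P := (m1 \x m2)%E.
Implicit Types u w : T1 * T2 -> R.

(** As [w] may fail to be integrable, Tonelli's theorem is applied to its positive and negative
    parts separately. *)
Lemma measurable_Rintegral_section w : measurable_fun setT w ->
  measurable_fun setT (fun X => \int[m2]_t w (X, t)).
Proof.
move=> mw; apply: measurableT_comp => //.
have mE : measurable_fun setT (EFin \o w) by exact/measurable_EFinP.
rewrite (_ : (fun X => _) = (fun X => fubini_F m2 ((EFin \o w)^\+)%E X - fubini_F m2 ((EFin \o w)^\-)%E X)%E).
  apply: emeasurable_funB.
  - by apply: measurable_fun_fubini_tonelli_F => //; exact: measurable_funepos.
  - by apply: measurable_fun_fubini_tonelli_F => //; exact: measurable_funeneg.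
apply/funext => X; rewrite [LHS]integralE /fubini_F.
by congr (_ - _)%E; apply: eq_integral => t _; rewrite ?funeposE ?funenegE.
Qed.

Definition tensor2 (f : T1 -> R) (g : T2 -> R) (z : T1 * T2) : R := f z.1 * g z.2.

Definition coef w (e : T2 -> R) (X : T1) : R := ip m2 (fun t => w (X, t)) e.

Lemma sqint_tensor2 f g : sqint m1 f -> sqint m2 g -> sqint P (tensor2 f g).
Proof. exact: sqint_tensor. Qed.

Lemma sqint_section_norm w : sqint P w ->
  m1.-integrable setT (EFin \o (fun X => ip m2 (fun t => w (X, t)) (fun t => w (X, t)))) /\
  ip P w w = \int[m1]_X ip m2 (fun t => w (X, t)) (fun t => w (X, t)).
Proof.
move=> Lw; have Iw := sqint_mul Lw Lw.
by split; [exact: integrable_section1 Iw|exact: Rintegral_section1 Iw].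
Qed.

Lemma sqint_coef w e : sqint P w -> sqint m2 e -> sqint m1 (coef w e).
Proof.
move=> Lw Le; have Iwe := sqint_mul Lw (sqint_snd m1 Le).
have mc : measurable_fun setT (coef w e) by exact: integrable_measurable (integrable_section1 Iwe).
split=> //; have [Iq _] := sqint_section_norm Lw.
pose q X := ip m2 (fun t => w (X, t)) (fun t => w (X, t)).
have := integrable_lty measurableT (integrableZl measurableT (ip m2 e e) Iq).
apply: le_lt_trans; apply: ae_ge0_le_integral => //.
- by move=> X _; rewrite lee_fin sqr_ge0.
- by apply/measurable_EFinP; exact: measurable_funX.
- by move=> X _; rewrite -EFinM lee_fin mulr_ge0// ip_ge0.
- exact: measurable_int (integrableZl measurableT (ip m2 e e) Iq).
apply: ae_mono (ae_sqint_section Lw) => X LX _.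
by rewrite -EFinM lee_fin mulrC; exact: cauchy_schwarz.
Qed.

Lemma ip_coef w f e : sqint P w -> sqint m1 f -> sqint m2 e ->
  ip m1 (coef w e) f = ip P w (tensor2 f e).
Proof.
move=> Lw Lf Le; have Lfe := sqint_tensor2 Lf Le.
rewrite [RHS](Rintegral_section1 (sqint_mul Lw Lfe)).
have mc := (sqint_coef Lw Le).1.
apply: ae_eq_Rintegral.
- by apply: measurable_funM; [exact: mc|exact: Lf.1].
- have m : measurable_fun setT (fun z => w z * tensor2 f e z).
    by apply: measurable_funM; [exact: Lw.1|exact: Lfe.1].
  exact: measurable_Rintegral_section m.
apply: ae_mono (ae_sqint_section Lw) => X LX; rewrite /coef /ip /tensor2 /=.
rewrite -RintegralZr//; last exact: sqint_mul.
by apply: eq_Rintegral => t _; ring.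
Qed.

Lemma bessel_coef N (e : 'I_N -> T2 -> R) w : orthonormal m2 e -> sqint P w ->
  \sum_(k < N) ip m1 (coef w (e k)) (coef w (e k)) <= ip P w w.
Proof.
move=> oe Lw; have Lc k := sqint_coef Lw (oe.1 k).
have [Iq ->] := sqint_section_norm Lw.
rewrite /ip -(Rintegral_sum _ (fun k => sqint_mul (Lc k) (Lc k))).
apply: ae_le_Rintegral => //.
- exact: integrable_EFin_sum (fun k => sqint_mul (Lc k) (Lc k)).
- by move=> X; apply: sumr_ge0 => k _; rewrite -expr2 sqr_ge0.
- by move=> X; exact: ip_ge0.
apply: ae_mono (ae_sqint_section Lw) => X LX.
have := bessel oe LX; congr (_ <= _); apply: eq_bigr => k _; exact: expr2.
Qed.

(** Pythagoras on almost every section, integrated over [X]. The projection error is bounded through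
    [B], and the coefficient errors enter with factor 1, so no constant is lost when the dimension
    grows. *)
Lemma pythagoras_coef N (e : 'I_N -> T2 -> R) u g C (c : 'I_N -> T1 -> R) :
  orthonormal m2 e -> sqint P u -> sqint P g -> (forall k, sqint m1 (c k)) -> 0 <= C ->
  {ae m1, forall X, ip m2 (oresidual m2 e (fun t => u (X, t))) (oresidual m2 e (fun t => u (X, t)))
     <= C * ip m2 (fun t => g (X, t)) (fun t => g (X, t))} ->
  let r := fun z => u z - \sum_(k < N) c k z.1 * e k z.2 in
  sqint P r /\ ip P r r <= C * ip P g g +
    \sum_(k < N) ip m1 (fun X => coef u (e k) X - c k X) (fun X => coef u (e k) X - c k X).
Proof.
move=> oe Lu Lg Lc C0 B r; have Le := oe.1.
have Lr : sqint P r.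
  by apply: sqintB => //; apply: sqint_sum => k; exact: sqint_tensor.
split=> //; have [Ir ->] := sqint_section_norm Lr.
have [Ig ->] := sqint_section_norm Lg.
have Ld k : sqint m1 (fun X => coef u (e k) X - c k X) by apply: sqintB => //; exact: sqint_coef.
have Id k := sqint_mul (Ld k) (Ld k).
rewrite {2}/ip -(Rintegral_sum _ Id) -RintegralZl// -RintegralD//; last 2 first.
- exact: (integrableZl measurableT C Ig).
- exact: integrable_EFin_sum Id.
apply: ae_le_Rintegral => //.
- exact: (integrableD measurableT (integrableZl measurableT C Ig) (integrable_EFin_sum _ Id)).
- by move=> X; exact: ip_ge0.
- by move=> X; rewrite addr_ge0 ?mulr_ge0 ?ip_ge0// sumr_ge0// => k _; rewrite -expr2 sqr_ge0.
apply: ae_mono (ae_and B (ae_sqint_section Lu)) => X [BX LX].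
have := pythagoras (fun k => c k X) oe LX; rewrite /= => E.
have R0 := ip_oproj_residual oe LX; rewrite /= in R0.
by rewrite {1 2}/r /= [leLHS]E -R0 lerD.
Qed.

(* Changing a function on a null set of sections makes all its sections square integrable. *)
Lemma sqint_regularize w : sqint P w -> exists w', [/\ sqint P w',
  forall X, sqint m2 (fun t => w' (X, t)), {ae m1, forall X t, w' (X, t) = w (X, t)} &
  {ae P, forall z, w z = w' z}].
Proof.
move=> Lw; have [mw w2] := Lw.
have mE : measurable_fun setT (fun z => (w z ^+ 2)%:E).
  by apply/measurable_EFinP; exact: measurable_funX.
pose Q X := (\int[m2]_t (w (X, t) ^+ 2)%:E)%E.
have mQ : measurable_fun setT Q.
  by apply: (measurable_fun_fubini_tonelli_F _ mE) => z; rewrite lee_fin sqr_ge0.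
pose D := [set X | (Q X < +oo)%E].
have mD : measurable D.
  by rewrite -[X in measurable X]setTI; exact: emeasurable_fun_infty_o.
pose w' z := \1_D z.1 * w z.
have mw' : measurable_fun setT w'.
  have mI : measurable_fun setT (\1_D : T1 -> R) by exact: measurable_indic.
  by apply: measurable_funM => //; apply: (measurableT_comp mI); exact: measurable_fst.
have DX : {ae m1, forall X, D X} by apply: ae_mono (ae_sqint_section Lw) => X [_].
have w'E X t : D X -> w' (X, t) = w (X, t) by move=> XD; rewrite /w' indicE mem_set// mul1r.
have w'w : {ae P, forall z, w z = w' z}.
  apply: ae_of_section; first exact: measurable_eq_set.
  by apply: ae_mono DX => X XD; apply: aeW => t; rewrite w'E.
exists w'; split=> //.
- exact: ae_sqint_eq w'w Lw.
- move=> X; have [XD|XD] := pselect (D X).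
    rewrite (_ : (fun t => _) = (fun t => w (X, t))); last by apply/funext => t; exact: w'E.
    by split=> //; exact: measurable_section.
  rewrite (_ : (fun t => _) = fun=> 0); first exact: sqint0.
  by apply/funext => t; rewrite /w' indicE memNset// mul0r.
- by apply: ae_mono DX => X XD t; exact: w'E.
Qed.

End sections_of_sqint.

(** * Weak derivatives restricted to sections and to coefficients *)

Section weak_derivatives_on_sections.
Context (R : realType) (n : nat).
Local Notation m1 := (mucube R n).
Local Notation mu := (mu01 R).
Local Notation P := (m1 \x mu)%E.
Local Notation cube := (unit_cube R n).
Implicit Types u g w : 'rV[R]_n * R -> R.

Lemma tensor2Br (phi : 'rV[R]_n -> R) (a b : R -> R) (c : R) :
  tensor2 phi (fun t => a t - c * b t) = fun z => tensor2 phi a z - c * tensor2 phi b z.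
Proof. by apply/funext => z; rewrite /tensor2; ring. Qed.

Lemma ip_fst_tensor2 (f phi : 'rV[R]_n -> R) (psi : R -> R) :
  sqint m1 f -> sqint m1 phi -> sqint mu psi ->
  ip P (fun z => f z.1) (tensor2 phi psi) = mean01 psi * ip m1 f phi.
Proof.
move=> Lf Lphi Lpsi; rewrite -ip_coef//; last exact: sqint_fst.
rewrite -ipZl//; congr ip; apply/funext => X; rewrite /coef /= mean01E ipC.
rewrite mulrC -(ipZr (f X) (sqint_cst mu 1) Lpsi).
by congr ip; apply/funext => t; rewrite mulr1.
Qed.

Lemma fundamental_product w : sqint P w ->
  (forall phi psi, test_function_rV cube phi -> test_function `]0, 1[ psi ->
     ip P w (tensor2 phi psi) = 0) ->
  {ae P, forall z, w z = 0}.
Proof.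
move=> Lw w0; have Iw : P.-integrable setT (EFin \o w).
  have := sqint_mul Lw (sqint_tensor (sqint_cst m1 1) (sqint_cst mu 1)).
  by congr integrable; apply/funext => z /=; rewrite !mulr1.
have mw := Lw.1; have mU := measurable_uncons_fun mw.
have ae0 : {ae mucube R n.+1, forall x, uncons_fun w x = 0}.
  apply: fundamental_cube; first exact: integrable_uncons_fun.
  move=> b m; rewrite Rintegral_cube_succ; last first.
    by apply: measurable_funM => //; exact: measurable_cutoff_rV.
  rewrite -(w0 (cutoff_rV (fun i => b (lift ord0 i)) m) (cutoff (b ord0) m)).
  - apply: eq_Rintegral => z _.
    rewrite -[uncons_fun w (cons_rV z)]/((uncons_fun w \o @cons_rV R n) z) uncons_funK.
    by rewrite cutoff_rVS /tensor_fun cons_rV_head cons_rV_tail /tensor2; ring.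
  - exact: test_function_cutoff_rV.
  - exact: test_function_cutoff.
have := ae_cube_succ ae0; apply: ae_mono => z.
by rewrite -[uncons_fun w (cons_rV z)]/((uncons_fun w \o @cons_rV R n) z) uncons_funK.
Qed.

Definition section_primitive g (z : 'rV[R]_n * R) : R := primitive (fun s => g (z.1, s)) z.2.

Lemma sqint_section_primitive g : sqint P g -> (forall X, sqint mu (fun t => g (X, t))) ->
  sqint P (section_primitive g).
Proof.
move=> Lg Lgs.
have mK : measurable_fun setT (section_primitive g).
  (* Joint measurability in X and t is obtained by integrating s out of a measurable function of the
     three variables X, t, s. *)
  pose G (y : ('rV[R]_n * measurableTypeR R) * measurableTypeR R) := ltind y.2 y.1.2 * g (y.1.1, y.2).
  suff mG : measurable_fun setT G by exact: (measurable_Rintegral_section mu mG).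
  have m11 : measurable_fun setT (fun y : ('rV[R]_n * measurableTypeR R) * measurableTypeR R => y.1.1).
    exact: (measurableT_comp measurable_fst measurable_fst).
  have m12 : measurable_fun setT (fun y : ('rV[R]_n * measurableTypeR R) * measurableTypeR R => y.1.2).
    exact: (measurableT_comp measurable_snd measurable_fst).
  apply: measurable_funM.
    have mp : measurable_fun setT (fun y : ('rV[R]_n * measurableTypeR R) * measurableTypeR R => (y.1.2, y.2)).
      by apply/measurable_fun_pairP; split => //; exact: measurable_snd.
    exact: (measurableT_comp (@measurable_lt_indic R) mp).
  have mp : measurable_fun setT (fun y : ('rV[R]_n * measurableTypeR R) * measurableTypeR R => (y.1.1, y.2)).
    by apply/measurable_fun_pairP; split => //; exact: measurable_snd.
  exact: (measurableT_comp Lg.1 mp).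
have [Iq _] := sqint_section_norm Lg.
split=> //; rewrite fubini_tonelli1; last 2 first.
- by apply/measurable_EFinP; exact: measurable_funX.
- by move=> z; rewrite lee_fin sqr_ge0.
apply: le_lt_trans (integrable_lty measurableT Iq); apply: ge0_le_integral => //.
- by move=> X _; apply: integral_ge0 => t _; rewrite lee_fin sqr_ge0.
- apply: (@measurable_fun_fubini_tonelli_F _ _ _ _ R mu (fun z => (section_primitive g z ^+ 2)%:E)).
    by apply/measurable_EFinP; exact: measurable_funX.
  by move=> z; rewrite lee_fin sqr_ge0.
- exact: measurable_int Iq.
move=> X _; rewrite /fubini_F /=.
set q := ip mu _ _.
have -> : q%:E = (\int[mu]_t q%:E)%E by rewrite integral_cst//= mu01T mule1.
apply: ge0_le_integral => //.
- by move=> t _; rewrite lee_fin sqr_ge0.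
- apply/measurable_EFinP; apply: measurable_funX.
  exact: measurable_section mK.
move=> t _; rewrite lee_fin /section_primitive /=.
(* The kernel has norm at most 1, so the primitive of a section is bounded, at every t, by the norm
   of that section. *)
apply: le_trans (cauchy_schwarz (ltind_sqint t) (Lgs X)) _.
rewrite -[leRHS]mul1r ler_wpM2r ?ip_ge0// -[leRHS](mean_cst (1 : R)).
apply: le_Rintegral => //.
- exact: sqint_mul (ltind_sqint t) (ltind_sqint t).
- exact: sqint_integrable (sqint_cst mu 1).
- by move=> s _; rewrite /ltind; case: (_ < _); rewrite ?mulr1 ?mulr0 ?ler01.
Qed.

(** The weak derivative in the second component of the pair, which is the head coordinate of the row
    vector, tested on products only. *)
Definition weak_last u g := forall phi psi,
  test_function_rV cube phi -> test_function `]0, 1[ psi ->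
  ip P u (tensor2 phi (derive1 psi)) = - ip P g (tensor2 phi psi).

(** The du Bois-Reymond argument with a parameter. The function v = u - K g has weak derivative 0.
    For a test function psi, psi - (mean psi) rho is the derivative of a test function, so v is
    orthogonal to phi times it. Hence v minus its [rho]-coefficient, a function of [X] alone, is
    orthogonal to all products and vanishes. *)
Lemma weak_last_regular u g : sqint P u -> sqint P g ->
  (forall X, sqint mu (fun t => u (X, t))) -> (forall X, sqint mu (fun t => g (X, t))) ->
  weak_last u g ->
  {ae m1, forall X, exists c, {ae mu, forall t, u (X, t) = c + primitive (fun s => g (X, s)) t}}.
Proof.
move=> Lu Lg Lus Lgs ug; have LK := sqint_section_primitive Lg Lgs.
have [rho trho rho1] := unit_test_function R.
have Lrho := sqint_test_function trho.
pose v z := u z - section_primitive g z.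
have Lv : sqint P v by exact: sqintB.
pose vr := coef mu v rho; have Lvr : sqint m1 vr by exact: sqint_coef.
have Lvr1 := sqint_fst mu Lvr.
pose w z := v z - vr z.1; have Lw : sqint P w by exact: sqintB.
have w0 : {ae P, forall z, w z = 0}.
  apply: fundamental_product => // phi psi tphi tpsi.
  have Lphi := sqint_test_function_rV tphi; have Lpsi := sqint_test_function tpsi.
  pose c := mean01 psi.
  have tk : test_function `]0, 1[ (fun t => psi t - c * rho t).
    have := test_functionD tpsi (test_function_scale (- c) trho); congr test_function.
    by apply/funext => t; rewrite mulNr.
  have k0 : mean01 (fun t => psi t - c * rho t) = 0.
    have := mean01D Lpsi (sqintZ (- c) Lrho); rewrite mean01Z// rho1 mulr1 subrr => <-.
    by congr mean01; apply/funext => t; rewrite mulNr.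
  have [Psi tPsi PsiE] := test_function_antiderivative tk k0.
  have LPsi := sqint_test_function tPsi.
  have LPsi' := sqint_test_function (test_function_derive1 tPsi).
  have Lpp := sqint_tensor2 Lphi Lpsi; have Lpr := sqint_tensor2 Lphi Lrho.
  have LpP := sqint_tensor2 Lphi LPsi'.
  have E1 : ip P w (tensor2 phi psi) = ip P v (tensor2 phi psi) - ip P (fun z => vr z.1) (tensor2 phi psi).
    exact: ipBl Lv Lvr1 Lpp.
  have E2 : ip m1 vr phi = ip P v (tensor2 phi rho) by exact: ip_coef Lv Lphi Lrho.
  have E3 : ip P v (tensor2 phi (derive1 Psi)) = ip P v (tensor2 phi psi) - c * ip P v (tensor2 phi rho).
    by rewrite PsiE tensor2Br (ipBr Lpp (sqintZ c Lpr) Lv) (ipZr c Lpr Lv).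
  have E4 : ip P v (tensor2 phi (derive1 Psi)) =
      ip P u (tensor2 phi (derive1 Psi)) - ip P (section_primitive g) (tensor2 phi (derive1 Psi)).
    exact: ipBl Lu LK LpP.
  rewrite E1 (ip_fst_tensor2 Lvr Lphi Lpsi) E2 -E3 E4.
  rewrite (ug _ _ tphi tPsi) -(ip_coef LK Lphi LPsi') -(ip_coef Lg Lphi LPsi).
  have -> : coef mu (section_primitive g) (derive1 Psi) = (fun X => -1 * coef mu g Psi X).
    apply/funext => X; rewrite mulN1r /coef /section_primitive /=.
    exact: ip_primitive_test_function.
  have Lc : sqint m1 (coef mu g Psi) by exact: sqint_coef.
  by rewrite (ipZl (-1) Lc Lphi) mulN1r subrr.
have mw0 : measurable [set z | w z = 0].
  by apply: measurable_eq_set => //; exact: Lw.1.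
have aeX : {ae m1, forall X, {ae mu, forall t, w (X, t) = 0}} :=
  @ae_to_section _ _ _ _ R m1 mu (fun z => w z = 0) mw0 w0.
apply: (ae_mono _ aeX) => X w0X; exists (vr X).
apply: (ae_mono _ w0X) => t; rewrite /w /v /section_primitive /= => /eqP.
by rewrite subr_eq0 subr_eq => /eqP.
Qed.

(** Both functions are replaced by almost everywhere equal ones all of whose sections are square
    integrable; almost every section is left unchanged. *)
Lemma du_bois_reymond u g : sqint P u -> sqint P g -> weak_last u g ->
  {ae m1, forall X, exists c, {ae mu, forall t, u (X, t) = c + primitive (fun s => g (X, s)) t}}.
Proof.
move=> Lu Lg ug.
have [u' [Lu' Lus u'u uu']] := sqint_regularize Lu.
have [g' [Lg' Lgs g'g gg']] := sqint_regularize Lg.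
have ug' : weak_last u' g'.
  move=> phi psi tphi tpsi.
  have Lphi := sqint_test_function_rV tphi; have Lpsi := sqint_test_function tpsi.
  have Lpsi' := sqint_test_function (test_function_derive1 tpsi).
  have := ug _ _ tphi tpsi.
  rewrite (ae_eq_ipr Lu.1 Lu'.1 (sqint_tensor2 Lphi Lpsi').1 uu').
  by rewrite (ae_eq_ipr Lg.1 Lg'.1 (sqint_tensor2 Lphi Lpsi).1 gg').
have H := weak_last_regular Lu' Lg' Lus Lgs ug'.
have aeX := ae_and H (ae_and u'u g'g).
apply: (ae_mono _ aeX) => X [[c Hc] [uX gX]]; exists c.
apply: (ae_mono _ Hc) => t; rewrite uX => ->; congr (_ + primitive _ _).
by apply/funext => s.
Qed.

(** The spline [e] is not a test function, so the hypothesis cannot be used with it directly.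
    Integrating u D + g phi over [X] leaves a function [F] of t that all test functions annihilate;
    thus [F] is 0 almost everywhere and may be paired with [e]. *)
Lemma coef_weak u g (D phi : 'rV[R]_n -> R) (e : R -> R) :
  sqint P u -> sqint P g -> sqint m1 D -> sqint m1 phi -> sqint mu e ->
  (forall psi, test_function `]0, 1[ psi ->
     ip P u (tensor2 D psi) = - ip P g (tensor2 phi psi)) ->
  ip m1 (coef mu u e) D = - ip m1 (coef mu g e) phi.
Proof.
move=> Lu Lg LD Lphi Le ug.
pose G z := u z * D z.1 + g z * phi z.1.
have IG : P.-integrable setT (EFin \o G).
  exact: (integrableD measurableT (sqint_mul Lu (sqint_fst mu LD)) (sqint_mul Lg (sqint_fst mu Lphi))).
pose F t := \int[m1]_X G (X, t).
have IF := integrable_section2 IG.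
have key psi : sqint mu psi -> \int[mu]_t (psi t * F t) = ip P u (tensor2 D psi) + ip P g (tensor2 phi psi)
    /\ P.-integrable setT (EFin \o (fun z => psi z.2 * G z)).
  move=> Lpsi; have I1 := sqint_mul Lu (sqint_tensor2 LD Lpsi).
  have I2 := sqint_mul Lg (sqint_tensor2 Lphi Lpsi).
  have IH : P.-integrable setT (EFin \o (fun z => psi z.2 * G z)).
    have := integrableD measurableT I1 I2; congr integrable; apply/funext => z /=.
    by congr EFin; rewrite /tensor2 /G; ring.
  split=> //; rewrite /ip -RintegralD//.
  transitivity (\int[P]_z (psi z.2 * G z)); last first.
    by apply: eq_Rintegral => z _; rewrite /tensor2 /G; ring.
  rewrite (Rintegral_section2 IH) /=; apply: ae_eq_Rintegral.
  - by apply: measurable_funM; [exact: Lpsi.1|exact: integrable_measurable IF].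
  - exact: integrable_measurable (integrable_section2 IH).
  by apply: ae_mono (ae_integrable2 IG) => t It; rewrite /F -RintegralZl.
have F0 : {ae mu, forall t, F t = 0}.
  apply: fundamental01 => // psi tpsi.
  by rewrite (key psi (sqint_test_function tpsi)).1 ug// addNr.
have [Ke _] := key _ Le.
rewrite (ip_coef Lu LD Le) (ip_coef Lg Lphi Le).
apply/eqP; rewrite -addr_eq0 -Ke -(mean_cst (0 : R)); apply/eqP.
apply: ae_eq_Rintegral => //.
  by apply: measurable_funM; [exact: Le.1|exact: integrable_measurable IF].
by apply: ae_mono F0 => t ->; rewrite mulr0.
Qed.

End weak_derivatives_on_sections.

(** * Tensor-product splines *)

Section tensor_approximation.
Context (R : realType).
Variables (h : R) (p : nat).
Hypotheses (h0 : 0 < h) (hN : h * (Num.truncn h^-1)%:R = 1).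
Local Notation mu := (mu01 R).

Lemma tensor_spline_tilde_fin n (I : finType) (c : I -> R) (s : I -> 'I_n -> R -> R) :
  (forall k l, spline_tilde p h (s k l)) ->
  tensor_spline_tilde p h (fun x : 'rV[R]_n => \sum_k c k * \prod_(l < n) s k l (x ord0 l)).
Proof.
move=> Hs; exists #|I|, (fun k => c (enum_val k)), (fun k => s (enum_val k)); split=> // x.
by rewrite -(big_enum_val (A := I) (fun k => c k * \prod_(l < n) s k l (x ord0 l))).
Qed.

(** The inner sums have lengths depending on [k], so the double sum is flattened over dependent
    pairs of indices; the head factor is inserted at position 0. *)
Lemma tensor_spline_tilde_succ n N (e : 'I_N -> R -> R) (w : 'I_N -> 'rV[R]_n -> R) :
  (forall k, spline_tilde p h (e k)) -> (forall k, tensor_spline_tilde p h (w k)) ->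
  tensor_spline_tilde p h (fun x : 'rV[R]_n.+1 => \sum_(k < N) w k (rV_tail x) * e k (rV_head x)).
Proof.
move=> He Hw.
have /choice[f fP] k : exists t : {m : nat & (('I_m -> R) * ('I_m -> 'I_n -> R -> R))%type},
    (forall i l, spline_tilde p h ((tagged t).2 i l)) /\
    forall x, w k x = \sum_(i < tag t) (tagged t).1 i * \prod_(l < n) (tagged t).2 i l (x ord0 l).
  by have [m [c [s [Hs wE]]]] := Hw k; exists (existT _ m (c, s)).
pose c (q : {k : 'I_N & 'I_(tag (f k))}) : R := (tagged (f (tag q))).1 (tagged q).
pose s (q : {k : 'I_N & 'I_(tag (f k))}) (l : 'I_n.+1) : R -> R :=
  if unlift ord0 l is Some l' then (tagged (f (tag q))).2 (tagged q) l' else e (tag q).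
have Hs q l : spline_tilde p h (s q l).
  by rewrite /s; case: unliftP => [l' _|_]; [exact: (fP _).1|exact: He].
have := tensor_spline_tilde_fin c Hs; congr tensor_spline_tilde; apply/funext => x.
pose F k (i : 'I_(tag (f k))) : R :=
  (tagged (f k)).1 i * ((\prod_(l < n) (tagged (f k)).2 i l (rV_tail x ord0 l)) * e k (rV_head x)).
have -> : \sum_(k < N) w k (rV_tail x) * e k (rV_head x) = \sum_(k < N) \sum_(i < tag (f k)) F k i.
  by apply: eq_bigr => k _; rewrite (fP k).2 mulr_suml; apply: eq_bigr => i _; rewrite /F mulrA.
have -> : \sum_(k < N) \sum_(i < tag (f k)) F k i =
    \sum_(q : {k : 'I_N & 'I_(tag (f k))}) F (tag q) (tagged q).
  exact: (sig_big_dep (J := fun k : 'I_N => 'I_(tag (f k))) xpredT (fun _ => xpredT) F).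
rewrite /= /F /c.
apply: eq_bigr => q _; rewrite big_ord_recl /s unlift_none; congr (_ * _).
rewrite mulrC; congr (_ * _); apply: eq_bigr => l _.
by rewrite liftK rV_tailE.
Qed.

Lemma tensor_spline_tilde_cst0 (c : R) :
  tensor_spline_tilde p h (fun _ : 'rV[R]_0 => c).
Proof.
exists 1%N, (fun=> c), (fun _ _ => fun=> 0); split; first by move=> _ [].
by move=> x; rewrite big_ord1 big_ord0 mulr1.
Qed.

Lemma sqint_uncons_fun n (W : 'rV[R]_n * R -> R) : sqint (mucube R n \x mu)%E W ->
  sqint (mucube R n.+1) (uncons_fun W).
Proof.
move=> [mW W2]; have mU := measurable_uncons_fun mW; split=> //.
rewrite integral_cube_succ; last by apply/measurable_EFinP; exact: measurable_funX.
move: W2; congr (_ < _)%E; apply: eq_integral => z _.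
by rewrite -[uncons_fun W (cons_rV z)]/((uncons_fun W \o @cons_rV R n) z) uncons_funK.
Qed.

(* The constant is absorbed because constants lie in the spline space. *)
Lemma oresidual_primitive_cst N (e : 'I_N -> R -> R) f g c :
  orthonormal mu e -> aespan mu e (fun=> 1) -> sqint mu f -> sqint mu g ->
  {ae mu, forall t, f t = c + primitive g t} ->
  ip mu (oresidual mu e (primitive g)) (oresidual mu e (primitive g)) <= h ^+ 2 * ip mu g g ->
  ip mu (oresidual mu e f) (oresidual mu e f) <= h ^+ 2 * ip mu g g.
Proof.
move=> oe e1 Lf Lg fE; apply: le_trans.
have LK := sqint_primitive Lg; have L1 := sqint_cst mu 1.
pose a := oresidual mu e (primitive g); pose b := oresidual mu e (fun=> 1 : R).
have La : sqint mu a by exact: sqint_oresidual.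
have Lb : sqint mu b by exact: sqint_oresidual.
(* The coefficients of c + [primitive g]: with them the error is [a] plus [c] times [b], and [b] has
   norm zero. *)
pose c' i := ip mu (primitive g) (e i) + c * ip mu (fun=> 1) (e i).
apply: le_trans (oproj_best c' oe Lf) _ => /=.
have Lc' : sqint mu (lincomb e c') by exact: sqint_lincomb _ oe.1.
have Lr := sqintB Lf Lc'; have Lcb := sqintZ c Lb; have Lab := sqintD La Lcb.
rewrite le_eqVlt; apply/orP; left; apply/eqP.
transitivity (ip mu (fun t => a t + c * b t) (fun t => a t + c * b t)).
  apply: ae_eq_Rintegral.
  - by apply: measurable_funM; exact: Lr.1.
  - by apply: measurable_funM; exact: Lab.1.
  apply: (ae_mono _ fE) => t ->.
  have -> : c + primitive g t - lincomb e c' t = a t + c * b t; last by [].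
  rewrite /a /b /oresidual mulrBr mulr1.
  have -> : lincomb e c' t = oproj mu e (primitive g) t + c * oproj mu e (fun=> 1) t.
    rewrite /oproj /lincomb mulr_sumr -big_split/=; apply: eq_bigr => i _.
    by rewrite /c'; ring.
  ring.
have b0 : ip mu b b = 0 := e1.
rewrite (ipDl La Lcb Lab) (ipDr La Lcb La) (ipDr La Lcb Lcb).
rewrite !(ipZl c Lb) // !(ipZr c Lb) // b0 (ipC mu a b) (ip_eq0l Lb La b0).
by rewrite !mulr0 !addr0.
Qed.

Definition weak_cube n (i : 'I_n) (u g : 'rV[R]_n -> R) := forall phi,
  test_function_rV (unit_cube R n) phi ->
  ip (mucube R n) u (partial i phi) = - ip (mucube R n) g phi.

Lemma weak_cube_tensor n (i : 'I_n.+1) (u g : 'rV[R]_n.+1 -> R) phi psi :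
  measurable_fun setT u -> measurable_fun setT g -> weak_cube i u g ->
  test_function_rV (unit_cube R n) phi -> test_function `]0, 1[ psi ->
  ip (mucube R n \x mu)%E (u \o @cons_rV R n)
    (if unlift ord0 i is Some j then tensor2 (partial j phi) psi else tensor2 phi (derive1 psi)) =
  - ip (mucube R n \x mu)%E (g \o @cons_rV R n) (tensor2 phi psi).
Proof.
move=> mu_ mg ug tphi tpsi; have tt := test_function_tensor tpsi tphi.
have tE (f : 'rV[R]_n -> R) (k : R -> R) : tensor_fun k f \o @cons_rV R n = tensor2 f k.
  by apply/funext => z; rewrite /tensor_fun /tensor2 /= cons_rV_head cons_rV_tail mulrC.
have mt := (sqint_test_function_rV tt).1.
have mt' := (sqint_test_function_rV (test_function_rV_partial i tt)).1.
have := ug _ tt; rewrite (ip_cube_succ mu_ mt') (ip_cube_succ mg mt) tE => <-; congr ip.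
rewrite partial_tensor; [|exact: (tpsi.1 0%N)|exact: (tphi.1 nil)].
by case: unliftP => [j _|_]; rewrite tE.
Qed.

Lemma tensor_spline_approximation n (u : 'rV[R]_n -> R) (g : 'I_n -> 'rV[R]_n -> R) :
  sqint (mucube R n) u -> (forall i, sqint (mucube R n) (g i)) ->
  (forall i, weak_cube i u (g i)) ->
  exists w, [/\ tensor_spline_tilde p h w, sqint (mucube R n) w &
    ip (mucube R n) (fun x => u x - w x) (fun x => u x - w x) <=
    h ^+ 2 * \sum_(i < n) ip (mucube R n) (g i) (g i)].
Proof.
elim: n u g => [|n ih] u g Lu Lg ug.
  (* The space of row vectors of length 0 is a single point, so [u] is its own approximation. *)
  have uE : u = fun=> u 0 by apply/funext => x; congr u; apply/rowP => -[].
  exists u; split=> //; first by rewrite uE; exact: tensor_spline_tilde_cst0.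
  rewrite (_ : (fun x => u x - u x) = fun=> 0); last by apply/funext => x; rewrite subrr.
  by rewrite ip0l big_ord0 mulr0.
have [M [e [oe Ce e1 Be]]] := primitive_approxP h0 hN true p.
have Le := oe.1.
have Se k : spline_tilde p h (e k) by exact: (reduced_spline_tilde h0 hN).
pose U := u \o @cons_rV R n; pose G i := g i \o @cons_rV R n.
have LU : sqint (mucube R n \x mu)%E U by exact: sqint_cube_succ.
have LG i : sqint (mucube R n \x mu)%E (G i) by exact: sqint_cube_succ.
have mu_ := Lu.1; have mg i := (Lg i).1.
(* The induction hypothesis is applied to each coefficient of [u]; its weak partial derivatives are
   the coefficients of those of [u] in the tail directions. *)
have /choice[w wP] k : exists w, [/\ tensor_spline_tilde p h w, sqint (mucube R n) w &
    ip (mucube R n) (fun x => coef mu U (e k) x - w x) (fun x => coef mu U (e k) x - w x) <=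
    h ^+ 2 * \sum_(i < n) ip (mucube R n) (coef mu (G (lift ord0 i)) (e k)) (coef mu (G (lift ord0 i)) (e k))].
  apply: (ih (coef mu U (e k)) (fun i => coef mu (G (lift ord0 i)) (e k))).
  - exact: sqint_coef.
  - by move=> i; exact: sqint_coef.
  move=> i phi tphi; apply: coef_weak => //.
  - exact: sqint_test_function_rV (test_function_rV_partial i tphi).
  - exact: sqint_test_function_rV.
  move=> psi tpsi; have := weak_cube_tensor mu_ (mg (lift ord0 i)) (ug (lift ord0 i)) tphi tpsi.
  by rewrite liftK.
have Lw k : sqint (mucube R n) (w k) by have [] := wP k.
have wl : weak_last U (G ord0).
  move=> phi psi tphi tpsi; have := weak_cube_tensor mu_ (mg ord0) (ug ord0) tphi tpsi.
  by rewrite unlift_none.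
have B : {ae mucube R n, forall X,
    ip mu (oresidual mu e (fun t => U (X, t))) (oresidual mu e (fun t => U (X, t))) <=
    h ^+ 2 * ip mu (fun t => G ord0 (X, t)) (fun t => G ord0 (X, t))}.
  have aeX := ae_and (du_bois_reymond LU (LG ord0) wl)
    (ae_and (ae_sqint_section LU) (ae_sqint_section (LG ord0))).
  apply: (ae_mono _ aeX) => X [[c Hc] [LUX LGX]].
  apply: (oresidual_primitive_cst oe (e1 isT) LUX LGX Hc).
  exact: Be.
have h2 : 0 <= h ^+ 2 by exact: sqr_ge0.
have [Lr Br] := pythagoras_coef oe LU (LG ord0) Lw h2 B.
pose W (z : 'rV[R]_n * R) := \sum_(k < M) w k z.1 * e k z.2.
have LW : sqint (mucube R n \x mu)%E W.
  by apply: sqint_sum => k; exact: sqint_tensor.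
exists (uncons_fun W); split.
- exact: (tensor_spline_tilde_succ Se (fun k => let: And3 H _ _ := wP k in H)).
- exact: sqint_uncons_fun.
have Ldiff := sqintB Lu (sqint_uncons_fun LW).
rewrite (ip_cube_succ Ldiff.1 Ldiff.1).
have -> : (fun x => u x - uncons_fun W x) \o @cons_rV R n = fun z => U z - \sum_(k < M) w k z.1 * e k z.2.
  apply/funext => z; rewrite /=; congr (_ - _).
  by rewrite -[uncons_fun W (cons_rV z)]/((uncons_fun W \o @cons_rV R n) z) uncons_funK.
apply: le_trans Br _; rewrite big_ord_recl mulrDr; apply: lerD.
  by rewrite (ip_cube_succ (mg ord0) (mg ord0)).
apply: (@le_trans _ _ (\sum_(k < M) h ^+ 2 * \sum_(i < n)
    ip (mucube R n) (coef mu (G (lift ord0 i)) (e k)) (coef mu (G (lift ord0 i)) (e k)))).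
  by apply: ler_sum => k _; have [] := wP k.
(* With the sum over [k] taken inside, Bessel's inequality recovers each tail partial derivative of
   [u]. *)
rewrite -mulr_sumr ler_wpM2l// exchange_big/=; apply: ler_sum => i _.
rewrite (ip_cube_succ (mg (lift ord0 i)) (mg (lift ord0 i))).
exact: bessel_coef.
Qed.

End tensor_approximation.

(** * Translation to the norms and weak partial derivatives of the statement *)

Section cube_sobolev.
Context (R : realType) (n : nat).
Local Notation cube := (unit_cube R n).
Implicit Types u g : 'rV[R]_n -> R.

Lemma sqint_in_L2 u : in_L2 (lebesgue_rV n) cube u -> sqint (mucube R n) (u \_ cube).
Proof. by move=> /(in_L2P (nu := mucube R n) (@measurable_unit_cube R n) (fun _ _ => erefl)). Qed.

Lemma ip_test_function_rV u phi : in_L2 (lebesgue_rV n) cube u -> test_function_rV cube phi ->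
  ip (mucube R n) (u \_ cube) phi = \int[lebesgue_rV n]_(x in cube) (u x * phi x).
Proof.
move=> Lu tphi; have LU := sqint_in_L2 Lu; have Lphi := sqint_test_function_rV tphi.
rewrite /ip (@Rintegral_restricted _ _ _ (lebesgue_rV n) (mucube R n) cube)//.
- by apply: eq_Rintegral => x xc; rewrite patchE xc.
- exact: measurable_unit_cube.
- by apply: measurable_funM; [exact: LU.1|exact: Lphi.1].
Qed.

Lemma weak_cube_partial i u g : in_L2 (lebesgue_rV n) cube u -> in_L2 (lebesgue_rV n) cube g ->
  is_weak_partial cube i u g -> weak_cube i (u \_ cube) (g \_ cube).
Proof.
move=> Lu Lg ug phi tphi; rewrite !ip_test_function_rV//; first exact: ug.
exact: test_function_rV_partial.
Qed.

Lemma L2norm_ip u g : sqint (mucube R n) u -> {in cube, u =1 g} ->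
  L2norm (lebesgue_rV n) cube g = (Num.sqrt (ip (mucube R n) u u))%:E.
Proof.
move=> Lu ug; have mu_ := Lu.1.
have E : g \_ cube = u \_ cube.
  by apply/funext => x; rewrite !patchE; case: ifPn => // xc; rewrite ug.
have mD : measurable_fun setT (u \_ cube).
  by apply/(measurable_restrictT u (@measurable_unit_cube R n)); exact: measurable_funTS.
rewrite (L2normE (nu := mucube R n) (@measurable_unit_cube R n) (fun _ _ => erefl)); last by rewrite E.
rewrite E (_ : (\int[mucube R n]_x _)%E = (ip (mucube R n) u u)%:E); last first.
  rewrite -sqnormE//; apply: ae_eq_integral => //.
  - by apply/measurable_EFinP; exact: measurable_funX.
  - by apply/measurable_EFinP; exact: measurable_funX.
  - by apply: ae_mono (@mucube_ae R n) => x xc _; rewrite patchE mem_set.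
by rewrite poweR_EFin powR12_sqrt// ip_ge0.
Qed.

End cube_sobolev.

Theorem theorem8 (R : realType) (d : nat) (hd : (0 < d)%N)
    (u : 'rV[R]_d -> R) (hu : sobolev1 (unit_cube R d) u)
    (h : R) (hh : grid_size h) (p : nat) (hp : h * p%:R < 1) :
  exists2 w : 'rV[R]_d -> R, tensor_spline_tilde p h w &
    (L2norm (lebesgue_rV d) (unit_cube R d) (u \- w)%R <=
     (Num.sqrt (2 * d)%:R * h)%:E * H1_seminorm (unit_cube R d) u)%E.
Proof.
have [h0 hnat] := hh; have [Lu ug] := hu.
have hN : h * (Num.truncn h^-1)%:R = 1 by rewrite truncnK// mulfV// gt_eqF.
pose g i := weak_partial (unit_cube R d) i u.
have gP i : in_L2 (lebesgue_rV d) (unit_cube R d) (g i) /\ is_weak_partial (unit_cube R d) i u (g i).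
  have [f Lf fP] := ug i.
  (* Since [hu] provides a square-integrable weak partial derivative, the chosen one is genuine and
     not the default 0. *)
  exact: (xgetPex (fun=> 0) (ex_intro (fun f => in_L2 _ _ f /\ is_weak_partial _ i u f) f (conj Lf fP))).
have LU := sqint_in_L2 Lu; have LG i := sqint_in_L2 (gP i).1.
have [w [tw Lw wE]] := tensor_spline_approximation p h0 hN LU LG
  (fun i => weak_cube_partial Lu (gP i).1 (gP i).2).
exists w => //.
rewrite (L2norm_ip (sqintB LU Lw)); last by move=> x xc; rewrite patchE xc.
rewrite /H1_seminorm.
have gE i : L2norm (lebesgue_rV d) (unit_cube R d) (g i) =
    (Num.sqrt (ip (mucube R d) ((g i) \_ (unit_cube R d)) ((g i) \_ (unit_cube R d))))%:E.
  by apply: L2norm_ip => // x xc; rewrite patchE xc.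
under eq_bigr => i _ do rewrite gE -EFin_expe sqr_sqrtr ?ip_ge0//.
set S := fun i => _ in wE; rewrite sumEFin poweR_EFin.
set q := \sum_(i < d) _ in wE *.
have q0 : 0 <= q by apply: sumr_ge0 => i _; exact: ip_ge0.
rewrite powR12_sqrt// -EFinM lee_fin.
apply: (@le_trans _ _ (h * Num.sqrt q)).
  rewrite -(sqr_sqrtr q0) -exprMn in wE.
  by have := ler_wsqrtr wE; rewrite sqrtr_sqr ger0_norm ?mulr_ge0 ?sqrtr_ge0// ltW.
(* The bound obtained is h |u|; as [d] is positive, 1 <= sqrt (2d). *)
rewrite -mulrA -[leLHS]mul1r ler_wpM2r ?mulr_ge0 ?sqrtr_ge0 ?(ltW h0)//.
by rewrite -[leLHS]sqrtr1 ler_wsqrtr// ler1n muln_gt0 hd.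
Qed.
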